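(* Let $g\ge0$ and $r>1$ be integers and put $n=2g+r-1$. The Hilbert series of the filtered algebras $\mathcal L_{\Sigma_{g,r}}^{\mathcal U_q(\mathfrak{sl}_2)}$ and $\mathrm{Sk}_q(\Sigma_{g,r})$, and of the Askey--Wilson algebra $\mathrm{AW}(n)$, is $$h(t)=\frac{(1+t)^{n-2}}{(1-t)^{n}(1-t^2)^{2n-3}}\left(\sum_{k=0}^{n-2}\binom{n-2}{k}^2t^{2k}-\sum_{k=0}^{n-3}\binom{n-2}{k}\binom{n-2}{k+1}t^{2k+1}\right).$$
   Context: $q$ is an indeterminate. The Hilbert series of a filtered algebra $A=\bigcup_{j\ge0}A(j)$ is $\sum_{j\ge0}\dim\big(A(j)/A(j-1)\big)t^j$ with $A(-1)=0$. **Quantum group.** $U=\mathcal U_q(\mathfrak{sl}_2)$ is generated by $K^{\pm1},E,F$ with $KE=q^2EK$, $KF=q^{-2}FK$, $[E,F]=\frac{K-K^{-1}}{q-q^{-1}}$; $\Delta(K)=K\otimes K$, $\Delta(E)=E\otimes K+1\otimes E$, $\Delta(F)=F\otimes1+K^{-1}\otimes F$; $S(K)=K^{-1}$, $S(E)=-EK^{-1}$, $S(F)=-KF$; Casimir $\Lambda=(q-q^{-1})^2FE+qK+q^{-1}K^{-1}$. Left adjoint action $h\rhd x=\sum h_{(1)}xS(h_{(2)})$; $U^{\mathrm{lf}}$ is the subalgebra of elements $x$ with $\dim (U\rhd x)<\infty$. **Reflection equation algebra.** $\mathcal O_q(\mathrm{SL}_2)$ is generated by the entries of $\mathcal K=\begin{pmatrix}k^+_+&k^+_-\\k^-_+&k^-_-\end{pmatrix}$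 subject to $k^+_+k^-_--qk^+_-k^-_+=1$ and $R_{21}(\mathcal K\otimes I)R(I\otimes\mathcal K)=(I\otimes\mathcal K)R_{21}(\mathcal K\otimes I)R$, where $R=\begin{pmatrix}q&0&0&0\\0&1&q-q^{-1}&0\\0&0&1&0\\0&0&0&q\end{pmatrix}$. There is an algebra isomorphism $\mathcal O_q(\mathrm{SL}_2)\cong U^{\mathrm{lf}}$ given by $k^+_+\mapsto q^{-1}(\Lambda-q^{-1}K)$, $k^+_-\mapsto q^{-1}(q-q^{-1})E$, $k^-_+\mapsto(q-q^{-1})KF$, $k^-_-\mapsto K$; through it $U$ acts on $\mathcal O_q(\mathrm{SL}_2)$ by the left adjoint action. **Alekseev moduli algebra.** $\mathcal L_{\Sigma_{g,r}}=\mathcal D_q(\mathrm{SL}_2)^{\tilde\otimes g}\,\tilde\otimes\,\mathcal O_q(\mathrm{SL}_2)^{\tilde\otimes(r-1)}$, where $\tilde\otimes$ is Majid's braided tensor product of $U$-module algebras and $\mathcal D_q(\mathrm{SL}_2)$ is the elliptic double, a $U$-module algebra with underlying $U$-module $\mathcal O_q(\mathrm{SL}_2)^{\otimes2}$ and $R$-matrix-twisted multiplication. As a $U$-module, $\mathcal L_{\Sigma_{g,r}}=\mathcal O_q(\mathrm{SL}_2)^{\otimes n}$ (with $U$ acting through iterated coproducts). It is generated by the entries $(k_i)^{\epsilon}_{\delta}$ of $n$ matrices $\mathcal K_1,\dots,\mathcal K_n$; all defining relations are homogeneous except the $n$ determinant relations. It is filtered with $j$-th piece spanned by monomials of degree at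 most $j$ in the $(k_i)^\epsilon_\delta$. $\mathcal L_{\Sigma_{g,r}}^{U}$ denotes the subalgebra of $U$-invariants ($h\rhd x=\varepsilon(h)x$), with the induced filtration. **Skein algebra.** $\mathrm{Sk}_q(\Sigma_{g,r})$ is the Kauffman bracket skein algebra over $\mathbb C(q^{1/4})$ of the genus $g$ surface with $r$ punctures (crossing $=q^{1/2}$ and $q^{-1/2}$ times the two smoothings, trivial loop $=-q-q^{-1}$). It is isomorphic, through the stated (internal) skein algebra, to $\mathcal L_{\Sigma_{g,r}}^U$ (scalars extended), and is given the filtration transported along this isomorphism; a simple closed curve $s_A$ running once through each of the handles in $A\subseteq\{1,\dots,n\}$ of the standard handle decomposition (a disc with $n$ handles) has degree $|A|$. **Askey--Wilson algebra.** $\mathrm{AW}(n)\subset U^{\otimes n}$ is the subalgebra generated by $\Lambda_A$, $\emptyset\ne A=\{i_1<\dots<i_k\}\subseteq\{1,\dots,n\}$, where $\Lambda_A=\big((\mathrm{id}^{\otimes(i_k-2)}\otimes\alpha_{i_k-1})\circ\cdots\circ\alpha_1(\Lambda)\big)\otimes1^{\otimes(n-i_k)}$, $\alpha_i=\Delta$ if $i\in A$ and $\alpha_i=\tau_L$ otherwise, and $\tau_L:U^{\mathrm{lf}}\to U\otimes U^{\mathrm{lf}}$ is the algebra morphism with $E\mapsto K\otimes E$, $FK\mapsto K^{-1}\otimes FK-qF\otimes\Lambda+q(q+q^{-1})F\otimes K-q^{-1}(q-q^{-1})^2F^2K\otimes E$, $K\mapsto1\otimes K-q^{-1}(q-q^{-1})^2FK\otimes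 E$, $\Lambda\mapsto1\otimes\Lambda$. It is isomorphic to $\mathcal L_{\Sigma_{0,n+1}}^U=(\mathcal O_q(\mathrm{SL}_2)^{\tilde\otimes n})^U$ by an isomorphism sending $\Delta^{(k-1)}(qk^+_++q^{-1}k^-_-)_{(i_1,\dots,i_k)}$ to $\Lambda_A$ (matrix coproduct on $\mathcal K$, factors placed in positions $i_1,\dots,i_k$ and $1$ elsewhere), and is given the filtration transported along it; $\Lambda_A$ has degree $|A|$.
   Formalization: The case (g,r)=(0,2), i.e. n=1, is excluded: there the formula's sums are empty, giving 0, while the true series is 1/(1-t). The determinant relation is taken with coefficient q^2 instead of q, as the stated isomorphism with U^lf requires. *)

(* Defs.v *)
From HB Require Import structures.
From mathcomp Require Import all_boot all_order all_algebra.
From mathcomp Require Import boolp classical_sets functions reals.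
From mathcomp Require Import topology normedtype.
From mathcomp Require Import fraction complex mxtens.

Set Implicit Arguments.
Unset Strict Implicit.
Unset Printing Implicit Defensive.

Import Order.TTheory GRing.Theory Num.Theory.
Import numFieldNormedType.Exports.

Local Open Scope classical_set_scope.
Local Open Scope ring_scope.
Local Open Scope quotient_scope.

(** * Algebras given by generators and relations *)

Section Terms.
Variables (F : fieldType) (X : Type).

Inductive term : Type :=
| tvar of X
| tone
| tadd of term & term
| tmul of term & term
| tscale of F & term.

Definition tzero : term := tscale 0 tone.
Definition topp (s : term) : term := tscale (-1) s.

Variable rel : term -> term -> Prop.

Inductive cong : term -> term -> Prop :=
| c_rel s t : rel s t -> cong s t
| c_refl s : cong s s
| c_sym s t : cong s t -> cong t s
| c_trans s t u : cong s t -> cong t u -> cong s u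
| c_add s s' t t' : cong s s' -> cong t t' -> cong (tadd s t) (tadd s' t')
| c_mul s s' t t' : cong s s' -> cong t t' -> cong (tmul s t) (tmul s' t')
| c_scale a s s' : cong s s' -> cong (tscale a s) (tscale a s')
| c_addA s t u : cong (tadd s (tadd t u)) (tadd (tadd s t) u)
| c_addC s t : cong (tadd s t) (tadd t s)
| c_add0 s : cong (tadd tzero s) s
| c_addN s : cong (tadd (topp s) s) tzero
| c_mulA s t u : cong (tmul s (tmul t u)) (tmul (tmul s t) u)
| c_mul1l s : cong (tmul tone s) s
| c_mul1r s : cong (tmul s tone) s
| c_mulDl s t u : cong (tmul (tadd s t) u) (tadd (tmul s u) (tmul t u))
| c_mulDr s t u : cong (tmul u (tadd s t)) (tadd (tmul u s) (tmul u t))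
| c_scaleA a b s : cong (tscale a (tscale b s)) (tscale (a * b) s)
| c_scale1 s : cong (tscale 1 s) s
| c_scaleDr a s t : cong (tscale a (tadd s t)) (tadd (tscale a s) (tscale a t))
| c_scaleDl a b s : cong (tscale (a + b) s) (tadd (tscale a s) (tscale b s))
| c_scaleAl a s t : cong (tscale a (tmul s t)) (tmul (tscale a s) t)
| c_scaleAr a s t : cong (tscale a (tmul s t)) (tmul s (tscale a t)).

HB.instance Definition _ := gen_eqMixin term.
HB.instance Definition _ := gen_choiceMixin term.

Definition congb (s t : term) : bool := `[< cong s t >].

Lemma congb_refl : reflexive congb.
Proof. by move=> s; apply/asboolP; exact: c_refl. Qed.

Lemma congb_sym : symmetric congb.
Proof. by move=> s t; apply/asboolP/asboolP; exact: c_sym. Qed.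

Lemma congb_trans : transitive congb.
Proof.
by move=> t s u /asboolP st /asboolP tu; apply/asboolP; exact: c_trans st tu.
Qed.

Canonical congb_equiv := EquivRel congb congb_refl congb_sym congb_trans.

(* The F-algebra generated by X subject to the relations s = t for rel s t. *)
Definition presAlg := {eq_quot congb}.

HB.instance Definition _ := Choice.on presAlg.
HB.instance Definition _ := EqQuotient.on presAlg.

Definition pcls (s : term) : presAlg := \pi_presAlg s.
Definition prepr (x : presAlg) : term := repr x.

Lemma preprK x : pcls (prepr x) = x.
Proof. exact: reprK. Qed.

Lemma pclsP s t : pcls s = pcls t <-> cong s t.
Proof.
split=> [/eqmodP|st]; first by move/asboolP.
by apply/eqmodP/asboolP.
Qed.

Lemma pcls_repr s : cong (prepr (pcls s)) s.
Proof. by apply/pclsP; rewrite preprK. Qed.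

Definition pzero := pcls tzero.
Definition pone := pcls tone.
Definition padd (x y : presAlg) := pcls (tadd (prepr x) (prepr y)).
Definition popp (x : presAlg) := pcls (topp (prepr x)).
Definition pmul (x y : presAlg) := pcls (tmul (prepr x) (prepr y)).
Definition pscale (a : F) (x : presAlg) := pcls (tscale a (prepr x)).

Lemma paddE s t : padd (pcls s) (pcls t) = pcls (tadd s t).
Proof. by apply/pclsP/c_add; exact: pcls_repr. Qed.
Lemma poppE s : popp (pcls s) = pcls (topp s).
Proof. by apply/pclsP/c_scale; exact: pcls_repr. Qed.
Lemma pmulE s t : pmul (pcls s) (pcls t) = pcls (tmul s t).
Proof. by apply/pclsP/c_mul; exact: pcls_repr. Qed.
Lemma pscaleE a s : pscale a (pcls s) = pcls (tscale a s).
Proof. by apply/pclsP/c_scale; exact: pcls_repr. Qed.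

Let pE := (paddE, poppE, pmulE, pscaleE).

Lemma pcls_ind (P : presAlg -> Prop) : (forall s, P (pcls s)) -> forall x, P x.
Proof. by move=> h x; rewrite -(preprK x). Qed.

Fact paddA : associative padd.
Proof.
by do 3!elim/pcls_ind=> ?; rewrite !pE; apply/pclsP; exact: c_addA.
Qed.
Fact paddC : commutative padd.
Proof. by do 2!elim/pcls_ind=> ?; rewrite !pE; apply/pclsP; exact: c_addC. Qed.
Fact padd0 : left_id pzero padd.
Proof. by elim/pcls_ind=> ?; rewrite !pE; apply/pclsP; exact: c_add0. Qed.
Fact paddN : left_inverse pzero popp padd.
Proof. by elim/pcls_ind=> ?; rewrite !pE; apply/pclsP; exact: c_addN. Qed.
HB.instance Definition _ :=
  GRing.isZmodule.Build presAlg paddA paddC padd0 paddN.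

Fact pmulA : associative pmul.
Proof.
by do 3!elim/pcls_ind=> ?; rewrite !pE; apply/pclsP; exact: c_mulA.
Qed.
Fact pmul1l : left_id pone pmul.
Proof. by elim/pcls_ind=> ?; rewrite !pE; apply/pclsP; exact: c_mul1l. Qed.
Fact pmul1r : right_id pone pmul.
Proof. by elim/pcls_ind=> ?; rewrite !pE; apply/pclsP; exact: c_mul1r. Qed.
Fact pmulDl : left_distributive pmul padd.
Proof.
by do 3!elim/pcls_ind=> ?; rewrite !pE; apply/pclsP; exact: c_mulDl.
Qed.
Fact pmulDr : right_distributive pmul padd.
Proof.
by do 3!elim/pcls_ind=> ?; rewrite !pE; apply/pclsP; exact: c_mulDr.
Qed.
HB.instance Definition _ :=
  GRing.Zmodule_isPzRing.Build presAlg pmulA pmul1l pmul1r pmulDl pmulDr.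

Fact pscaleA a b x : pscale a (pscale b x) = pscale (a * b) x.
Proof.
by elim/pcls_ind: x => ?; rewrite !pE; apply/pclsP; exact: c_scaleA.
Qed.
Fact pscale1 : left_id 1 pscale.
Proof. by elim/pcls_ind=> ?; rewrite !pE; apply/pclsP; exact: c_scale1. Qed.
Fact pscaleDr : right_distributive pscale +%R.
Proof.
move=> a; elim/pcls_ind=> s; elim/pcls_ind=> t.
by rewrite /GRing.add /= !pE; apply/pclsP; exact: c_scaleDr.
Qed.
Fact pscaleDl x : {morph pscale^~ x : a b / a + b}.
Proof.
elim/pcls_ind: x => s a b.
by rewrite {2}/GRing.add /= !pE; apply/pclsP; exact: c_scaleDl.
Qed.
HB.instance Definition _ :=
  GRing.Zmodule_isLmodule.Build F presAlg pscaleA pscale1 pscaleDr pscaleDl.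

(* presAlg has no lalgType instance: MathComp reserves it to nonzero rings. *)
Lemma pscaleAl (a : F) (x y : presAlg) : a *: (x * y) = (a *: x) * y.
Proof.
elim/pcls_ind: x => s; elim/pcls_ind: y => t.
by rewrite /GRing.mul /GRing.scale /= !pE; apply/pclsP; exact: c_scaleAl.
Qed.

Lemma pscaleAr (a : F) (x y : presAlg) : a *: (x * y) = x * (a *: y).
Proof.
elim/pcls_ind: x => s; elim/pcls_ind: y => t.
by rewrite /GRing.mul /GRing.scale /= !pE; apply/pclsP; exact: c_scaleAr.
Qed.

Definition gen (x : X) : presAlg := pcls (tvar x).

(* Span of the monomials of degree at most j in the generators. *)
Definition genfil (j : nat) : set presAlg :=
  [set x | exists s : seq (F * seq X),
    all (fun p => size p.2 <= j)%N s /\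
    x = \sum_(p <- s) p.1 *: \prod_(y <- p.2) gen y].

Inductive gensub (S : set presAlg) : set presAlg :=
| gs_gen x : S x -> gensub S x
| gs_one : gensub S 1
| gs_lin a x y : gensub S x -> gensub S y -> gensub S (a *: x + y)
| gs_mul x y : gensub S x -> gensub S y -> gensub S (x * y).

End Terms.

Arguments tone {F X}.
Arguments gen {F X rel}.

Definition freeAlg (F : fieldType) (X : Type) :=
  presAlg (fun _ _ : term F X => False).

Definition algOf (F : fieldType) (X : Type)
    (r : freeAlg F X -> freeAlg F X -> Prop) :=
  presAlg (fun s t : term F X => r (pcls _ s) (pcls _ t)).

Section Morphisms.
Variables (F : fieldType) (X Y : Type).
Variables (rX : term F X -> term F X -> Prop).
Variables (rY : term F Y -> term F Y -> Prop).
Local Notation A := (presAlg rX).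
Local Notation B := (presAlg rY).

(* f restricts to an isomorphism from the subalgebra P onto the subalgebra Q. *)
Definition subalg_iso (P : set A) (Q : set B) (f : A -> B) : Prop :=
  [/\ set_bij P Q f, f 1 = 1,
      forall a x y, P x -> P y -> f (a *: x + y) = a *: f x + f y &
      forall x y, P x -> P y -> f (x * y) = f x * f y].

(* Graph of the algebra morphism, defined on the subalgebra generated by the
   first components of S, that extends the assignment S. *)
Inductive mor_graph (S : A -> B -> Prop) : A -> B -> Prop :=
| mg_gen x y : S x y -> mor_graph S x y
| mg_one : mor_graph S 1 1
| mg_lin a x y x' y' : mor_graph S x y -> mor_graph S x' y' ->
    mor_graph S (a *: x + x') (a *: y + y')
| mg_mul x y x' y' : mor_graph S x y -> mor_graph S x' y' ->
    mor_graph S (x * x') (y * y').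

End Morphisms.

(** * Hilbert series *)

Section Hilbert.
Variables (F : fieldType) (V : lmodType F).

Definition quot_dim (A B : set V) (d : nat) : Prop :=
  exists v : 'I_d -> V, (forall i, A (v i)) /\
    forall x, A x -> exists! c : 'rV[F]_d, B (x - \sum_i c 0 i *: v i).

Definition filpred (fil : nat -> set V) (j : nat) : set V :=
  if j is j'.+1 then fil j' else [set 0].

(* The Hilbert series of fil is the expansion of num / den, that is,
   (sum_j d_j t^j) * den = num as power series; den is meant to have constant
   term 1. *)
Definition hilbert_series (fil : nat -> set V) (num den : {poly int}) : Prop :=
  exists d : nat -> nat,
    (forall j, quot_dim (fil j) (filpred fil j) (d j)) /\
    (forall m, \sum_(j < m.+1) (d j)%:R * den`_(m - j) = num`_m).

End Hilbert.

Definition hs_num (n : nat) : {poly int} :=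
  (1 + 'X) ^+ (n - 2) *
  (\sum_(0 <= k < n.-1) ('C(n - 2, k) ^ 2)%N%:R *: 'X^(2 * k)
   - \sum_(0 <= k < n - 2)
       ('C(n - 2, k) * 'C(n - 2, k.+1))%N%:R *: 'X^(2 * k + 1)).

Definition hs_den (n : nat) : {poly int} :=
  (1 - 'X) ^+ n * (1 - 'X^2) ^+ (2 * n - 3).

(** * The quantum group *)

Inductive ugen := gK | gKi | gE | gF.

Section QuantumGroup.
Variables (F : fieldType) (q : F).

Section Relations.
Variables (X : Type) (e : ugen -> freeAlg F X).
Local Notation K := (e gK).
Local Notation Ki := (e gKi).
Local Notation E := (e gE).
Local Notation F' := (e gF).

Inductive Urel : freeAlg F X -> freeAlg F X -> Prop :=
| U_KKi : Urel (K * Ki) 1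
| U_KiK : Urel (Ki * K) 1
| U_KE : Urel (K * E) (q ^+ 2 *: (E * K))
| U_KF : Urel (K * F') (q ^- 2 *: (F' * K))
| U_EF : Urel (E * F' - F' * E) ((q - q^-1)^-1 *: (K - Ki)).

End Relations.

Definition Uq := algOf (Urel (fun u => gen u)).

(* U^{\otimes n}: n commuting copies of U. *)
Inductive Utens_rel (n : nat) :
  freeAlg F ('I_n * ugen) -> freeAlg F ('I_n * ugen) -> Prop :=
| Ut_factor i x y : Urel (fun u => gen (i, u)) x y -> Utens_rel x y
| Ut_comm i j u v : i != j ->
    Utens_rel (gen (i, u) * gen (j, v)) (gen (j, v) * gen (i, u)).

Definition Utens (n : nat) := algOf (@Utens_rel n).

Definition counit_gen (u : ugen) : F :=
  match u with gK | gKi => 1 | gE | gF => 0 end.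

Fixpoint counit_term (h : term F ugen) : F :=
  match h with
  | tvar u => counit_gen u
  | tone => 1
  | tadd h h' => counit_term h + counit_term h'
  | tmul h h' => counit_term h * counit_term h'
  | tscale a h => a * counit_term h
  end.

Definition counit (h : Uq) : F := counit_term (prepr h).

End QuantumGroup.

(** * The Alekseev moduli algebra *)

Section Alekseev.
Variables (F : fieldType) (q : F) (g n : nat).

(* (i, e, d) stands for (k_i)^e_d; 0 is the sign + and 1 is the sign -. *)
Definition Lgen := ('I_n * 'I_2 * 'I_2)%type.

Local Notation Fr := (freeAlg F Lgen).

Definition kgen (i : 'I_n) (e d : 'I_2) : Fr := gen (i, e, d).

Definition lwt (x : Lgen) : int := x.2%:Z - x.1.2%:Z.

(* The left adjoint action, K |> x = K x K^-1, E |> x = (E x - x E) K^-1 and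
   F |> x = F x - K^-1 x K F, transported to the generators along
   k^+_+ |-> q^-1 (Lambda - q^-1 K),  k^+_- |-> q^-1 (q - q^-1) E,
   k^-_+ |-> (q - q^-1) K F,          k^-_- |-> K. *)
Definition act_gen (u : ugen) (x : Lgen) : term F Lgen :=
  let: (i, e, d) := x in
  let k e d := tvar F ((i, e, d) : Lgen) in
  match u with
  | gK => tscale (q ^ (2 * lwt x)) (tvar F x)
  | gKi => tscale (q ^ (- (2 * lwt x))) (tvar F x)
  | gE => match e == 0, d == 0 with
          | true, true => k 0 1
          | true, false => tzero F Lgen
          | false, true => tadd (k 1 1) (topp (k 0 0))
          | false, false => tscale (- q ^+ 2) (k 0 1)
          end
  | gF => match e == 0, d == 0 with
          | true, true => tscale (- q^-1) (k 1 0)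
          | true, false => tscale q^-1 (tadd (k 0 0) (topp (k 1 1)))
          | false, true => tzero F Lgen
          | false, false => tscale q (k 1 0)
          end
  end.

(* On products h |> (s t) is computed with the coproduct of h. *)
Fixpoint act_term (u : ugen) (s : term F Lgen) : term F Lgen :=
  match s with
  | tvar x => act_gen u x
  | tone => tscale (counit_gen F u) tone
  | tadd s t => tadd (act_term u s) (act_term u t)
  | tscale a s => tscale a (act_term u s)
  | tmul s t =>
      match u with
      | gK => tmul (act_term gK s) (act_term gK t)
      | gKi => tmul (act_term gKi s) (act_term gKi t)
      | gE => tadd (tmul (act_term gE s) (act_term gK t))
                   (tmul s (act_term gE t))
      | gF => tadd (tmul (act_term gF s) t)
                   (tmul (act_term gKi s) (act_term gF t))
      end
  end.

Fixpoint act_Uterm (h : term F ugen) (s : term F Lgen) : term F Lgen :=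
  match h with
  | tvar u => act_term u s
  | tone => s
  | tadd h h' => tadd (act_Uterm h s) (act_Uterm h' s)
  | tmul h h' => act_Uterm h (act_Uterm h' s)
  | tscale a h => tscale a (act_Uterm h s)
  end.

(* Rows and columns are indexed by v_+ v_+, v_- v_+, v_+ v_-, v_- v_-: the
   first tensor factor varies fastest.  With the other ordering the map of
   the comment of act_gen would not satisfy the reflection equation. *)
Definition Rmx : 'M[F]_(2 * 2) :=
  \matrix_(i, j) nth 0 (nth [::] [::
     [:: q; 0; 0;        0];
     [:: 0; 1; q - q^-1; 0];
     [:: 0; 0; 1;        0];
     [:: 0; 0; 0;        q]] i) j.

Definition flip_index (i : 'I_(2 * 2)) : 'I_(2 * 2) :=
  mxtens_index ((mxtens_unindex i).2, (mxtens_unindex i).1).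

Definition R21mx : 'M[F]_(2 * 2) := mxsub flip_index flip_index Rmx.

Definition scmx (M : 'M[F]_(2 * 2)) : 'M[Fr]_(2 * 2) :=
  map_mx (fun c : F => c *: (1 : Fr)) M.

Definition Kmx (i : 'I_n) : 'M[Fr]_2 := \matrix_(e, d) kgen i e d.

(* K_i \otimes I and I \otimes K_i, see Rmx for the order of the factors. *)
Definition K1mx (i : 'I_n) : 'M[Fr]_(2 * 2) := 1%:M *t Kmx i.
Definition K2mx (i : 'I_n) : 'M[Fr]_(2 * 2) := Kmx i *t 1%:M.

Local Notation R := (scmx Rmx).
Local Notation R21 := (scmx R21mx).
Local Notation R21i := (scmx (invmx R21mx)).

(* q^{H \otimes H / 2} sum_m q^{m (m - 1) / 2} (q - q^-1)^m / [m]! E^m \otimes F^m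
   is the universal R-matrix for the coproduct of U; E^3 and F^3 kill the
   generators.  Rgen x y is sum (R_(2) |> y) (R_(1) |> x). *)
Definition qnum (m : nat) : F := (q ^+ m - q ^- m) / (q - q^-1).

Definition Rgen (x y : Lgen) : Fr :=
  \sum_(m < 3)
    (q ^+ 'C(m, 2) * (q - q^-1) ^+ m / \prod_(1 <= l < m.+1) qnum l
     * q ^ (2 * (lwt x + m%:Z) * (lwt y - m%:Z))) *:
    (pcls _ (iter m (act_term gF) (tvar F y)) *
     pcls _ (iter m (act_term gE) (tvar F x))).

Definition linked (i j : 'I_n) : bool :=
  [&& (i < 2 * g)%N, ~~ odd i & j == i.+1 :> nat].

(* The handles 2p, 2p + 1 with p < g generate D_q(SL_2) and the others
   O_q(SL_2).
   L_det has q^2 because k^+_+ k^-_- - c k^+_- k^-_+ is U-invariant, central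
   and mapped to 1 in U exactly for c = q^2.
   L_braided is the exchange rule (1 \otimes x) (y \otimes 1) =
   sum (R_(2) |> y) \otimes (R_(1) |> x) of the braided tensor product.
   L_elliptic is
   R'_21 (K_i \otimes I) R' (I \otimes K_j)
     = (I \otimes K_j) R'_21 (K_i \otimes I) R'_21^-1
   for R' = q^(-1/2) R, the action of the universal R-matrix on V \otimes V;
   the other relations do not depend on the scaling of R. *)
Inductive Lrel : Fr -> Fr -> Prop :=
| L_reflection i a b :
    Lrel ((R21 *m K1mx i *m R *m K2mx i) a b)
         ((K2mx i *m R21 *m K1mx i *m R) a b)
| L_det i :
    Lrel (kgen i 0 0 * kgen i 1 1 - q ^+ 2 *: (kgen i 0 1 * kgen i 1 0)) 1
| L_braided (x y : Lgen) :
    (y.1.1 < x.1.1)%N -> ~~ linked y.1.1 x.1.1 ->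
    Lrel (gen x * gen y) (Rgen x y)
| L_elliptic i j a b : linked i j ->
    Lrel (q^-1 *: (R21 *m K1mx i *m R *m K2mx j) a b)
         ((K2mx j *m R21 *m K1mx i *m R21i) a b).

(* n handles; equal to L_{Sigma_{g,r}} when n = 2 g + r - 1. *)
Definition alekseev := algOf Lrel.

(* The class does not depend on the representatives: act_term preserves the
   relations of L, and its operators satisfy those of U. *)
Definition act (h : Uq q) (x : alekseev) : alekseev :=
  pcls _ (act_Uterm (prepr h) (prepr x)).

Definition Linv : set alekseev :=
  [set x | forall h : Uq q, act h x = counit h *: x].

Definition Linv_fil (j : nat) : set alekseev := Linv `&` @genfil F Lgen _ j.

(* Delta^(k-1)(q k^+_+ + q^-1 k^-_-) placed in the positions A. *)
Definition qtrace (A : {set 'I_n}) : alekseev :=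
  let P : 'M[alekseev]_2 :=
    \big[mulmx/1%:M]_(i <- enum A)
       (\matrix_(e, d) (gen ((i, e, d) : Lgen) : alekseev)) in
  q *: P 0 0 + q^-1 *: P 1 1.

End Alekseev.

(** * The Askey--Wilson algebra *)

Section AskeyWilson.
Variables (F : fieldType) (q : F) (n : nat).

Local Notation Un := (Utens q n).
Local Notation "u '_at' i" := (gen (i, u) : Un) (at level 9, i at level 9).

Definition casimir (i : 'I_n) : Un :=
  (q - q^-1) ^+ 2 *: (gF _at i * gE _at i) + q *: gK _at i + q^-1 *: gKi _at i.

(* id^{\otimes i} \otimes Delta, on the first i + 1 factors. *)
Inductive Delta_gens (i j : 'I_n) : Un -> Un -> Prop :=
| D_id (l : 'I_n) u : (l < i)%N -> Delta_gens i j (u _at l) (u _at l)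
| D_K : Delta_gens i j (gK _at i) (gK _at i * gK _at j)
| D_Ki : Delta_gens i j (gKi _at i) (gKi _at i * gKi _at j)
| D_E : Delta_gens i j (gE _at i) (gE _at i * gK _at j + gE _at j)
| D_F : Delta_gens i j (gF _at i) (gF _at i + gKi _at i * gF _at j).

(* id^{\otimes i} \otimes tau_L, on U^{\otimes i} \otimes U^lf, where U^lf, the
   locally finite part of U, is generated by E, FK, K and Lambda (not K^-1). *)
Inductive tauL_gens (i j : 'I_n) : Un -> Un -> Prop :=
| T_id (l : 'I_n) u : (l < i)%N -> tauL_gens i j (u _at l) (u _at l)
| T_E : tauL_gens i j (gE _at i) (gK _at i * gE _at j)
| T_FK : tauL_gens i j (gF _at i * gK _at i)
    (gKi _at i * (gF _at j * gK _at j)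
     - q *: (gF _at i * casimir j)
     + (q * (q + q^-1)) *: (gF _at i * gK _at j)
     - (q^-1 * (q - q^-1) ^+ 2) *:
         (gF _at i * gF _at i * gK _at i * gE _at j))
| T_K : tauL_gens i j (gK _at i)
    (gK _at j - (q^-1 * (q - q^-1) ^+ 2) *: (gF _at i * gK _at i * gE _at j))
| T_Lambda : tauL_gens i j (casimir i) (casimir j).

(* AW_chain A i x: x is the element of U^{\otimes (i + 1)} obtained from Lambda
   by applying the maps alpha of the (0-based) positions 0, ..., i - 1. *)
Inductive AW_chain (A : {set 'I_n}) : 'I_n -> Un -> Prop :=
| AW_base (i : 'I_n) : i = 0%N :> nat -> AW_chain A i (casimir i)
| AW_step (i j : 'I_n) x y : j = i.+1 :> nat -> AW_chain A i x ->
    mor_graph (if i \in A then Delta_gens i j else tauL_gens i j) x y ->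
    AW_chain A j y.

Definition is_Lambda (A : {set 'I_n}) (x : Un) : Prop :=
  exists m : 'I_n,
    [/\ m \in A, forall i, i \in A -> (i <= m)%N & AW_chain A m x].

Definition AW : set Un :=
  gensub [set x | exists A : {set 'I_n}, is_Lambda A x].

End AskeyWilson.

(** * The Kauffman bracket skein algebra *)

Section Surface.
Variables (R : realType) (g n : nat).

Definition lo (i : nat) : nat :=
  if (i < 2 * g)%N then (if odd i then 2 * i - 1 else 2 * i)%N
  else (2 * i)%N.
Definition hi (i : nat) : nat :=
  if (i < 2 * g)%N then (lo i).+2 else (lo i).+1.

(* The band of a handle with feet [2 lo, 2 lo + 1] and [2 hi, 2 hi + 1]; the
   handles 2p + 1 with p < g are tilted to avoid the handles 2p, with which
   they are linked. *)
Definition band (i : nat) : set (R * R * R) :=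
  [set p : R * R * R | let: (x, y, w) := p in
    let c : R := (lo i + hi i)%N%:R + 2^-1 in
    let d : R := (hi i)%:R - (lo i)%:R in
    [/\ 0 <= y, (d - 2^-1) ^+ 2 <= (x - c) ^+ 2 + y ^+ 2 <= (d + 2^-1) ^+ 2 &
        w = if (i < 2 * g)%N && odd i then y else 0]].

(* A disc with n handles, embedded in R^3; it is oriented so that the
   projection (x, y, w) |-> (x, y), an immersion, preserves orientation.  For
   n = 2 g + r - 1 it has genus g and r boundary components. *)
Definition surface : set (R * R * R) :=
  [set p : R * R * R | let: (x, y, w) := p in
     [/\ 0 <= x <= (4 * n)%N%:R, -1 <= y <= 0 & w = 0]]
  `|` \bigcup_(i in [set i : nat | (i < n)%N]) band i.

Definition thickened : set (R * R * R * R) :=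
  [set p : R * R * R * R | surface p.1 /\ 0 <= p.2 <= 1].

Definition solid_ring : set (R * R * R * R) :=
  [set p : R * R * R * R | let: (u, v, s, t) := p in
     [/\ u ^+ 2 + v ^+ 2 = 1, -1 <= s <= 2 & -1 <= t <= 1]].

Definition core_annulus : set (R * R * R * R) :=
  solid_ring `&` [set p : R * R * R * R | 0 <= p.1.2 <= 1 /\ p.2 = 0].

(* Framed links, as disjoint unions of tame annuli in the interior of the
   thickened surface. *)
Definition banded_link (B : set (R * R * R * R)) : Prop :=
  exists (c : nat) (f : 'I_c -> R * R * R * R -> R * R * R * R),
    [/\ forall i, {within solid_ring, continuous (f i)},
        forall i, f i @` solid_ring `<=` thickened,
        forall i j x y, solid_ring x -> solid_ring y ->
          f i x = f j y -> i = j /\ x = y &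
        B = \bigcup_(i in [set: 'I_c]) f i @` core_annulus].

Record blink := Blink { bset : set (R * R * R * R); _ : banded_link bset }.

(* Ambient isotopy; the inverses of the H t are automatically continuous since
   the thickened surface is compact. *)
Definition isotopic (A B : set (R * R * R * R)) : Prop :=
  exists H : R -> R * R * R * R -> R * R * R * R,
    [/\ {within [set p : R * (R * R * R * R) | 0 <= p.1 <= 1 /\ thickened p.2],
           continuous (fun p : R * (R * R * R * R) => H p.1 p.2)},
        forall t, 0 <= t <= 1 -> set_bij thickened thickened (H t),
        forall x, thickened x -> H 0 x = x &
        H 1 @` A = B].

Definition stack (A B : set (R * R * R * R)) : set (R * R * R * R) :=
  ((fun p => (p.1, (1 + p.2) / 2)) @` A) `|` ((fun p => (p.1, p.2 / 2)) @` B).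

Definition cube : set (R * R * R) :=
  [set p : R * R * R | let: (u, v, h) := p in [/\ 0 <= u <= 1, 0 <= v <= 1 & 0 <= h <= 1]].

Definition to_ball (p : R * R * R) : R * R * R * R :=
  let: (u, v, h) := p in ((1 + u) / 3, (v - 2) / 3, 0, (1 + h) / 3).

Definition strands_cross : set (R * R * R) :=
  [set p : R * R * R | let: (u, v, h) := p in
     [/\ 0 <= v <= 1, 5^-1 <= u - v / 2 <= 3 / 10 & h = 2^-1 + v * (1 - v)]]
  `|`
  [set p : R * R * R | let: (u, v, h) := p in
     [/\ 0 <= v <= 1, 7 / 10 <= u + v / 2 <= 4 / 5 & h = 2^-1 - v * (1 - v)]].

Definition strands_vert : set (R * R * R) :=
  [set p : R * R * R | let: (u, v, h) := p in
     [/\ 0 <= v <= 1, 5^-1 <= u <= 3 / 10 \/ 7 / 10 <= u <= 4 / 5 & h = 2^-1]].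

Definition strands_horiz : set (R * R * R) :=
  [set p : R * R * R | let: (u, v, h) := p in
     [/\ 0 <= v <= 1,
         5^-1 ^+ 2 <= (u - 2^-1) ^+ 2 + v ^+ 2 <= (3 / 10) ^+ 2 \/
         5^-1 ^+ 2 <= (u - 2^-1) ^+ 2 + (1 - v) ^+ 2 <= (3 / 10) ^+ 2 &
         h = 2^-1]].

Definition small_loop : set (R * R * R) :=
  [set p : R * R * R | let: (u, v, h) := p in
     5^-1 ^+ 2 <= (u - 2^-1) ^+ 2 + (v - 2^-1) ^+ 2 <= (3 / 10) ^+ 2 /\
     h = 2^-1].

Section Skein.
Variables (F : fieldType) (s : F). (* s is q^(1/4) *)

Local Notation Fr := (freeAlg F blink).

(* Up to isotopy, the ball in which the skein relations are applied can be
   taken to be the fixed one, to_ball @` cube. *)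
Inductive skein_rel : Fr -> Fr -> Prop :=
| sk_empty A : bset A = set0 -> skein_rel (gen A) 1
| sk_stack A B C : bset C = stack (bset A) (bset B) ->
    skein_rel (gen A * gen B) (gen C)
| sk_isotopy A B : isotopic (bset A) (bset B) -> skein_rel (gen A) (gen B)
| sk_cross Z A B C : Z `&` (to_ball @` cube) = set0 ->
    bset A = Z `|` to_ball @` strands_cross ->
    bset B = Z `|` to_ball @` strands_vert ->
    bset C = Z `|` to_ball @` strands_horiz ->
    skein_rel (gen A) (s ^+ 2 *: gen B + s ^- 2 *: gen C)
| sk_loop A B : bset A `&` (to_ball @` cube) = set0 ->
    bset B = bset A `|` to_ball @` small_loop ->
    skein_rel (gen B) ((- s ^+ 4 - s ^- 4) *: gen A).

Definition skein := algOf skein_rel.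

End Skein.

End Surface.

(** * Base fields *)

(* C(z) for an indeterminate z. *)
Definition ratC (R : realType) : fieldType := {fraction {poly R[i]}}.
Definition indet (R : realType) : ratC R := tofrac ('X : {poly R[i]}).

(* Main.v *)
(* Solving the defining relations for their leading words turns them into a
   terminating rewriting system.  Its overlaps involve at most three handles and
   all resolve, so by the diamond lemma the reduced words form a basis of the
   moduli algebra adapted to the degree filtration and to the K-weights.  On each
   (finite-dimensional) piece of the filtration E maps the weight space of K-weight
   1 onto the one of K-weight q^2, and its kernel consists of the invariants; hence
   the j-th coefficient is the number of reduced words of degree j with K-weight 1
   minus the number of those with K-weight q^2.  The Hilbert series is thus the
   constant term in z of (1 - z) ((1 + t) / ((1 - t) (1 - t z) (1 - t / z)))^n, and
   an Euler transformation relates ((1 - t z) (1 - t / z))^-n to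
   ((1 + t z) (1 + t / z))^(n - 2) up to powers of 1 - t and 1 - t^2. *)
From HB Require Import structures.
Require Import Defs.
From mathcomp Require Import all_boot all_order all_algebra.
From mathcomp Require Import boolp classical_sets functions reals.
From mathcomp Require Import fraction complex mxtens.
From mathcomp Require Import ring zify.

Set Implicit Arguments.
Unset Strict Implicit.
Unset Printing Implicit Defensive.

Import Order.TTheory GRing.Theory Num.Theory.
Local Open Scope classical_set_scope.
Local Open Scope ring_scope.

(** * Computable noncommutative polynomials over Z[q, q^-1] *)

(** The obstacle is that confluence concerns any number of handles, while a computation sees only a
    few. A rule depends on its two handles only through their order and through whether they are
    linked, so computations can be carried along relabellings that preserve both. As linked pairs
    are disjoint and consecutive, three patterns of links on three handles suffice. Coefficients are
    kept as lists of Laurent monomials in q with denominators cleared beforehand, so that every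
    check is the evaluation of a closed term. Relations and rules have to imply each other:
    relations reduce to zero, which makes the coefficients of normal forms well defined on the
    algebra and gives independence; rules are combinations of relations, which gives spanning.
    Surjectivity of E is obtained without complete reducibility: weights in a filtration piece are
    bounded by the degree, so E and F are nilpotent there, and the classical formula for E on a
    string of F is enough. *)

(* The letter (h, c) is the entry of code c of K_h, with the codes
   0 = k^+_-, 1 = k^-_-, 2 = k^+_+, 3 = k^-_+; letters are ordered by handle,
   then by code. *)
Definition letter := (nat * nat)%type.
Definition word := seq letter.

(* (c, e, w) is the monomial c q^e w. *)
Definition cpoly := seq (int * int * word).

Definition kb (h : nat) : letter := (h, 0%N).
Definition kd (h : nat) : letter := (h, 1%N).
Definition ka (h : nat) : letter := (h, 2%N).
Definition kc (h : nat) : letter := (h, 3%N).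

Fixpoint cinsert (m : int * int * word) (p : cpoly) : cpoly :=
  if p is m' :: p' then
    if (m.1.2 == m'.1.2) && (m.2 == m'.2)
    then (m.1.1 + m'.1.1, m'.1.2, m'.2) :: p' else m' :: cinsert m p'
  else [:: m].

Definition collect (p : cpoly) : cpoly :=
  [seq m <- foldr cinsert [::] p | m.1.1 != 0].

Definition cscale (a : int * int) (p : cpoly) : cpoly :=
  [seq (a.1 * m.1.1, a.2 + m.1.2, m.2) | m <- p].

Definition cmul (p r : cpoly) : cpoly :=
  [seq (m.1.1 * m'.1.1, m.1.2 + m'.1.2, m.2 ++ m'.2) | m <- p, m' <- r].

Definition csub (p r : cpoly) : cpoly := p ++ cscale (-1, 0) r.

Definition crename (h : letter -> letter) (p : cpoly) : cpoly :=
  [seq (m.1, map h m.2) | m <- p].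

(** * The rewriting system *)

(* Right-hand sides of the rules for a pair of codes x, y: refl_rule within one
   handle, br_rule and ell_rule for a letter of handle 1 followed by a letter of
   handle 0, unlinked resp. linked.  They are the defining relations solved for
   their leading words. *)
Definition refl_rule (x y : nat) : option cpoly :=
  (match x, y with
  | 1%N, 0%N => Some [:: (1, 2, [:: kb 0; kd 0])]
  | 1%N, 2%N => Some [:: (1, 2, [:: kb 0; kc 0]); (1, 0, [::])]
  | 2%N, 0%N =>
    Some [:: (1, 0, [:: kb 0; ka 0]); (1, -2, [:: kb 0; kd 0]);
        (-1, 0, [:: kb 0; kd 0])]
  | 2%N, 1%N => Some [:: (1, 2, [:: kb 0; kc 0]); (1, 0, [::])]
  | 3%N, 0%N =>
    Some [:: (1, -2, [:: kd 0; kd 0]); (-1, 0, [:: kd 0; kd 0]);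
        (1, 2, [:: kb 0; kc 0]); (-1, -2, [::]); (1, 0, [::])]
  | 3%N, 1%N => Some [:: (1, 2, [:: kd 0; kc 0])]
  | 3%N, 2%N =>
    Some [:: (1, -2, [:: kd 0; kc 0]); (-1, 0, [:: kd 0; kc 0]);
        (1, 0, [:: ka 0; kc 0])]
  | _, _ => None
  end)%Z.

Definition br_rule (x y : nat) : cpoly :=
  (match x, y with
  | 0%N, 0%N => [:: (1, 2, [:: kb 0; kb 1])]
  | 0%N, 1%N => [:: (1, 0, [:: kd 0; kb 1])]
  | 0%N, 2%N => [:: (1, 0, [:: ka 0; kb 1])]
  | 0%N, 3%N => [:: (1, -2, [:: kc 0; kb 1])]
  | 1%N, 0%N =>
    [:: (1, 0, [:: kb 0; kd 1]); (1, 0, [:: ka 0; kb 1]);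
        (-1, 2, [:: ka 0; kb 1]); (-1, 0, [:: kd 0; kb 1]);
        (1, 2, [:: kd 0; kb 1])]
  | 1%N, 1%N =>
    [:: (1, 0, [:: kd 0; kd 1]); (1, 0, [:: kc 0; kb 1]);
        (-1, 2, [:: kc 0; kb 1])]
  | 1%N, 2%N =>
    [:: (1, 0, [:: ka 0; kd 1]); (-1, -2, [:: kc 0; kb 1]);
        (1, 0, [:: kc 0; kb 1])]
  | 1%N, 3%N => [:: (1, 0, [:: kc 0; kd 1])]
  | 2%N, 0%N =>
    [:: (1, 0, [:: kb 0; ka 1]); (-1, -2, [:: ka 0; kb 1]);
        (1, 0, [:: ka 0; kb 1]); (1, -2, [:: kd 0; kb 1]);
        (-1, 0, [:: kd 0; kb 1])]
  | 2%N, 1%N =>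
    [:: (1, 0, [:: kd 0; ka 1]); (-1, -2, [:: kc 0; kb 1]);
        (1, 0, [:: kc 0; kb 1])]
  | 2%N, 2%N =>
    [:: (1, 0, [:: ka 0; ka 1]); (1, -4, [:: kc 0; kb 1]);
        (-1, -2, [:: kc 0; kb 1])]
  | 2%N, 3%N => [:: (1, 0, [:: kc 0; ka 1])]
  | 3%N, 0%N =>
    [:: (1, -2, [:: kb 0; kc 1]); (-1, -2, [:: ka 0; kd 1]);
        (1, 0, [:: ka 0; kd 1]); (1, -2, [:: ka 0; ka 1]);
        (-1, 0, [:: ka 0; ka 1]); (1, -2, [:: kd 0; kd 1]);
        (-1, 0, [:: kd 0; kd 1]); (-1, -2, [:: kd 0; ka 1]);
        (1, 0, [:: kd 0; ka 1]); (1, -4, [:: kc 0; kb 1]);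
        (-1, -2, [:: kc 0; kb 1]); (-1, 0, [:: kc 0; kb 1]);
        (1, 2, [:: kc 0; kb 1])]
  | 3%N, 1%N =>
    [:: (1, 0, [:: kd 0; kc 1]); (-1, 0, [:: kc 0; kd 1]);
        (1, 2, [:: kc 0; kd 1]); (1, 0, [:: kc 0; ka 1]);
        (-1, 2, [:: kc 0; ka 1])]
  | 3%N, 2%N =>
    [:: (1, 0, [:: ka 0; kc 1]); (1, -2, [:: kc 0; kd 1]);
        (-1, 0, [:: kc 0; kd 1]); (-1, -2, [:: kc 0; ka 1]);
        (1, 0, [:: kc 0; ka 1])]
  | 3%N, 3%N => [:: (1, 2, [:: kc 0; kc 1])]
  | _, _ => [::]
  end)%Z.

Definition ell_rule (x y : nat) : cpoly :=
  (match x, y with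
  | 0%N, 0%N => [:: (1, 1, [:: kb 0; kb 1])]
  | 0%N, 1%N => [:: (1, -1, [:: kd 0; kb 1])]
  | 0%N, 2%N =>
    [:: (1, 1, [:: ka 0; kb 1]); (-1, -1, [:: kb 0; kd 1]);
        (1, 1, [:: kb 0; kd 1])]
  | 0%N, 3%N =>
    [:: (1, -1, [:: kc 0; kb 1]); (-1, -3, [:: kd 0; kd 1]);
        (1, -1, [:: kd 0; kd 1])]
  | 1%N, 0%N =>
    [:: (-1, -1, [:: kd 0; kb 1]); (1, 1, [:: kd 0; kb 1]);
        (1, 1, [:: kb 0; kd 1])]
  | 1%N, 1%N => [:: (1, 1, [:: kd 0; kd 1])]
  | 1%N, 2%N =>
    [:: (-1, -1, [:: kc 0; kb 1]); (1, 1, [:: kc 0; kb 1]);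
        (1, -3, [:: kd 0; kd 1]); (-2, -1, [:: kd 0; kd 1]);
        (1, 1, [:: kd 0; kd 1]); (1, -1, [:: ka 0; kd 1])]
  | 1%N, 3%N => [:: (1, -1, [:: kc 0; kd 1])]
  | 2%N, 0%N =>
    [:: (1, -1, [:: kb 0; ka 1]); (-1, -1, [:: ka 0; kb 1]);
        (1, 1, [:: ka 0; kb 1]); (1, -3, [:: kb 0; kd 1]);
        (-2, -1, [:: kb 0; kd 1]); (1, 1, [:: kb 0; kd 1]);
        (1, -3, [:: kd 0; kb 1]); (-1, -1, [:: kd 0; kb 1])]
  | 2%N, 1%N =>
    [:: (1, -1, [:: kd 0; ka 1]); (-1, -1, [:: kc 0; kb 1]);
        (1, 1, [:: kc 0; kb 1]); (1, -3, [:: kd 0; kd 1]);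
        (-2, -1, [:: kd 0; kd 1]); (1, 1, [:: kd 0; kd 1])]
  | 2%N, 2%N =>
    [:: (1, 1, [:: ka 0; ka 1]); (-1, -1, [:: kb 0; kc 1]);
        (1, 1, [:: kb 0; kc 1]); (1, -3, [:: kc 0; kb 1]);
        (-1, -1, [:: kc 0; kb 1]); (-1, -5, [:: kd 0; kd 1]);
        (2, -3, [:: kd 0; kd 1]); (-1, -1, [:: kd 0; kd 1])]
  | 2%N, 3%N =>
    [:: (1, 1, [:: kc 0; ka 1]); (-1, -1, [:: kd 0; kc 1]);
        (1, 1, [:: kd 0; kc 1])]
  | 3%N, 0%N =>
    [:: (-1, -3, [:: kd 0; ka 1]); (1, -1, [:: kd 0; ka 1]);
        (1, -1, [:: kb 0; kc 1]); (1, -3, [:: kc 0; kb 1]);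
        (-2, -1, [:: kc 0; kb 1]); (1, 1, [:: kc 0; kb 1]);
        (-1, -5, [:: kd 0; kd 1]); (3, -3, [:: kd 0; kd 1]);
        (-2, -1, [:: kd 0; kd 1]); (-1, -3, [:: ka 0; kd 1]);
        (1, -1, [:: ka 0; kd 1])]
  | 3%N, 1%N =>
    [:: (1, 1, [:: kd 0; kc 1]); (-1, -1, [:: kc 0; kd 1]);
        (1, 1, [:: kc 0; kd 1])]
  | 3%N, 2%N =>
    [:: (-1, -1, [:: kc 0; ka 1]); (1, 1, [:: kc 0; ka 1]);
        (1, -3, [:: kd 0; kc 1]); (-2, -1, [:: kd 0; kc 1]);
        (1, 1, [:: kd 0; kc 1]); (1, -1, [:: ka 0; kc 1]);
        (1, -3, [:: kc 0; kd 1]); (-1, -1, [:: kc 0; kd 1])]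
  | 3%N, 3%N => [:: (1, 1, [:: kc 0; kc 1])]
  | _, _ => [::]
  end)%Z.

Definition place (h0 h1 : nat) (l : letter) : letter :=
  (if l.1 == 0%N then h0 else h1, l.2).

Definition rule (lk : rel nat) (x y : letter) : option cpoly :=
  if x.1 == y.1 then omap (crename (place x.1 x.1)) (refl_rule x.2 y.2)
  else if (y.1 < x.1)%N then
    Some (crename (place y.1 x.1)
            ((if lk y.1 x.1 then ell_rule else br_rule) x.2 y.2))
  else None.

(** Fixing the leftmost strategy makes the normal form a function of the word before confluence is
    known. *)
Fixpoint red1 (lk : rel nat) (w : word) : option cpoly :=
  if w is x :: w' then
    if w' is y :: v then
      if rule lk x y is Some r then Some [seq (m.1, m.2 ++ v) | m <- r]
      else omap (fun p : cpoly => [seq (m.1, x :: m.2) | m <- p]) (red1 lk w')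
    else None
  else None.

Definition cstep (lk : rel nat) (p : cpoly) : cpoly :=
  collect (flatten [seq if red1 lk m.2 is Some r then cscale m.1 r else [:: m]
                   | m <- p]).

(** Any number of steps is sound, since a polynomial that has not vanished by then merely fails the
    test; twenty are enough for all the tests below. *)
Definition cnull (lk : rel nat) (p : cpoly) : bool :=
  iter 20 (cstep lk) (collect p) == [::].

Definition letters (k : nat) : seq letter :=
  [seq (h, c) | h <- iota 0 k, c <- iota 0 4].

(** The S-polynomial of the diamond lemma: the difference of the two ways to start reducing xyz. *)
Definition overlap (lk : rel nat) (x y z : letter) : cpoly :=
  if rule lk x y is Some r then
    if rule lk y z is Some r' then
      csub (cmul r [:: (1, 0, [:: z])]) (cmul [:: (1, 0, [:: x])] r')
    else [::]
  else [::].

Definition confluent (lk : rel nat) : bool :=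
  all (fun x => all (fun y => all (fun z => cnull lk (overlap lk x y z))
    (letters 3)) (letters 3)) (letters 3).

(** The links possible among handles i < j < k: linked handles are consecutive and the smaller one
    is even, so i and k are not linked, and at most one of the pairs i, j and j, k is. *)
Definition lk_none : rel nat := fun _ _ => false.
Definition lk01 : rel nat := fun i j => (i == 0%N) && (j == 1%N).
Definition lk12 : rel nat := fun i j => (i == 1%N) && (j == 2%N).

Lemma confluent_none : confluent lk_none. Proof. by vm_compute. Qed.
Lemma confluent01 : confluent lk01. Proof. by vm_compute. Qed.
Lemma confluent12 : confluent lk12. Proof. by vm_compute. Qed.

(** * Evaluation of computable polynomials in a vector space *)

Section Evaluation.
Variables (F : fieldType) (q : F).
Hypothesis q_neq0 : q != 0.

Definition cf (a : int * int) : F := a.1%:~R * q ^ a.2.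

(** The linear extension of [f]. Leaving [V] and [f] free lets one computation serve both for
    coefficient functionals, with values in the field, and for monomials of the moduli algebra. *)
Definition evs (V : lmodType F) (f : word -> V) (p : cpoly) : V :=
  \sum_(m <- p) cf m.1 *: f m.2.

Variable V : lmodType F.
Implicit Types (f : word -> V) (p r : cpoly).

Lemma cfM a b c d : cf (a * c, b + d) = cf (a, b) * cf (c, d).
Proof. by rewrite /cf /= expfzDr // intrM mulrACA. Qed.

Lemma evs_nil f : evs f [::] = 0.
Proof. by rewrite /evs big_nil. Qed.

Lemma evs_cons f m p : evs f (m :: p) = cf m.1 *: f m.2 + evs f p.
Proof. by rewrite /evs big_cons. Qed.

Lemma evs1 f w : evs f [:: (1, 0, w)] = f w.
Proof. by rewrite /evs big_seq1 /cf /= mulr1 scale1r. Qed.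

Lemma evs_cat f p r : evs f (p ++ r) = evs f p + evs f r.
Proof. by rewrite /evs big_cat. Qed.

Lemma evs_flatten f (s : seq cpoly) :
  evs f (flatten s) = \sum_(p <- s) evs f p.
Proof.
by elim: s => [|p s IH] /=; rewrite ?big_nil ?evs_nil // evs_cat big_cons IH.
Qed.

Lemma evs_cscale f a p : evs f (cscale a p) = cf a *: evs f p.
Proof.
rewrite /evs big_map scaler_sumr; apply: eq_bigr => -[[c e] w] _ /=.
by rewrite scalerA -cfM; case: a.
Qed.

Lemma evs_csub f p r : evs f (csub p r) = evs f p - evs f r.
Proof. by rewrite evs_cat evs_cscale /cf /= mulr1 scaleN1r. Qed.

Lemma evs_cmul f p r :
  evs f (cmul p r) = evs (fun w => evs (fun w' => f (w ++ w')) r) p.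
Proof.
rewrite /evs /cmul /allpairs_dep big_flatten /= big_map; apply: eq_bigr => m _.
rewrite big_map scaler_sumr; apply: eq_bigr => m' _ /=.
by rewrite scalerA cfM; case: m m' => [[? ?] ?] [[? ?] ?].
Qed.

Lemma evs_crename f h p : evs f (crename h p) = evs (f \o map h) p.
Proof. by rewrite /evs big_map. Qed.

Lemma evs_place f (u v : word) r :
  evs f [seq (m.1, u ++ m.2 ++ v) | m <- r] =
  evs (fun w => f (u ++ w ++ v)) r.
Proof. by rewrite /evs big_map. Qed.

Lemma eq_in_evs f f' p :
  {in p, forall m, f m.2 = f' m.2} -> evs f p = evs f' p.
Proof. by move=> H; apply: eq_big_seq => m /H ->. Qed.

Lemma eq_evs f f' p : f =1 f' -> evs f p = evs f' p.
Proof. by move=> H; apply: eq_in_evs => m _; exact: H. Qed.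

Lemma evs_exchange (f : word -> word -> V) p r :
  evs (fun w => evs (f w) r) p = evs (fun w' => evs (f^~ w') p) r.
Proof.
rewrite /evs; under eq_bigr do rewrite scaler_sumr.
rewrite exchange_big; apply: eq_bigr => m' _; rewrite scaler_sumr.
by apply: eq_bigr => m _; rewrite !scalerA mulrC.
Qed.

Lemma evs_cinsert f m p : evs f (cinsert m p) = cf m.1 *: f m.2 + evs f p.
Proof.
elim: p => [|m' p IH] /=; first by rewrite /evs big_seq1 big_nil addr0.
case: ifP => [/andP [/eqP E /eqP E']|_]; last by rewrite !evs_cons IH addrCA.
rewrite !evs_cons /= E' addrA -scalerDl; congr (_ *: _ + _).
by rewrite /cf /= E intrD mulrDl.
Qed.

Lemma evs_collect f p : evs f (collect p) = evs f p.
Proof.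
transitivity (evs f (foldr cinsert [::] p)).
  rewrite /evs big_filter [RHS](bigID (fun m => m.1.1 != 0)) /=.
  rewrite [X in _ = _ + X]big1 ?addr0 // => m /negPn /eqP E.
  by rewrite /cf E mul0r scale0r.
by elim: p => [|m p IH] //=; rewrite evs_cinsert IH evs_cons.
Qed.

Lemma mem_cinsert m p x : x \in cinsert m p ->
  exists2 m', m' \in m :: p & x.2 = m'.2.
Proof.
elim: p => [|m' p IH] /=; first by move=> H; exists x.
case: ifP => [/andP [_ /eqP E]|_]; rewrite inE => /orP [/eqP->|H].
- by exists m'; rewrite //= !inE eqxx orbT.
- by exists x; rewrite //= !inE H !orbT.
- by exists m'; rewrite //= !inE eqxx orbT.
have [y Hy Ey] := IH H; exists y => //.
by move: Hy; rewrite !inE => /orP [->|->]; rewrite ?orbT.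
Qed.

Lemma mem_collect p x : x \in collect p -> exists2 m, m \in p & x.2 = m.2.
Proof.
rewrite mem_filter => /andP [_].
elim: p x => [|m p IH] x //= /mem_cinsert [y].
rewrite inE => /orP [/eqP->|/IH [z Hz E]] Ex.
  by exists m; rewrite ?inE ?eqxx.
by exists z; rewrite ?Ex // inE Hz orbT.
Qed.

(* P singles out the words for which f is already known to be compatible with
   the rewriting rules. *)
Lemma cnull_sound (lk : rel nat) (P : word -> Prop) f p :
  (forall w r, P w -> red1 lk w = Some r ->
     f w = evs f r /\ {in r, forall m, P m.2}) ->
  {in p, forall m, P m.2} -> cnull lk p -> evs f p = 0.
Proof.
move=> Hf Hp /eqP Hc; rewrite -(evs_collect f p) -(evs_nil f) -Hc.
have {Hp} : {in collect p, forall m, P m.2}.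
  by move=> x /mem_collect [m Hm ->]; exact: Hp.
elim: 20%N (collect p) {Hc} => [|k IH] {}p Hp //; rewrite iterSr -IH.
- rewrite evs_collect evs_flatten big_map; apply: eq_big_seq => m Hm.
  case E: (red1 lk m.2) => [r|]; last by rewrite evs_cons evs_nil addr0.
  by rewrite evs_cscale; have [-> _] := Hf _ _ (Hp _ Hm) E.
move=> x /mem_collect [y /flattenP [_ /mapP [m Hm ->]]].
case E: (red1 lk m.2) => [r|]; last by rewrite inE => /eqP -> ->; exact: Hp.
have [_ H] := Hf _ _ (Hp _ Hm) E.
by move=> /mapP [z /H Hz ->] ->.
Qed.

End Evaluation.

Lemma red1_none lk w : red1 lk w = None ->
  forall u x y v, w = u ++ x :: y :: v -> rule lk x y = None.
Proof.
elim: w => [|x w IH] /=; first by move=> _ [].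
case: w IH => [|y v] IH; first by move=> _ [|? []].
case E: (rule lk x y) => [r|] //; case E': (red1 lk _) => [|] //= _.
by move=> [|x' u] x1 y1 v1 [] => [<- <- _|_ /IH] //; exact.
Qed.

Lemma red1_some lk w p : red1 lk w = Some p -> exists u x y v r,
  [/\ w = u ++ x :: y :: v, rule lk x y = Some r,
      p = [seq (m.1, u ++ m.2 ++ v) | m <- r] &
      forall u' x' y' v' r', w = u' ++ x' :: y' :: v' ->
        rule lk x' y' = Some r' -> (size u <= size u')%N].
Proof.
elim: w p => [|x w IH] //= p.
case: w IH => [|y v] IH //.
case E: (rule lk x y) => [r|].
  by case=> <-; exists [::], x, y, v, r; split.
case E': (red1 lk _) => [p'|] //= [<-].
have [u [x1 [y1 [v1 [r [Ew Er Ep Hm]]]]]] := IH _ E'.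
exists (x :: u), x1, y1, v1, r; split=> //=.
- by rewrite Ew.
- by rewrite Ep -map_comp.
move=> [|x' u'] x2 y2 v2 r2 [<-]; first by move=> [<- _]; rewrite E.
by move=> Ev /(Hm _ _ _ _ _ Ev).
Qed.

(** * Confluence *)

Definition lkg (g : nat) : rel nat :=
  fun i j => [&& (i < 2 * g)%N, ~~ odd i & j == i.+1].

Definition valid (n : nat) (l : letter) : bool := (l.1 < n)%N && (l.2 < 4)%N.

Definition wtl (l : letter) : int := (l.2 == 0%N)%:Z - (l.2 == 3%N)%:Z.
Definition wt (w : word) : int := \sum_(l <- w) wtl l.

Lemma wt_cat u v : wt (u ++ v) = wt u + wt v.
Proof. by rewrite /wt big_cat. Qed.

Lemma wt_cons x v : wt (x :: v) = wtl x + wt v.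
Proof. by rewrite /wt big_cons. Qed.

Lemma wt_nil : wt [::] = 0.
Proof. by rewrite /wt big_nil. Qed.

(* Conditions on a monomial w of the right-hand side of the rule for the pair
   of codes (c, c') with handles (0, 0), resp. (1, 0). *)
Definition refl_ok (c c' : nat) (w : word) : bool :=
  [&& all (fun l => (l.1 == 0%N) && (l.2 < 4)%N) w,
      wt w == wtl (0%N, c) + wtl (0%N, c') &
      if w is [:: l; l'] then (l.2 < c)%N || (l.2 == c) && (l'.2 < c')%N
      else w == [::]].

Definition exch_ok (c c' : nat) (w : word) : bool :=
  [&& all (fun l => (l.2 < 4)%N) w,
      wt w == wtl (0%N, c) + wtl (0%N, c') &
      if w is [:: l; l'] then (l.1 == 0%N) && (l'.1 == 1%N) else false].

(** A copy of [wt] that reduces by computation, which the big sum does not; it serves to check the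
    tables of rules. *)
Definition wtc (w : word) : int := foldr (fun l s => wtl l + s) 0 w.

Lemma wtcE w : wtc w = wt w.
Proof. by elim: w => [|l w IH]; rewrite ?wt_nil // wt_cons /= IH. Qed.

Lemma refl_rule_ok c c' r :
  refl_rule c c' = Some r -> {in r, forall m, refl_ok c c' m.2}.
Proof.
have E w : refl_ok c c' w = [&& all (fun l => (l.1 == 0%N) && (l.2 < 4)%N) w,
      wtc w == wtl (0%N, c) + wtl (0%N, c') &
      if w is [:: l; l'] then (l.2 < c)%N || (l.2 == c) && (l'.2 < c')%N
      else w == [::]] by rewrite wtcE.
move=> H m Hm; rewrite {}E; move: m Hm; apply/allP; move: r H.
by case: c => [|[|[|[|c]]]]; case: c' => [|[|[|[|c']]]] //= r [<-].
Qed.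

Lemma exch_rule_ok (b : bool) c c' :
  {in (if b then ell_rule else br_rule) c c', forall m, exch_ok c c' m.2}.
Proof.
have E w : exch_ok c c' w = [&& all (fun l => (l.2 < 4)%N) w,
      wtc w == wtl (0%N, c) + wtl (0%N, c') &
      if w is [:: l; l'] then (l.1 == 0%N) && (l'.1 == 1%N) else false]
  by rewrite wtcE.
move=> m Hm; rewrite {}E; move: m Hm; apply/allP.
by case: b; case: c => [|[|[|[|c]]]]; case: c' => [|[|[|[|c']]]].
Qed.

(** * Termination: a monomial order decreased by the rules *)

Section Order.
Variable n : nat.

(* Words are ordered by their value in base 4n + 1, with nonzero digits: this
   is the degree-lexicographic order. *)
Definition dig (l : letter) : nat := (4 * l.1 + l.2).+1.
Definition code (w : word) : nat :=
  foldl (fun s l => s * (4 * n).+1 + dig l)%N 0%N w.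

Lemma code_rcons w x : code (rcons w x) = (code w * (4 * n).+1 + dig x)%N.
Proof. by rewrite /code -cats1 foldl_cat. Qed.

Lemma code_cat u v :
  code (u ++ v) = (code u * (4 * n).+1 ^ size v + code v)%N.
Proof.
elim/last_ind: v => [|v x IH]; first by rewrite cats0 expn0 muln1 addn0.
by rewrite -rcons_cat !code_rcons IH size_rcons expnSr mulnDl addnA mulnA.
Qed.

(** As [w] is no longer than [w'], the prefix [u] gets multiplied by no larger a power of the base,
    and the middle parts decide. *)
Lemma code_ctx u v w w' :
  (size w <= size w')%N -> (code w < code w')%N ->
  (code (u ++ w ++ v) < code (u ++ w' ++ v))%N.
Proof.
move=> Hs Hc; rewrite !code_cat !size_cat !expnD !addnA ltn_add2r.
rewrite !mulnA -!mulnDl ltn_pmul2r ?expn_gt0 //.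
by rewrite -addnS leq_add // leq_mul2l leq_pexp2l ?orbT.
Qed.

(** Within a handle the first code drops, or it stays and the second drops, or the word becomes
    empty; in an exchange the first letter moves to the smaller handle. *)
Lemma rule_dec lk x y r : valid n x -> valid n y -> rule lk x y = Some r ->
  {in r, forall m, [/\ all (valid n) m.2, (size m.2 <= 2)%N,
    (code m.2 < code [:: x; y])%N, wt m.2 = wtl x + wtl y &
    {in m.2, forall l, l.1 = x.1 \/ l.1 = y.1}]}.
Proof.
case: x y => [h c] [h' c'] /andP [/= Hh Hc] /andP [/= Hh' Hc'].
rewrite /rule /=; case: ifP => [/eqP E|_].
  case Er: (refl_rule c c') => [r'|] //= [<-] m' /mapP [m /(refl_rule_ok Er)].
  case/and3P => Ha /eqP Hw Hl {m'}-> /=.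
  split.
  - rewrite all_map; apply/allP => l /(allP Ha) /andP [/eqP E1 E2].
    by rewrite /valid /= E1 /= Hh.
  - by rewrite size_map; case: (m.2) Hl => [|? [|? []]].
  - case: (m.2) Ha Hl => [|[a b] [|[a' b'] []]] //=.
    rewrite /code /= /place /= /dig /= => /and3P [/andP [/eqP -> Hb] /andP [/eqP -> Hb'] _] /=.
    rewrite -E; nia.
  - by rewrite /wt big_map; exact: Hw.
  - by move=> l' /mapP [l _ ->]; left; rewrite /place /=; case: ifP.
case: ifP => // Hlt [<-] m' /mapP [m /exch_rule_ok /and3P [Ha /eqP Hw Hl] {m'}->] /=.
split.
- rewrite all_map; apply/allP => l /(allP Ha) E2.
  by rewrite /valid /= E2 andbT; case: ifP.
- by rewrite size_map; case: (m.2) Hl => [|? [|? []]].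
- case: (m.2) Ha Hl => [|[a b] [|[a' b'] []]] //=.
  rewrite /code /= /place /= /dig /= => /and3P [Hb Hb' _] /andP [/eqP -> /eqP ->] /=.
  nia.
- by rewrite /wt big_map; exact: Hw.
by move=> l' /mapP [l _ ->]; rewrite /place /=; case: ifP; [right|left].
Qed.

Lemma ctx_dec lk u x y v r : all (valid n) (u ++ x :: y :: v) ->
  rule lk x y = Some r ->
  {in r, forall m, [/\ all (valid n) (u ++ m.2 ++ v),
    (size (u ++ m.2 ++ v) <= size (u ++ x :: y :: v))%N,
    (code (u ++ m.2 ++ v) < code (u ++ x :: y :: v))%N &
    wt (u ++ m.2 ++ v) = wt (u ++ x :: y :: v)]}.
Proof.
rewrite all_cat => /andP [Hu /= /and3P [Hx Hy Hv]] Hr m Hm.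
have [H1 H2 H3 H4 _] := rule_dec Hx Hy Hr Hm.
split; first by rewrite !all_cat Hu H1.
- by rewrite !size_cat leq_add2l /= -add2n leq_add2r.
- by rewrite -[x :: y :: v]/([:: x; y] ++ v); apply: code_ctx H3.
by rewrite !wt_cat !wt_cons H4 -!addrA.
Qed.

End Order.

(** * Transfer of computations between handles *)

Section Renaming.
Variables (F : fieldType) (q : F).
Hypothesis q_neq0 : q != 0.
Variables (lk lk0 : rel nat) (hs : nat -> nat) (H : seq nat).

Definition ren (l : letter) : letter := (hs l.1, l.2).

Definition ren_mono : Prop := {in H &, forall a b,
  [/\ (hs a == hs b) = (a == b), (hs a < hs b)%N = (a < b)%N &
      lk (hs a) (hs b) = lk0 a b]}.

Hypothesis hsP : ren_mono.

Lemma rule_ren x y : x.1 \in H -> y.1 \in H ->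
  rule lk (ren x) (ren y) = omap (crename ren) (rule lk0 x y).
Proof.
move=> Hx Hy; have [E1 E2 E3] := hsP Hy Hx; rewrite /rule /= E2 E3 eq_sym E1 eq_sym.
have E h h' (p : cpoly) : crename (place (hs h) (hs h')) p =
    crename ren (crename (place h h') p).
  rewrite /crename -map_comp; apply: eq_map => m /=; congr (_, _).
  by rewrite -map_comp; apply: eq_map => l; rewrite /ren /place /=; case: ifP.
case: ifP => _; first by case: (refl_rule _ _) => [r|] //=; rewrite E.
by case: ifP => //= _; rewrite E.
Qed.

Variables (V : lmodType F) (f : word -> V) (Q : word -> Prop).
Hypothesis fP : forall u x y v r, Q (u ++ x :: y :: v) -> rule lk x y = Some r ->
  f (u ++ x :: y :: v) = evs q (fun w => f (u ++ w ++ v)) r /\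
  {in r, forall m, Q (u ++ m.2 ++ v)}.

(** Renaming turns each reduction step for the model [lk0] into one for [lk], so the computed
    reduction to zero can be replayed on the actual handles. The predicate [Q] confines the words to
    those where [f] is known to respect the rules, as the induction of the diamond lemma
    requires. *)
Lemma cnull_ren p : {in p, forall m, all (fun l => l.2 < 4)%N m.2} ->
  {in p, forall m, all (fun l => l.1 \in H) m.2} ->
  {in p, forall m, Q (map ren m.2)} ->
  cnull lk0 p -> evs q f (crename ren p) = 0.
Proof.
move=> Hp4 HpH HpQ; rewrite evs_crename.
apply: (cnull_sound q_neq0 (P := fun w =>
  [/\ all (fun l => l.2 < 4)%N w, all (fun l => l.1 \in H) w & Q (map ren w)])).
  move=> w p' [H4 HH HQ] /red1_some [u [x [y [v [r [Ew Er -> _]]]]]].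
  move: H4 HH HQ; rewrite {}Ew !all_cat /= map_cat /=.
  case/and4P => Hu4 Hx4 Hy4 Hv4 /and4P [HuH HxH HyH HvH] HQ.
  have Er' := rule_ren HxH HyH; rewrite Er /= in Er'.
  have [-> HQr] := fP HQ Er'; rewrite evs_crename evs_place; split.
    by apply: eq_evs => z /=; rewrite !map_cat.
  move=> m' /mapP [m Hm -> /=].
  (* Any bound on the handles will do for [rule_dec]; its clauses on letters are the ones wanted. *)
  have Vx : valid (maxn x.1 y.1).+1 x by rewrite /valid Hx4 ltnS leq_maxl.
  have Vy : valid (maxn x.1 y.1).+1 y by rewrite /valid Hy4 ltnS leq_maxr.
  have [Hv _ _ _ Hl] := rule_dec Vx Vy Er Hm; split.
  - rewrite !all_cat Hu4 Hv4 andbT /=; apply/allP => l /(allP Hv).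
    by case/andP.
  - rewrite !all_cat HuH HvH andbT /=; apply/allP => l /Hl.
    by case=> ->.
  rewrite !map_cat; apply: (HQr (m.1, map ren m.2)).
  by apply/mapP; exists m.
by move=> m Hm; split; [exact: Hp4 Hm|exact: HpH Hm|exact: HpQ Hm].
Qed.

End Renaming.

(** In an overlap the handles weakly decrease. The cases are the coincidences among them; collapsing
    them to 0, 1, 2 keeps their order, and their links select one of the three checked patterns. *)
Lemma overlap_model g x y z r r' : (x.2 < 4)%N -> (y.2 < 4)%N -> (z.2 < 4)%N ->
  rule (lkg g) x y = Some r -> rule (lkg g) y z = Some r' ->
  exists hs lk0 x0 y0 z0,
  [/\ [/\ x = ren hs x0, y = ren hs y0 & z = ren hs z0],
      ren_mono (lkg g) lk0 hs [:: x0.1; y0.1; z0.1] &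
      cnull lk0 (overlap lk0 x0 y0 z0)].
Proof.
case: x y z => [hx cx] [hy cy] [hz cz] /= Hx Hy Hz.
have le_rule (a b : letter) p : rule (lkg g) a b = Some p -> (b.1 <= a.1)%N.
  by rewrite /rule; case: ltngtP.
move=> /le_rule /= Hyx /le_rule /= Hzy.
have inl k h c : (h < k)%N -> (c < 4)%N -> (h, c) \in letters k.
  move=> Hh Hc; apply/allpairsP; exists (h, c).
  by split; rewrite // mem_iota.
have conf lk0 a b c : confluent lk0 ->
  (a < 3)%N -> (b < 3)%N -> (c < 3)%N ->
  cnull lk0 (overlap lk0 (a, cx) (b, cy) (c, cz)).
  move=> Hc Ha Hb Hc'; move/allP: Hc => /(_ _ (inl _ _ _ Ha Hx)).
  by move=> /allP /(_ _ (inl _ _ _ Hb Hy)) /allP /(_ _ (inl _ _ _ Hc' Hz)).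
have lkF a b : b != a.+1 -> lkg g a b = false.
  by rewrite /lkg => /negbTE ->; rewrite !andbF.
have [E1|N1] := eqVneq hy hx; have [E2|N2] := eqVneq hz hy.
- exists (fun=> hx), lk_none, (0, cx)%N, (0, cy)%N, (0, cz)%N.
  split; [by rewrite /ren /= E2 E1| |exact: conf confluent_none _ _ _].
  move=> a b; rewrite !inE /= !orbb => /eqP-> /eqP->.
  by rewrite !eqxx !ltnn lkF //; lia.
- exists (fun a => if a == 0 then hz else hx)%N,
    (if lkg g hz hx then lk01 else lk_none), (1, cx)%N, (1, cy)%N, (0, cz)%N.
  split; [by rewrite /ren /= E1| |].
    move=> a b; rewrite !inE /=.
    case/or3P => /eqP-> /or3P [] /eqP-> /=; split;
    try lia; case E: (lkg g hz hx); rewrite /= ?E ?lkF //; lia.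
  by case: ifP => _; [apply: (conf _ _ _ _ confluent01)|apply: (conf _ _ _ _ confluent_none)].
- exists (fun a => if a == 0 then hz else hx)%N,
    (if lkg g hz hx then lk01 else lk_none), (1, cx)%N, (0, cy)%N, (0, cz)%N.
  split; [by rewrite /ren /= E2| |].
    move=> a b; rewrite !inE /=.
    case/or3P => /eqP-> /or3P [] /eqP-> /=; split;
    try lia; case E: (lkg g hz hx); rewrite /= ?E ?lkF //; lia.
  by case: ifP => _; [apply: (conf _ _ _ _ confluent01)|apply: (conf _ _ _ _ confluent_none)].
exists (fun a => if a == 0 then hz else if a == 1 then hy else hx)%N,
    (if lkg g hz hy then lk01 else if lkg g hy hx then lk12 else lk_none),
    (2, cx)%N, (1, cy)%N, (0, cz)%N.
split=> //.
  (* A linked pair starts at an even handle, so two successive pairs are not both linked. *)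
  have F12 : lkg g hz hy -> lkg g hy hx = false.
    rewrite /lkg; case/and3P => _ Ho /eqP ->; rewrite /= negbK (negbTE Ho).
    by rewrite andbF.
  move=> a b; rewrite !inE /=.
  case/or3P => /eqP-> /or3P [] /eqP-> /=; split;
  try lia; case E: (lkg g hz hy); case E': (lkg g hy hx);
  rewrite /= ?E ?E' ?lkF //; try lia; by rewrite F12 in E'.
case: ifP => _; first exact: (conf _ _ _ _ confluent01).
by case: ifP => _; [apply: (conf _ _ _ _ confluent12)|apply: (conf _ _ _ _ confluent_none)].
Qed.

(** * The diamond lemma *)

Section Diamond.
Variables (F : fieldType) (q : F).
Hypothesis q_neq0 : q != 0.
Variables (g n : nat).
Local Notation lk := (lkg g).
Local Notation val := (all (valid n)).

Definition reduced (w : word) : bool := red1 lk w == None.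

(** The fuel makes the recursion structural; as each reduction lowers [code], all fuels above
    [code n w] give the same value on a valid word. *)
Fixpoint coef_fuel (w0 : word) (k : nat) (w : word) : F^o :=
  if k is k'.+1 then
    if red1 lk w is Some r then evs q (coef_fuel w0 k') r else (w == w0)%:R
  else 0.

(* The coefficient of the reduced word w0 in the normal form of w. *)
Definition co (w0 w : word) : F^o := coef_fuel w0 (code n w).+1 w.

Lemma red1_dec w r : val w -> red1 lk w = Some r ->
  {in r, forall m, [/\ val m.2, (size m.2 <= size w)%N,
    (code n m.2 < code n w)%N & wt m.2 = wt w]}.
Proof.
move=> Hw /red1_some [u [x [y [v [r' [Ew Er -> _]]]]]] m /mapP [m' Hm -> /=].
by move: Hw; rewrite Ew => /ctx_dec /(_ Er) /(_ _ Hm).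
Qed.

Lemma coef_fuelE w0 k k' w : val w -> (code n w < k)%N -> (code n w < k')%N ->
  coef_fuel w0 k w = coef_fuel w0 k' w.
Proof.
elim: k k' w => [|k IH] [|k'] w //= Hw Hk Hk'.
case E: (red1 lk w) => [r|] //; apply: eq_in_evs => m Hm.
have [Hv _ Hc _] := red1_dec Hw E Hm.
by apply: IH => //; apply: leq_trans Hc _.
Qed.

Lemma coE w0 w : val w ->
  co w0 w = if red1 lk w is Some r then evs q (co w0) r else (w == w0)%:R.
Proof.
move=> Hw; rewrite {1}/co /=; case E: (red1 lk w) => [r|] //.
apply: eq_in_evs => m Hm; have [Hv _ Hc _] := red1_dec Hw E Hm.
exact: coef_fuelE.
Qed.

Lemma co_reduced w0 w : val w -> reduced w -> co w0 w = (w == w0)%:R.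
Proof. by move=> Hw /eqP E; rewrite coE // E. Qed.

(** The core of the diamond lemma, by strong induction on [code]: the pair x, y is compared with the
    leftmost reducible pair, which [co] rewrites. The two coincide, share a letter, or are
    disjoint. *)
Lemma co_rule w0 u x y v r : val (u ++ x :: y :: v) -> rule lk x y = Some r ->
  co w0 (u ++ x :: y :: v) = evs q (fun w => co w0 (u ++ w ++ v)) r.
Proof.
move Ew: (u ++ x :: y :: v) => w.
elim/ltn_ind: {w}(code n w) {-2}w (erefl (code n w)) u x y v r Ew => k IH.
move=> w Ek u x y v r Ew Hw Er; rewrite coE //.
have {}IH z : (code n z < k)%N -> val z -> forall u x y v r,
    z = u ++ x :: y :: v -> rule lk x y = Some r ->
    co w0 z = evs q (fun w => co w0 (u ++ w ++ v)) r.
  by move=> Hz Vz u' x' y' v' r' Ez; apply: (IH _ Hz).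
case E: (red1 lk w) => [p|]; last first.
  by move: (red1_none E (esym Ew)); rewrite Er.
have [u1 [x1 [y1 [v1 [r1 [Ew1 Er1 -> Hm]]]]]] := red1_some E.
rewrite evs_place.
have := Hm _ _ _ _ _ (esym Ew) Er; rewrite leq_eqVlt => /orP [/eqP Es|].
  move: Er; have := Ew; rewrite Ew1 => /eqP; rewrite eqseq_cat ?Es //.
  by case/andP => /eqP-> /eqP [-> -> ->]; rewrite Er1 => -[->].
(* The leftmost pair starts strictly earlier, so [u] is [u1] followed by a nonempty word. *)
move=> Hs; have Eu : u = u1 ++ drop (size u1) u.
  rewrite -{1}(cat_take_drop (size u1) u); congr (_ ++ _).
  have := congr1 (take (size u1)) (etrans Ew Ew1).
  by rewrite take_cat Hs take_size_cat //.
have Hs' : size (drop (size u1) u) = (size u - size u1)%N by rewrite size_drop.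
move: (drop _ _) Eu Hs' Ew Hs => t {E Hm} Eu Hs' Ew Hs; subst u.
move: Ew; rewrite Ew1 -catA => /eqP; rewrite eqseq_cat // eqxx /=.
(* One letter between the two starting points means that the pairs overlap, two or more that they
   are disjoint. *)
case: t Hs' Hs => [|x2 [|y2 t]]; first by rewrite cats0 ltnn.
  move=> _ _ /= /eqP [Ex2 Ex Ev1].
  subst x2 x v1; move: Hw Ek; rewrite Ew1 => Hw Ek.
  have /and5P [_ Vx1 Vy1 Vy _] : [&& val u1, valid n x1, valid n y1, valid n y & val v].
    by move: Hw; rewrite all_cat /=.
  have /andP [_ x14] := Vx1; have /andP [_ y14] := Vy1; have /andP [_ y4] := Vy.
  have [hs [lk0 [x0 [y0 [z0 [[Ex Ey Ez] Hmono Hnull]]]]]] :=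
    overlap_model x14 y14 y4 Er1 Er.
  have [xH yH zH] : [/\ x0.1 \in [:: x0.1; y0.1; z0.1],
      y0.1 \in [:: x0.1; y0.1; z0.1] & z0.1 \in [:: x0.1; y0.1; z0.1]].
    by rewrite !inE !eqxx !orbT.
  move: (Er1) (Er); rewrite {1 2}Ex {1 2}Ey {1}Ez !(rule_ren Hmono) //.
  case Er10: (rule lk0 x0 y0) => [r10|] //= [Er1'].
  case Er0: (rule lk0 y0 z0) => [r0|] //= [Er0'].
  have x04 : (x0.2 < 4)%N by rewrite Ex in x14.
  have y04 : (y0.2 < 4)%N by rewrite Ey in y14.
  have z04 : (z0.2 < 4)%N by rewrite Ez in y4.
  pose N := (x0.1 + y0.1 + z0.1).+1.
  have Vx0 : valid N x0 by rewrite /valid x04 ltnS -addnA leq_addr.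
  have Vy0 : valid N y0 by rewrite /valid y04 ltnS addnAC leq_addl.
  have Vz0 : valid N z0 by rewrite /valid z04 ltnS leq_addl.
  pose f w := co w0 (u1 ++ w ++ v).
  have : evs q f (crename (ren hs) (overlap lk0 x0 y0 z0)) = 0.
    (* The overlap word has code [k], but all terms of its two reducts lie below [k], where the
       induction hypothesis makes [co] respect the rules. *)
    apply: (cnull_ren q_neq0 Hmono (Q := fun z => val (u1 ++ z ++ v) /\
       (code n (u1 ++ z ++ v) < k)%N)) => //.
    - move=> u2 x2 y2 v2 r2; rewrite /f -!catA /= => -[Hv Hc] Er2.
      have Ec : u1 ++ u2 ++ x2 :: y2 :: v2 ++ v = (u1 ++ u2) ++ x2 :: y2 :: v2 ++ v.
        by rewrite -catA.
      split.
        rewrite (IH _ Hc Hv _ _ _ _ _ Ec Er2).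
        by apply: eq_evs => z; rewrite -!catA.
      move=> m Hm; rewrite Ec in Hv Hc; have [] := ctx_dec Hv Er2 Hm.
      rewrite -!catA in Hc *; move=> H1 _ H2 _.
      by split=> //; apply: ltn_trans H2 Hc.
    - rewrite /overlap Er10 Er0 => m; rewrite mem_cat => /orP [].
        move=> /allpairsP [[m1 m2] [/= H1]]; rewrite inE => /eqP -> -> /=.
        have [H _ _ _ _] := rule_dec Vx0 Vy0 Er10 H1.
        by rewrite all_cat /= z04 !andbT; apply: sub_all H => l /andP [].
      move=> /mapP [_ /allpairsP [[m1 m2] [/= +  H1 ->] ->]].
      rewrite inE => /eqP -> /=; rewrite x04 /=.
      have [H _ _ _ _] := rule_dec Vy0 Vz0 Er0 H1.
      by apply: sub_all H => l /andP [].
    - rewrite /overlap Er10 Er0 => m; rewrite mem_cat => /orP [].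
        move=> /allpairsP [[m1 m2] [/= H1]]; rewrite inE => /eqP -> -> /=.
        have [_ _ _ _ H] := rule_dec Vx0 Vy0 Er10 H1.
        by rewrite all_cat /= zH !andbT; apply/allP => l /H [] ->.
      move=> /mapP [_ /allpairsP [[m1 m2] [/= +  H1 ->] ->]].
      rewrite inE => /eqP -> /=; rewrite xH /=.
      have [_ _ _ _ H] := rule_dec Vy0 Vz0 Er0 H1.
      by apply/allP => l /H [] ->.
    rewrite /overlap Er10 Er0 => m; rewrite mem_cat => /orP [].
      move=> /allpairsP [[m1 m2] [/= H1]]; rewrite inE => /eqP -> -> /=.
      have := ctx_dec Hw Er1; rewrite -Er1' => /(_ (m1.1, map (ren hs) m1.2)).
      rewrite map_cat /= -Ez -!catA /= -Ek => H.
      by have [|? _ ?] := H _; first by apply/mapP; exists m1.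
    move=> /mapP [_ /allpairsP [[m1 m2] [/= +  H1 ->] ->]].
    rewrite inE => /eqP -> /=; rewrite -Ex -Ek.
    have := Hw; rewrite -cat_rcons => /ctx_dec /(_ Er).
    rewrite -Er0' => /(_ (m2.1, map (ren hs) m2.2)); rewrite !cat_rcons /= => H.
    by have [|? _ ?] := H _; first by apply/mapP; exists m2.
  rewrite /overlap Er10 Er0 evs_crename evs_csub // !evs_cmul // => /eqP.
  rewrite subr_eq0 => /eqP H.
  rewrite -Er1' -Er0' !evs_crename.
  transitivity (evs q (fun w => evs q (fun w' => (f \o map (ren hs)) (w ++ w'))
     [:: (1, 0, [:: z0])]) r10).
    apply: eq_evs => w1; rewrite evs1 //= /f map_cat /= -Ez.
    by rewrite -!catA.
  rewrite {}H evs1 //; apply: eq_evs => w1.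
  by rewrite /= /f /= -Ex -!catA.
move=> Hs' Hs /= /eqP [Ex2 Ey2 Ev1]; subst x2 y2 v1.
have Ec : w = (u1 ++ x1 :: y1 :: t) ++ x :: y :: v by rewrite Ew1 -!catA.
(* Disjoint pairs: both orders of reduction lead to the same double sum. *)
transitivity (evs q (fun w1 => evs q (fun w2 =>
   co w0 (u1 ++ w1 ++ t ++ w2 ++ v)) r) r1).
  apply: eq_in_evs => m1 Hm1.
  have := Hw; rewrite Ew1 => /ctx_dec /(_ Er1) /(_ _ Hm1) [Hv _ Hc _].
  rewrite -Ew1 Ek in Hc.
  rewrite (IH _ Hc Hv (u1 ++ m1.2 ++ t) x y v r) -?catA //.
  by apply: eq_evs => z; rewrite -!catA.
rewrite evs_exchange; apply: eq_in_evs => m Hm.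
have := Hw; rewrite Ec => /ctx_dec /(_ Er) /(_ _ Hm) [Hv _ Hc _].
have Eu' : (u1 ++ x1 :: y1 :: t) ++ m.2 ++ v = u1 ++ x1 :: y1 :: t ++ m.2 ++ v.
  by rewrite -!catA.
rewrite -Ec Eu' Ek in Hc; rewrite Eu' in Hv *.
by rewrite [RHS](IH _ Hc Hv _ _ _ _ _ erefl Er1).
Qed.
End Diamond.

Section DiamondSupport.
Variables (F : fieldType) (q : F).
Hypothesis q_neq0 : q != 0.
Variables (g n : nat).

(** Rules preserve the weight, never lengthen a word, and stop only at reduced words; this adapts
    the basis to the filtration and to the weights at once. *)
Lemma co_supp w0 w : all (valid n) w -> co q g n w0 w != 0 ->
  [/\ all (valid n) w0, reduced g w0, (size w0 <= size w)%N & wt w0 = wt w].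
Proof.
move Ek: (code n w) => k; elim/ltn_ind: k w Ek => k IH w Ek Vw.
rewrite coE //; case E: (red1 _ w) => [r|].
  have [/hasP [m Hm Hn] _|/hasPn H] := boolP (has (fun m => co q g n w0 m.2 != 0) r).
    have [H1 H2 H3 H4] := red1_dec Vw E Hm; rewrite Ek in H3.
    have [H5 H6 H7 H8] := IH _ H3 _ erefl H1 Hn.
    by rewrite -H4; split=> //; apply: leq_trans H2.
  rewrite /evs big1_seq ?eqxx // => m /andP [_ /H].
  by rewrite negbK => /eqP ->; rewrite scaler0.
case: (eqVneq w w0) => [<- _|]; last by rewrite eqxx.
by split=> //; rewrite /reduced E.
Qed.

End DiamondSupport.

(** * Evaluation of presented algebras *)

Section TermEvaluation.
Variables (F : fieldType) (X : Type).
Implicit Types (s t : term F X) (f : seq X -> F).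

(* The value at s of the linear form on the free algebra given by f on words. *)
Fixpoint teval s f : F :=
  match s with
  | tvar x => f [:: x]
  | tone => f [::]
  | tadd s t => teval s f + teval t f
  | tmul s t => teval s (fun w => teval t (fun w' => f (w ++ w')))
  | tscale a s => a * teval s f
  end.

Lemma teval_ext s f f' : f =1 f' -> teval s f = teval s f'.
Proof. by move=> /funext ->. Qed.

Lemma tevalD s f f' : teval s (fun w => f w + f' w) = teval s f + teval s f'.
Proof.
elim: s f f' => [x||s IHs t IHt|s IHs t IHt|a s IHs] f f' //=.
- by rewrite IHs IHt addrACA.
- by rewrite -IHs; apply: teval_ext => w; rewrite IHt.
by rewrite IHs mulrDr.
Qed.

Lemma tevalZ s a f : teval s (fun w => a * f w) = a * teval s f.
Proof.
elim: s f => [x||s IHs t IHt|s IHs t IHt|b s IHs] f //=.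
- by rewrite IHs IHt mulrDr.
- by rewrite -IHs; apply: teval_ext => w; rewrite IHt.
by rewrite IHs mulrCA.
Qed.

Lemma teval_exchange s t (f : seq X -> seq X -> F) :
  teval s (fun w => teval t (f w)) = teval t (fun w' => teval s (f^~ w')).
Proof.
elim: s f => [x||s IHs s' IHs'|s IHs s' IHs'|b s IHs] f //=.
- by rewrite IHs IHs' tevalD.
- rewrite -IHs; apply: teval_ext => w.
  by rewrite (IHs' (fun w' => f (w ++ w'))).
by rewrite IHs tevalZ.
Qed.

(** Invariance in every context u, v is what carries the induction through products: the factors are
    replaced one after the other, the order of evaluation being exchanged for the left one. *)
Lemma teval_cong (rel : term F X -> term F X -> Prop) f :
  (forall s t, rel s t -> forall u v,
     teval s (fun w => f (u ++ w ++ v)) = teval t (fun w => f (u ++ w ++ v))) ->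
  forall s t, cong rel s t -> forall u v,
     teval s (fun w => f (u ++ w ++ v)) = teval t (fun w => f (u ++ w ++ v)).
Proof.
move=> Hf s t; elim=> {s t}.
- exact: Hf.
- by [].
- by move=> s t _ IH u v; rewrite IH.
- by move=> s t r _ IH _ IH' u v; rewrite IH.
- by move=> s s' t t' _ IH _ IH' u v /=; rewrite IH IH'.
- move=> s s' t t' _ IH _ IH' u v /=.
  transitivity (teval s (fun w => teval t' (fun w' => f (u ++ w ++ w' ++ v)))).
    apply: teval_ext => w; rewrite (@teval_ext _ _ (fun w' => f ((u ++ w) ++ w' ++ v))).
      by rewrite IH'; apply: teval_ext => w'; rewrite -!catA.
    by move=> w'; rewrite -!catA.
  rewrite teval_exchange (teval_exchange s').
  by apply: teval_ext => w'; rewrite IH; apply: teval_ext => w; rewrite -!catA.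
- by move=> a s s' _ IH u v /=; rewrite IH.
- by move=> s t r u v /=; rewrite addrA.
- by move=> s t u v /=; rewrite addrC.
- by move=> s u v /=; rewrite mul0r add0r.
- by move=> s u v /=; rewrite mulN1r mul0r addNr.
- move=> s t r u v /=; apply: teval_ext => w; apply: teval_ext => w'.
  by apply: teval_ext => w''; rewrite -!catA.
- by [].
- by move=> s u v /=; apply: teval_ext => w; rewrite cats0.
- by [].
- by move=> s t r u v /=; rewrite -tevalD.
- by move=> a b s u v /=; rewrite mulrA.
- by move=> s u v /=; rewrite mul1r.
- by move=> a s t u v /=; rewrite mulrDr.
- by move=> a b s u v /=; rewrite mulrDl.
- by [].
by move=> a s t u v /=; rewrite -tevalZ.
Qed.

End TermEvaluation.

Section PresAlg.
Variables (F : fieldType) (X : Type) (rel : term F X -> term F X -> Prop).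
Local Notation A := (presAlg rel).

Lemma pclsD s t : pcls rel (tadd s t) = pcls rel s + pcls rel t.
Proof. by rewrite -paddE. Qed.
Lemma pclsM s t : pcls rel (tmul s t) = pcls rel s * pcls rel t.
Proof. by rewrite -pmulE. Qed.
Lemma pclsZ a s : pcls rel (tscale a s) = a *: pcls rel s.
Proof. by rewrite -pscaleE. Qed.
Lemma pcls1 : pcls rel tone = 1. Proof. by []. Qed.
Lemma pcls0 : pcls rel (tzero F X) = 0. Proof. by []. Qed.
Lemma pclsN s : pcls rel (topp s) = - pcls rel s.
Proof. by rewrite -poppE. Qed.

Definition mon (w : seq X) : A := \prod_(x <- w) gen x.

Lemma mon_nil : mon [::] = 1. Proof. by rewrite /mon big_nil. Qed.
Lemma mon1 x : mon [:: x] = gen x. Proof. by rewrite /mon big_seq1. Qed.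
Lemma mon_cat u v : mon (u ++ v) = mon u * mon v.
Proof. by rewrite /mon big_cat. Qed.
Lemma mon_cons x v : mon (x :: v) = gen x * mon v.
Proof. by rewrite /mon big_cons. Qed.

Lemma pscalM (a b : F) (x y : A) : (a *: x) * (b *: y) = (a * b) *: (x * y).
Proof. by rewrite -pscaleAl -pscaleAr scalerA. Qed.

End PresAlg.

Lemma cong_free (F : fieldType) (X : Type) (rel : term F X -> term F X -> Prop)
    s t : cong (fun _ _ => False) s t -> cong rel s t.
Proof.
elim=> {s t}.
- by [].
- by move=> *; exact: c_refl.
- by move=> *; exact: c_sym.
- by move=> *; apply: c_trans; eassumption.
- by move=> *; exact: c_add.
- by move=> *; exact: c_mul.
- by move=> *; exact: c_scale.
- by move=> *; exact: c_addA.
- by move=> *; exact: c_addC.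
- by move=> *; exact: c_add0.
- by move=> *; exact: c_addN.
- by move=> *; exact: c_mulA.
- by move=> *; exact: c_mul1l.
- by move=> *; exact: c_mul1r.
- by move=> *; exact: c_mulDl.
- by move=> *; exact: c_mulDr.
- by move=> *; exact: c_scaleA.
- by move=> *; exact: c_scale1.
- by move=> *; exact: c_scaleDr.
- by move=> *; exact: c_scaleDl.
- by move=> *; exact: c_scaleAl.
by move=> *; exact: c_scaleAr.
Qed.

Section FreeAlg.
Variables (F : fieldType) (X : Type).
Local Notation Fr := (freeAlg F X).

Definition feval (x : Fr) (f : seq X -> F) : F := teval (prepr x) f.

Lemma feval_pcls s f : feval (pcls _ s) f = teval s f.
Proof.
rewrite (@teval_ext _ _ _ _ (fun w => f ([::] ++ w ++ [::]))); last first.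
  by move=> w; rewrite cats0.
rewrite /feval (@teval_ext _ _ _ _ (fun w => f ([::] ++ w ++ [::]))); last first.
  by move=> w; rewrite cats0.
by apply: teval_cong (pcls_repr _ _) _ _.
Qed.

Lemma fevalD x y f : feval (x + y) f = feval x f + feval y f.
Proof. by rewrite -(preprK x) -(preprK y) -pclsD !feval_pcls. Qed.
Lemma fevalZ a x f : feval (a *: x) f = a * feval x f.
Proof. by rewrite -(preprK x) -pclsZ !feval_pcls. Qed.
Lemma fevalN x f : feval (- x) f = - feval x f.
Proof. by rewrite -scaleN1r fevalZ mulN1r. Qed.
Lemma feval0 f : feval 0 f = 0.
Proof. by rewrite -(scale0r (0 : Fr)) fevalZ mul0r. Qed.
Lemma feval_mon w f : feval (mon _ w) f = f w.
Proof.
elim: w f => [|x w IH] f; first by rewrite mon_nil -pcls1 feval_pcls.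
rewrite mon_cons -(preprK (mon _ w)) -pclsM feval_pcls /=.
by rewrite -[RHS](IH (fun w' => f (x :: w'))).
Qed.

Variable rel : term F X -> term F X -> Prop.

Definition proj (x : Fr) : presAlg rel := pcls _ (prepr x).

Lemma proj_pcls s : proj (pcls _ s) = pcls rel s.
Proof.
apply/pclsP; exact: cong_free (pcls_repr _ _).
Qed.

Lemma projD x y : proj (x + y) = proj x + proj y.
Proof. by rewrite -(preprK x) -(preprK y) -pclsD !proj_pcls pclsD. Qed.
Lemma projM x y : proj (x * y) = proj x * proj y.
Proof. by rewrite -(preprK x) -(preprK y) -pclsM !proj_pcls pclsM. Qed.
Lemma projZ a x : proj (a *: x) = a *: proj x.
Proof. by rewrite -(preprK x) -pclsZ !proj_pcls pclsZ. Qed.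
Lemma proj_one : proj 1 = 1.
Proof. by rewrite -(pcls1 (fun _ _ => False)) proj_pcls. Qed.
Lemma projN x : proj (- x) = - proj x.
Proof. by rewrite -scaleN1r projZ scaleN1r. Qed.
Lemma proj0 : proj 0 = 0.
Proof. by rewrite -(scale0r (0 : Fr)) projZ scale0r. Qed.
Lemma proj_gen x : proj (gen x) = gen x.
Proof. exact: proj_pcls. Qed.
Lemma proj_mon w : proj (mon _ w) = mon _ w.
Proof.
elim: w => [|x w IH]; first by rewrite !mon_nil proj_one.
by rewrite !mon_cons projM IH proj_gen.
Qed.

End FreeAlg.

Lemma proj_rel (F : fieldType) (X : Type) (r : freeAlg F X -> freeAlg F X -> Prop)
    (x y : freeAlg F X) :
  r x y -> proj (fun s t => r (pcls _ s) (pcls _ t)) x = proj _ y.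
Proof. by move=> H; apply/pclsP/c_rel; rewrite !preprK. Qed.

(** * The adjoint action on the moduli algebra *)

Section ActCong.
Variables (F : fieldType) (q : F) (n : nat).
Variable rel : term F (Lgen n) -> term F (Lgen n) -> Prop.
Hypothesis act_rel : forall s t, rel s t ->
  forall u, cong rel (act_term q u s) (act_term q u t).
Hypothesis q_neq0 : q != 0.
Local Notation A := (presAlg rel).
Local Notation T u s := (pcls rel (act_term q u s)).

Let pE := (pclsD, pclsM, pclsZ, pcls1).

(** Coassociativity of the coproduct takes care of associativity, and so on for the other axioms.
    The section is applied to the free algebra, where [act_rel] is vacuous, and to the moduli
    algebra, where it is [act_relL]. *)
Lemma act_cong s t : cong rel s t ->
  forall u, cong rel (act_term q u s) (act_term q u t).
Proof.
move=> H u; apply/pclsP; move: u; elim: H => {s t}.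
- by move=> s t H u; apply/pclsP; exact: act_rel.
- by [].
- by move=> s t _ IH u; rewrite IH.
- by move=> s t r _ IH _ IH' u; rewrite IH.
- by move=> s s' t t' _ IH _ IH' u; rewrite /= !pE IH IH'.
- move=> s s' t t' /pclsP Hs IH /pclsP Ht IH' u.
  by case: u; rewrite /= !pE ?Hs ?Ht !IH !IH'.
- by move=> a s s' _ IH u; rewrite /= !pE IH.
- by move=> s t r u; rewrite /= !pE addrA.
- by move=> s t u; rewrite /= !pE addrC.
- by move=> s u; rewrite /= !pE scale0r add0r.
- by move=> s u; rewrite /= !pE scale0r scaleN1r addNr.
- by move=> s t r; case; rewrite /= !pE ?(mulrDr, mulrDl) ?mulrA ?addrA.
- by move=> s; case; rewrite /= !pE ?scale1r ?scale0r ?mul1r ?mul0r ?add0r.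
- by move=> s; case; rewrite /= !pE ?scale1r ?scale0r ?mulr1 ?mulr0 ?addr0 ?add0r.
- by move=> s t r; case; rewrite /= !pE !mulrDl // addrACA.
- by move=> s t r; case; rewrite /= !pE !mulrDr // addrACA.
- by move=> a b s u; rewrite /= !pE scalerA.
- by move=> s u; rewrite /= !pE scale1r.
- by move=> a s t u; rewrite /= !pE scalerDr.
- by move=> a b s u; rewrite /= !pE scalerDl.
- by move=> a s t; case; rewrite /= !pE ?scalerDr -!pscaleAl.
by move=> a s t; case; rewrite /= !pE ?scalerDr -!pscaleAr.
Qed.

Definition actO (u : ugen) (x : A) : A := T u (prepr x).

Lemma actO_pcls u s : actO u (pcls rel s) = T u s.
Proof. by apply/pclsP/act_cong; exact: pcls_repr. Qed.

Lemma actOD u x y : actO u (x + y) = actO u x + actO u y.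
Proof. by rewrite -(preprK x) -(preprK y) -pclsD !actO_pcls pclsD. Qed.
Lemma actOZ u a x : actO u (a *: x) = a *: actO u x.
Proof. by rewrite -(preprK x) -pclsZ !actO_pcls pclsZ. Qed.
Lemma actO0 u : actO u 0 = 0.
Proof. by rewrite -(scale0r (0 : A)) actOZ !scale0r. Qed.
Lemma actO_sum u I (r : seq I) (P : pred I) (f : I -> A) :
  actO u (\sum_(i <- r | P i) f i) = \sum_(i <- r | P i) actO u (f i).
Proof. exact: (big_morph (actO u) (actOD u) (actO0 u)). Qed.

Lemma actO1 u : actO u 1 = counit_gen F u *: (1 : A).
Proof. by rewrite -(pcls1 rel) actO_pcls pclsZ. Qed.
Lemma actO_gen u x : actO u (gen x) = pcls rel (act_gen q u x).
Proof. exact: actO_pcls. Qed.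

Lemma actOKM x y : actO gK (x * y) = actO gK x * actO gK y.
Proof. by rewrite -(preprK x) -(preprK y) -pclsM !actO_pcls pclsM. Qed.
Lemma actOKiM x y : actO gKi (x * y) = actO gKi x * actO gKi y.
Proof. by rewrite -(preprK x) -(preprK y) -pclsM !actO_pcls pclsM. Qed.
Lemma actOEM x y : actO gE (x * y) = actO gE x * actO gK y + x * actO gE y.
Proof.
by rewrite -(preprK x) -(preprK y) -pclsM !actO_pcls pclsD !pclsM.
Qed.
Lemma actOFM x y : actO gF (x * y) = actO gF x * y + actO gKi x * actO gF y.
Proof.
by rewrite -(preprK x) -(preprK y) -pclsM !actO_pcls pclsD !pclsM.
Qed.

End ActCong.

Definition cact_gen (u : ugen) (l : letter) : cpoly :=
  let: (h, c) := l in
  match u with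
  | gK => [:: (1, 2 * wtl l, [:: l])]
  | gKi => [:: (1, - (2 * wtl l), [:: l])]
  | gE => match c with
          | 1%N => [:: (-1, 2, [:: kb h])]
          | 2%N => [:: (1, 0, [:: kb h])]
          | 3%N => [:: (1, 0, [:: kd h]); (-1, 0, [:: ka h])]
          | _ => [::]
          end
  | gF => match c with
          | 0%N => [:: (1, -1, [:: ka h]); (-1, -1, [:: kd h])]
          | 1%N => [:: (1, 1, [:: kc h])]
          | 2%N => [:: (-1, -1, [:: kc h])]
          | _ => [::]
          end
  end.

Fixpoint cact_word (u : ugen) (w : word) : cpoly :=
  match w with
  | [::] => match u with gK | gKi => [:: (1, 0, [::])] | _ => [::] end
  | x :: v =>
      match u with
      | gK => cmul (cact_gen gK x) (cact_word gK v)
      | gKi => cmul (cact_gen gKi x) (cact_word gKi v)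
      | gE => cmul (cact_gen gE x) (cact_word gK v) ++
              cmul [:: (1, 0, [:: x])] (cact_word gE v)
      | gF => cmul (cact_gen gF x) [:: (1, 0, v)] ++
              cmul (cact_gen gKi x) (cact_word gF v)
      end
  end.

Definition cact (u : ugen) (p : cpoly) : cpoly :=
  flatten [seq cscale m.1 (cact_word u m.2) | m <- p].

Definition sg (b : bool) : 'I_2 := if b then 1 else 0.

Section Letters.
Variable n : nat.

(** [hs] says where the handles of a computed word lie among the n handles. *)
Definition gl (hs : nat -> 'I_n) (l : letter) : Lgen n :=
  (hs l.1, sg (odd l.2), sg (l.2 < 2)%N).

Definition lett (x : Lgen n) : letter :=
  (x.1.1 : nat, (2 * (x.2 == 0%R) + x.1.2)%N).

Lemma lett_gl hs l : (l.2 < 4)%N -> lett (gl hs l) = (hs l.1 : nat, l.2).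
Proof. by case: l => [h [|[|[|[|c]]]]]. Qed.

Lemma gl_lett (hs : nat -> 'I_n) (x : Lgen n) : hs x.1.1 = x.1.1 -> gl hs (lett x) = x.
Proof.
case: x => [[i e] d] /=; rewrite /gl /lett /= => ->.
by case: e d => [[|[|//]] He] [[|[|//]] Hd]; congr (_, _, _); apply: val_inj.
Qed.

Lemma lett_valid x : valid n (lett x).
Proof.
by case: x => [[i e] d]; rewrite /valid /= ltn_ord /=; case: (d == 0); case: e => [[|[|]]].
Qed.

Lemma lwt_gl hs l : (l.2 < 4)%N -> lwt (gl hs l) = wtl l.
Proof. by case: l => [h [|[|[|[|c]]]]]. Qed.

End Letters.

(** * Computation of the action on monomials *)

Section Reification.
Variables (F : fieldType) (q : F) (n : nat).
Variable rel : term F (Lgen n) -> term F (Lgen n) -> Prop.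
Hypothesis act_rel : forall s t, rel s t ->
  forall u, cong rel (act_term q u s) (act_term q u t).
Hypothesis q_neq0 : q != 0.
Local Notation A := (presAlg rel).
Variable hs : nat -> 'I_n.

Definition evA (p : cpoly) : A := evs q (fun w => mon rel (map (gl hs) w)) p.

Lemma evA_cmul p r : evA (cmul p r) = evA p * evA r.
Proof.
rewrite /evA evs_cmul // /evs mulr_suml; apply: eq_bigr => m _.
rewrite -pscaleAl mulr_sumr; congr (_ *: _); apply: eq_bigr => m' _.
by rewrite map_cat mon_cat pscaleAr.
Qed.

Lemma evA1 w : evA [:: (1, 0, w)] = mon rel (map (gl hs) w).
Proof. exact: evs1. Qed.

Lemma evA_cat p r : evA (p ++ r) = evA p + evA r.
Proof. exact: evs_cat. Qed.

Lemma act_gl_E h c : (c < 4)%N -> act_gen q gE (gl hs (h, c)) =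
  let v c := tvar F (gl hs (h, c)) in
  match c with
  | 1%N => tscale (- q ^+ 2) (v 0%N)
  | 2%N => v 0%N
  | 3%N => tadd (v 1%N) (topp (v 2%N))
  | _ => tzero F (Lgen n)
  end.
Proof. by case: c => [|[|[|[|c]]]]. Qed.

Lemma act_gl_F h c : (c < 4)%N -> act_gen q gF (gl hs (h, c)) =
  let v c := tvar F (gl hs (h, c)) in
  match c with
  | 0%N => tscale q^-1 (tadd (v 2%N) (topp (v 1%N)))
  | 1%N => tscale q (v 3%N)
  | 2%N => tscale (- q^-1) (v 3%N)
  | _ => tzero F (Lgen n)
  end.
Proof. by case: c => [|[|[|[|c]]]]. Qed.

Lemma pcls_act_gl u l : (l.2 < 4)%N ->
  pcls rel (act_gen q u (gl hs l)) = evA (cact_gen u l).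
Proof.
have E := (pclsD, pclsZ, pclsN, pcls0).
have E2 := (evs_cons, evs_nil, mon1, addr0).
case: l => [h c] Hc; case: u.
- by rewrite /evA [cact_gen _ _]/= !E2 /cf mul1r -(lwt_gl hs Hc) E.
- by rewrite /evA [cact_gen _ _]/= !E2 /cf mul1r -(lwt_gl hs Hc) E.
- rewrite act_gl_E //; case: c Hc => [|[|[|[|c]]]] // _;
  by rewrite /evA [cact_gen _ _]/= ?E ?E2 /cf ?mul1r ?scale1r ?mulN1r ?scaleN1r ?scaleNr.
rewrite act_gl_F //; case: c Hc => [|[|[|[|c]]]] // _;
by rewrite /evA [cact_gen _ _]/= ?E ?E2 /cf ?mul1r ?scale1r ?mulN1r ?scaleN1r ?scaleNr
  ?scalerBr ?exprN1 ?expr1z.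
Qed.

Lemma evA_cact_word u w : all (fun l => l.2 < 4)%N w ->
  actO q u (mon rel (map (gl hs) w)) = evA (cact_word u w).
Proof.
elim: w u => [|x v IH] u /=.
  rewrite mon_nil actO1 //; case: u; rewrite /= ?evA1 ?mon_nil ?scale1r //.
    by rewrite scale0r /evA evs_nil.
  by rewrite scale0r /evA evs_nil.
case/andP => Hx Hv; rewrite mon_cons.
have HG u' : actO q u' (gen (gl hs x) : A) = evA (cact_gen u' x).
  by rewrite actO_gen // pcls_act_gl.
case: u.
- by rewrite actOKM // HG IH // -evA_cmul.
- by rewrite actOKiM // HG IH // -evA_cmul.
- by rewrite actOEM // HG !IH // evA_cat !evA_cmul evA1 mon1.
by rewrite actOFM // !HG !IH // evA_cat !evA_cmul evA1.
Qed.

Lemma evA_cact u p : {in p, forall m, all (fun l => l.2 < 4)%N m.2} ->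
  actO q u (evA p) = evA (cact u p).
Proof.
move=> Hp; rewrite /evA evs_flatten big_map {1}/evs actO_sum //.
apply: eq_big_seq => m Hm; rewrite actOZ // evA_cact_word ?evs_cscale //.
exact: Hp.
Qed.

End Reification.

(** * The defining relations as computable polynomials *)

Definition cmatrix := nat -> nat -> cpoly.

Definition cmm (A B : cmatrix) : cmatrix :=
  fun a b => collect (flatten [seq cmul (A a k) (B k b) | k <- iota 0 4]).

Definition cflip (a : nat) : nat := nth 0%N [:: 0; 2; 1; 3]%N a.

Definition cR : cmatrix := fun a b =>
  nth [::] (nth [::] [::
    [:: [:: (1, 1, [::])]; [::]; [::]; [::]];
    [:: [::]; [:: (1, 0, [::])]; [:: (1, 1, [::]); (-1, -1, [::])]; [::]];
    [:: [::]; [::]; [:: (1, 0, [::])]; [::]];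
    [:: [::]; [::]; [::]; [:: (1, 1, [::])]]] a) b.

Definition cR21 : cmatrix := fun a b => cR (cflip a) (cflip b).

Definition cR21i : cmatrix := fun a b =>
  nth [::] (nth [::] [::
    [:: [:: (1, -1, [::])]; [::]; [::]; [::]];
    [:: [::]; [:: (1, 0, [::])]; [::]; [::]];
    [:: [::]; [:: (-1, 1, [::]); (1, -1, [::])]; [:: (1, 0, [::])]; [::]];
    [:: [::]; [::]; [::]; [:: (1, -1, [::])]]] a) b.

Definition ccode (e d : nat) : nat := (2 * (d == 0) + e)%N.

Definition cK1 (h : nat) : cmatrix := fun a b =>
  if (a %/ 2 == b %/ 2)%N then [:: (1, 0, [:: (h, ccode (a %% 2) (b %% 2))])]
  else [::].
Definition cK2 (h : nat) : cmatrix := fun a b =>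
  if (a %% 2 == b %% 2)%N then [:: (1, 0, [:: (h, ccode (a %/ 2) (b %/ 2))])]
  else [::].

Definition refl_rel (a b : nat) : cpoly :=
  csub (cmm (cmm (cmm cR21 (cK1 0)) cR) (cK2 0) a b)
       (cmm (cmm (cmm (cK2 0) cR21) (cK1 0)) cR a b).

Definition ell_rel (a b : nat) : cpoly :=
  csub (cscale (1, -1) (cmm (cmm (cmm cR21 (cK1 0)) cR) (cK2 1) a b))
       (cmm (cmm (cmm (cK2 1) cR21) (cK1 0)) cR21i a b).

Definition det_rel : cpoly :=
  csub (csub [:: (1, 0, [:: ka 0; kd 0])] [:: (1, 2, [:: kb 0; kc 0])])
       [:: (1, 0, [::])].

Definition br_rel (c c' : nat) : cpoly :=
  csub [:: (1, 0, [:: (1%N, c); (0%N, c')])] (br_rule c c').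

Section Relations.
Variables (F : fieldType) (q : F) (n : nat).
Hypothesis q_neq0 : q != 0.
Hypothesis q_free : forall k, (0 < k)%N -> q ^+ k != 1.
Local Notation Fr := (freeAlg F (Lgen n)).
Variable hs : nat -> 'I_n.
Local Notation evF := (@evA F q n (fun _ _ => False) hs).

Definition evmx (A : cmatrix) : 'M[Fr]_(2 * 2) := \matrix_(a, b) evF (A a b).

Lemma evmx_mul A B : evmx A *m evmx B = evmx (cmm A B).
Proof.
apply/matrixP => a b; rewrite !mxE /cmm /evA evs_collect evs_flatten big_map.
rewrite -[iota 0 4]/(index_iota 0 (2 * 2)) big_mkord.
by apply: eq_bigr => k _; rewrite !mxE -/(evF _) -evA_cmul.
Qed.

Let ev1 (c e : int) : evF [:: (c, e, [::])] = (c%:~R * q ^ e) *: (1 : Fr).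
Proof. by rewrite /evA evs_cons evs_nil addr0 mon_nil. Qed.
Let ev2 (c e c' e' : int) : evF [:: (c, e, [::]); (c', e', [::])] =
  (c%:~R * q ^ e + c'%:~R * q ^ e') *: (1 : Fr).
Proof. by rewrite /evA !evs_cons evs_nil addr0 mon_nil -scalerDl. Qed.
Let ev0 : evF [::] = (0 : F) *: (1 : Fr).
Proof. by rewrite /evA evs_nil scale0r. Qed.

Lemma evmx_R : scmx n (Rmx q) = evmx cR.
Proof.
apply/matrixP => a b; rewrite !mxE.
case: a b => [[|[|[|[|//]]]] Ha] [[|[|[|[|//]]]] Hb] /=;
by rewrite /cR /= ?ev1 ?ev2 ?ev0 ?mul1r ?expr1z ?expr0z ?mulN1r ?exprN1.
Qed.

Lemma flip_cflip (a : 'I_(2 * 2)) : flip_index a = cflip a :> nat.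
Proof. by case: a => [[|[|[|[|//]]]] Ha]. Qed.

Lemma evmx_R21 : scmx n (R21mx q) = evmx cR21.
Proof.
have /matrixP H := evmx_R; apply/matrixP => a b.
have := H (flip_index a) (flip_index b).
by rewrite !mxE !flip_cflip.
Qed.

Definition R21inv : 'M[F]_(2 * 2) :=
  \matrix_(i, j) nth 0 (nth [::] [::
     [:: q^-1; 0; 0; 0];
     [:: 0; 1; 0; 0];
     [:: 0; - q + q^-1; 1; 0];
     [:: 0; 0; 0; q^-1]] i) j.

Lemma R21mxK : R21mx q *m R21inv = 1%:M.
Proof.
apply/matrixP => a b; rewrite !mxE -[LHS]/(\sum_(k < 4) _) !big_ord_recl big_ord0.
rewrite !mxE !flip_cflip.
case: a b => [[|[|[|[|//]]]] Ha] [[|[|[|[|//]]]] Hb];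
rewrite /cflip /= ?mulr0 ?mul0r ?mulr1 ?mul1r ?addr0 ?add0r ?mulfV //.
by rewrite addrC; ring.
Qed.

Lemma evmx_R21i : scmx n (invmx (R21mx q)) = evmx cR21i.
Proof.
have -> : invmx (R21mx q) = R21inv.
  have [H _] := mulmx1_unit R21mxK.
  by rewrite -[LHS]mulmx1 -R21mxK mulKmx.
apply/matrixP => a b; rewrite !mxE.
case: a b => [[|[|[|[|//]]]] Ha] [[|[|[|[|//]]]] Hb] /=;
by rewrite /cR21i /= ?ev1 ?ev2 ?ev0 ?mul1r ?expr1z ?expr0z ?mulN1r ?exprN1.
Qed.

Lemma kgen_gl h (e d : 'I_2) :
  kgen F (hs h) e d = evF [:: (1, 0, [:: (h, ccode e d)])].
Proof.
rewrite evA1 // mon1 /kgen /gl /ccode /=; congr (gen (_, _, _)); apply: val_inj.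
  by case: e d => [[|[|//]] He] [[|[|//]] Hd].
by case: e d => [[|[|//]] He] [[|[|//]] Hd].
Qed.

Lemma evmx_K1 h : K1mx F (hs h) = evmx (cK1 h).
Proof.
apply/matrixP => a b; rewrite !mxE kgen_gl /cK1 /= -val_eqE /=.
by case: eqP => _; rewrite ?mul1r // mul0r /evA evs_nil.
Qed.

Lemma evmx_K2 h : K2mx F (hs h) = evmx (cK2 h).
Proof.
apply/matrixP => a b; rewrite !mxE kgen_gl /cK2 /= -val_eqE /=.
by case: eqP => _; rewrite ?mulr1 // mulr0 /evA evs_nil.
Qed.

Lemma evF_sub p r : evF (csub p r) = evF p - evF r.
Proof. exact: evs_csub. Qed.

Local Notation R := (scmx n (Rmx q)).
Local Notation R21 := (scmx n (R21mx q)).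
Local Notation R21i := (scmx n (invmx (R21mx q))).

Lemma refl_relE (a b : 'I_(2 * 2)) :
  (R21 *m K1mx F (hs 0%N) *m R *m K2mx F (hs 0%N)) a b -
  (K2mx F (hs 0%N) *m R21 *m K1mx F (hs 0%N) *m R) a b = evF (refl_rel a b).
Proof.
by rewrite evmx_R evmx_R21 evmx_K1 evmx_K2 !evmx_mul evF_sub !mxE.
Qed.

Lemma ell_relE (a b : 'I_(2 * 2)) :
  q^-1 *: (R21 *m K1mx F (hs 0%N) *m R *m K2mx F (hs 1%N)) a b -
  (K2mx F (hs 1%N) *m R21 *m K1mx F (hs 0%N) *m R21i) a b = evF (ell_rel a b).
Proof.
rewrite evmx_R evmx_R21 evmx_R21i evmx_K1 evmx_K2 !evmx_mul evF_sub !mxE.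
by rewrite {3}/evA evs_cscale // /cf /= mul1r exprN1.
Qed.

Lemma det_relE :
  kgen F (hs 0%N) 0 0 * kgen F (hs 0%N) 1 1 -
  q ^+ 2 *: (kgen F (hs 0%N) 0 1 * kgen F (hs 0%N) 1 0) - 1 = evF det_rel.
Proof.
rewrite !kgen_gl !evF_sub -!evA_cmul //; congr (_ - _ - _).
- by rewrite /evA /= !evs_cons !evs_nil !addr0 scalerA /cf /= !mul1r mulr1.
- by rewrite evA1 // mon_nil.
Qed.

Lemma collect_null (V : lmodType F) (f : word -> V) p :
  collect p == [::] -> evs q f p = 0.
Proof. by move=> /eqP E; rewrite -evs_collect // E evs_nil. Qed.

Lemma collect_eq p r : collect (csub p r) == [::] -> evF p = evF r.
Proof. by move/collect_null => H; apply/eqP; rewrite -subr_eq0 -evF_sub /evA H. Qed.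

Lemma q_sub_inv_neq0 : q - q^-1 != 0.
Proof.
apply: contra (q_free (isT : 0 < 2)%N); rewrite subr_eq0 => /eqP E.
by rewrite expr2 {1}E mulVf.
Qed.

Lemma q_add_inv_neq0 : q + q^-1 != 0.
Proof.
apply: contra (q_free (isT : 0 < 4)%N); rewrite addr_eq0 => /eqP E.
have E2 : q ^+ 2 = -1 by rewrite expr2 {1}E mulNr mulVf.
by rewrite (exprM q 2 2) E2 sqrrN expr1n.
Qed.

Lemma qnum1 : qnum q 1 = 1.
Proof. by rewrite /qnum expr1 divff // q_sub_inv_neq0. Qed.

Lemma qnum2 : qnum q 2 = q + q^-1.
Proof.
rewrite /qnum -exprVn subr_sqr mulrAC divff ?mul1r //.
exact: q_sub_inv_neq0.
Qed.

(* E^2 / [2] on the generators, where the universal R-matrix divides by [2]. *)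
Definition cE2 (c : nat) : cpoly :=
  if c == 3 then [:: (-1, 1, [:: kb 1])] else [::].

(** The three terms of [Rgen], with E^2 / [2] replaced by [cE2] so that no division is left; the + 1
    in the last exponent is the factor q to the power ['C(m, 2)] at m = 2. *)
Definition cRgen (c c' : nat) : cpoly :=
  let x := [:: (1, 0, [:: (1%N, c)])] in let y := [:: (1, 0, [:: (0%N, c')])] in
  let wx := wtl (1%N, c) in let wy := wtl (0%N, c') in
  cscale (1, 2 * wx * wy) (cmul y x) ++
  cscale (1, 2 * (wx + 1) * (wy - 1))
    (cmul [:: (1, 1, [::]); (-1, -1, [::])] (cmul (cact gF y) (cact gE x))) ++
  cscale (1, 2 * (wx + 2) * (wy - 2) + 1)
    (cmul (cmul [:: (1, 1, [::]); (-1, -1, [::])] [:: (1, 1, [::]); (-1, -1, [::])])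
       (cmul (cact gF (cact gF y)) (cE2 c))).

Lemma cRgen_br : all (fun c => all (fun c' =>
  collect (csub (cRgen c c') (br_rule c c')) == [::]) (iota 0 4)) (iota 0 4).
Proof. by vm_compute. Qed.

Lemma cE2_half : all (fun c =>
  collect (csub (cact gE (cact gE [:: (1, 0, [:: (1%N, c)])]))
    (cmul [:: (1, 1, [::]); (1, -1, [::])] (cE2 c))) == [::]) (iota 0 4).
Proof. by vm_compute. Qed.

Lemma Rgen_br c c' : (c < 4)%N -> (c' < 4)%N ->
  Rgen q (gl hs (1%N, c)) (gl hs (0%N, c')) = evF (br_rule c c').
Proof.
move=> Hc Hc'; have ic : c \in iota 0 4 by rewrite mem_iota.
have ic' : c' \in iota 0 4 by rewrite mem_iota.
have /collect_eq <- := allP (allP cRgen_br _ ic) _ ic'.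
have /collect_eq HE2 := allP cE2_half _ ic.
have Hrel (s t : term F (Lgen n)) : False -> forall u,
    cong (fun _ _ : term F (Lgen n) => False) (act_term q u s) (act_term q u t).
  by [].
set x := gl hs _; set y := gl hs _.
pose fr := fun _ _ : term F (Lgen n) => False.
pose cx := [:: (1, 0, [:: (1%N, c)])] : cpoly; pose cy := [:: (1, 0, [:: (0%N, c')])] : cpoly.
have Ex : pcls fr (tvar F x) = evF cx by rewrite evA1 // mon1.
have Ey : pcls fr (tvar F y) = evF cy by rewrite evA1 // mon1.
have act1 u s p : pcls fr s = evF p ->
    {in p, forall m, all (fun l => l.2 < 4)%N m.2} ->
    pcls fr (act_term q u s) = evF (cact u p).
  by move=> Es Hp; rewrite -(actO_pcls Hrel) Es (evA_cact Hrel).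
have gcx : {in cx, forall m, all (fun l => l.2 < 4)%N m.2}.
  by move=> m; rewrite inE => /eqP -> /=; rewrite Hc.
have gcy : {in cy, forall m, all (fun l => l.2 < 4)%N m.2}.
  by move=> m; rewrite inE => /eqP -> /=; rewrite Hc'.
have EEx := act1 gE _ _ Ex gcx; have EFy := act1 gF _ _ Ey gcy.
have EEEx : pcls fr (act_term q gE (act_term q gE (tvar F x))) =
    (q + q^-1) *: evF (cE2 c).
  rewrite (act1 _ _ _ EEx); last first.
    by apply/allP; move: Hc; rewrite /cx; case: (c) => [|[|[|[|?]]]].
  rewrite HE2 evA_cmul // /evA !evs_cons evs_nil addr0 mon_nil /cf /= !mul1r.
  by rewrite -scalerDl -pscaleAl mul1r expr1z exprN1.
have EFFy : pcls fr (act_term q gF (act_term q gF (tvar F y))) =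
    evF (cact gF (cact gF cy)).
  rewrite (act1 _ _ _ EFy) //.
  by apply/allP; move: Hc'; rewrite /cy; case: (c') => [|[|[|[|?]]]].
rewrite /Rgen !big_ord_recl big_ord0 addr0 !iterS -/fr /=.
rewrite !/(bump _ _) /= EEEx EFFy EEx EFy Ex Ey.
rewrite !lwt_gl // ?big_nil.
have Ed : evF [:: (1, 1, [::]); (-1, -1, [::])] = (q - q^-1) *: (1 : Fr).
  by rewrite ev2 mul1r mulN1r expr1z exprN1.
have Ez a (p : cpoly) : evF (cscale (1, a) p) = q ^ a *: evF p.
  by rewrite /evA evs_cscale // /cf mul1r.
have -> : evF (cRgen c c') =
    q ^ (2 * wtl (1%N, c) * wtl (0%N, c')) *: (evF cy * evF cx) +
    (q ^ (2 * (wtl (1%N, c) + 1) * (wtl (0%N, c') - 1)) *: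
       ((q - q^-1) *: (evF (cact gF cy) * evF (cact gE cx))) +
     q ^ (2 * (wtl (1%N, c) + 2) * (wtl (0%N, c') - 2) + 1) *:
       ((q - q^-1) *: ((q - q^-1) *: (evF (cact gF (cact gF cy)) * evF (cE2 c))))).
  rewrite /cRgen evA_cat evA_cat !Ez -/cx -/cy.
  set ey := cact gF cy; set ex := cact gE cx; set ey2 := cact gF ey.
  by rewrite !evA_cmul // !Ed -!pscaleAl !mul1r -!pscaleAl !mul1r.
rewrite addr0; congr (_ *: _ + (_ + _)).
- by rewrite bin0n expr0 !mul1r invr1 mul1r; congr (q ^ (_ * _)); exact: subr0.
- by rewrite scalerA big_nat1 qnum1 bin_small // expr0 mul1r expr1 divr1 mulrC.
rewrite addr0 -pscaleAr !scalerA; congr (_ *: _).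
have Ep : \prod_(1 <= l < 3) qnum q l = q + q^-1.
  by rewrite big_nat_recr //= big_nat1 qnum1 mul1r qnum2.
rewrite Ep [in RHS]expfzDr // expr1z bin2 /= expr1.
have := q_add_inv_neq0; set d := q + q^-1 => Hd.
set e := q ^ _; set a := q - q^-1.
have -> : (1 + (1 + 0) = 2)%N by [].
(* The factor [2] produced by E^2 cancels the one in the denominator of the R-matrix. *)
have -> : q * a ^+ 2 / d * e * d = q * a ^+ 2 * e * (d^-1 * d) by ring.
by rewrite mulVf // expr2; ring.
Qed.
End Relations.

Definition all_ugen : seq ugen := [:: gK; gKi; gE; gF].

Definition letters_ok (H : seq nat) (p : cpoly) : bool :=
  all (fun m => all (fun l => (l.2 < 4)%N && (l.1 \in H)) m.2) p.

(** The second test makes the relation a consequence of the rules; the third does the same for its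
    images under the generators of U, so that the action passes to the quotient. *)
Definition rel_ok (lk : rel nat) (H : seq nat) (p : cpoly) : bool :=
  [&& letters_ok H p, cnull lk p &
      all (fun u => letters_ok H (cact u p) && cnull lk (cact u p)) all_ugen].

Lemma refl_rel_ok : all (fun a => all (fun b =>
  rel_ok lk_none [:: 0%N] (refl_rel a b)) (iota 0 4)) (iota 0 4).
Proof. by vm_compute. Qed.

Lemma det_rel_ok : rel_ok lk_none [:: 0%N] det_rel.
Proof. by vm_compute. Qed.

Lemma br_rel_ok : all (fun c => all (fun c' =>
  rel_ok lk_none [:: 0; 1]%N (br_rel c c')) (iota 0 4)) (iota 0 4).
Proof. by vm_compute. Qed.

Lemma ell_rel_ok : all (fun a => all (fun b =>
  rel_ok lk01 [:: 0; 1]%N (ell_rel a b)) (iota 0 4)) (iota 0 4).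
Proof. by vm_compute. Qed.

(* (k, c, e) stands for c q^e times the relation of index k, the entry (a, b)
   of a matrix relation having index 4 a + b. *)
Definition cert := seq (nat * int * int).

Definition ceval (rels : nat -> cpoly) (s : cert) : cpoly :=
  flatten [seq cscale (t.1.2, t.2) (rels t.1.1) | t <- s].

(** Index 16, the first one left free by the matrix entries, is given to the determinant, the source
    of the constant terms in the rules. *)
Definition refl_rels (k : nat) : cpoly :=
  if k == 16%N then det_rel else refl_rel (k %/ 4) (k %% 4).
Definition ell_rels (k : nat) : cpoly := ell_rel (k %/ 4) (k %% 4).

Definition refl_cert (c c' : nat) : cert :=
  (match c, c' with
  | 1%N, 0%N => [:: (7%N, 1, 0)]
  | 1%N, 2%N => [:: (5%N, 1, 0); (16%N, 1, 0)]
  | 2%N, 0%N => [:: (1%N, -1, -1)]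
  | 2%N, 1%N => [:: (16%N, 1, 0)]
  | 3%N, 0%N => [:: (6%N, 1, -1); (16%N, -1, -2); (16%N, 1, 0)]
  | 3%N, 1%N => [:: (13%N, -1, 0)]
  | 3%N, 2%N => [:: (4%N, 1, -1)]
  | _, _ => [::]
  end)%Z.

Definition ell_cert (c c' : nat) : cert :=
  (match c, c' with
  | 0%N, 0%N => [:: (3%N, -1, 1)]
  | 0%N, 1%N => [:: (7%N, -1, 0)]
  | 0%N, 2%N => [:: (2%N, -1, 0)]
  | 0%N, 3%N => [:: (6%N, -1, -1)]
  | 1%N, 0%N => [:: (11%N, -1, 1)]
  | 1%N, 1%N => [:: (15%N, -1, 0)]
  | 1%N, 2%N => [:: (10%N, -1, 0)]
  | 1%N, 3%N => [:: (14%N, -1, -1)]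
  | 2%N, 0%N =>
    [:: (1%N, -1, -1); (2%N, 1, -2); (2%N, -1, 0); (7%N, -1, -2); (7%N, 1, 0)]
  | 2%N, 1%N => [:: (5%N, -1, 0); (6%N, 1, -1); (6%N, -1, 1)]
  | 2%N, 2%N => [:: (0%N, -1, 0); (6%N, -1, -3); (6%N, 1, -1)]
  | 2%N, 3%N => [:: (4%N, -1, 1)]
  | 3%N, 0%N =>
    [:: (9%N, -1, -1); (10%N, 1, -2); (10%N, -1, 0); (15%N, -1, -2);
        (15%N, 1, 0)]
  | 3%N, 1%N => [:: (13%N, -1, 0); (14%N, 1, -1); (14%N, -1, 1)]
  | 3%N, 2%N => [:: (8%N, -1, 0); (14%N, -1, -3); (14%N, 1, -1)]
  | 3%N, 3%N => [:: (12%N, -1, 1)]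
  | _, _ => [::]
  end)%Z.

(** This is the converse of the reductions above: rules follow from relations. The combinations are
    exact in the free algebra, so that collecting terms verifies them. *)
Lemma refl_certP : all (fun c => all (fun c' =>
  if refl_rule c c' is Some r then
    collect (csub (csub [:: (1, 0, [:: (0%N, c); (0%N, c')])] r)
                  (ceval refl_rels (refl_cert c c'))) == [::]
  else true) (iota 0 4)) (iota 0 4).
Proof. by vm_compute. Qed.

Lemma ell_certP : all (fun c => all (fun c' =>
    collect (csub (csub [:: (1, 0, [:: (1%N, c); (0%N, c')])] (ell_rule c c'))
                  (ceval ell_rels (ell_cert c c'))) == [::])
  (iota 0 4)) (iota 0 4).
Proof. by vm_compute. Qed.

(** * PBW basis of the moduli algebra *)

Section Moduli.
Variables (F : fieldType) (q : F) (g n' : nat).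
Hypothesis q_neq0 : q != 0.
Hypothesis q_free : forall k, (0 < k)%N -> q ^+ k != 1.
Local Notation n := n'.+1.
Local Notation fr := (fun _ _ : term F (Lgen n) => False).
Local Notation Fr := (freeAlg F (Lgen n)).
Local Notation relL := (fun s t => @Lrel F q g n (pcls _ s) (pcls _ t)).
Local Notation A := (alekseev q g n).
Local Notation lk := (lkg g).
Local Notation val := (all (valid n)).

(** A defining relation involves one or two handles, hence is one of the checked polynomials placed
    along a map that preserves order and links. *)
Lemma Lrel_reif (x y : Fr) : Lrel q g x y -> exists hs lk0 H p,
  [/\ x - y = evA q fr hs p, ren_mono lk lk0 (fun k => hs k : nat) H &
      rel_ok lk0 H p].
Proof.
have lkF a b : b != a.+1 -> lk a b = false.
  by rewrite /lkg => /negbTE ->; rewrite !andbF.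
have mono1 (i : 'I_n) : ren_mono lk lk_none (fun=> i : nat) [:: 0%N].
  move=> a b; rewrite !inE => /eqP -> /eqP ->; rewrite !eqxx !ltnn; split=> //.
  by rewrite /lkg ltn_eqF // !andbF.
have mono2 (i j : 'I_n) (lk0 : rel nat) : (i < j)%N -> lk0 =2 (if lk i j then lk01 else lk_none) ->
    ren_mono lk lk0 (fun k => (if k == 0%N then i else j) : nat) [:: 0; 1]%N.
  move=> Hij Hlk a b; rewrite Hlk !inE => /orP [] /eqP -> /orP [] /eqP -> /=;
    move: (nat_of_ord i) (nat_of_ord j) Hij => {Hlk}{}i {}j Hij; split;
    try (by lia); case E: (lk i j); rewrite /= ?E ?lkF //; lia.
have i4 (a : 'I_(2 * 2)) : (a : nat) \in iota 0 4 by rewrite mem_iota /=.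
have L4 (l : Lgen n) : (lett l).2 \in iota 0 4.
  by rewrite mem_iota /=; case/andP: (lett_valid l).
case=> [i a b|i|{}x {}y Hlt Hl|i j a b Hl].
- exists (fun=> i), lk_none, [:: 0%N], (refl_rel a b).
  split; [by rewrite -refl_relE|exact: mono1|].
  exact: allP (allP refl_rel_ok _ (i4 a)) _ (i4 b).
- exists (fun=> i), lk_none, [:: 0%N], det_rel.
  split; [by rewrite -det_relE|exact: mono1|exact: det_rel_ok].
- pose hs k := if k == 0%N then y.1.1 else x.1.1.
  have Ex : gl hs (1%N, (lett x).2) = x by rewrite -[RHS](@gl_lett n (fun=> x.1.1)).
  have Ey : gl hs (0%N, (lett y).2) = y by rewrite -[RHS](@gl_lett n (fun=> y.1.1)).
  exists hs, lk_none, [:: 0; 1]%N, (br_rel (lett x).2 (lett y).2); split.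
  + have /andP [_ Hx] := lett_valid x; have /andP [_ Hy] := lett_valid y.
    rewrite /br_rel evF_sub // -Rgen_br // Ex Ey evA1 //= Ex Ey.
    by rewrite mon_cons mon1.
  + apply: mono2 => // a b.
    by move: Hl; rewrite /linked /lkg => /negbTE ->.
  exact: allP (allP br_rel_ok _ (L4 x)) _ (L4 y).
pose hs k := if k == 0%N then i else j.
exists hs, lk01, [:: 0; 1]%N, (ell_rel a b); split.
- by rewrite -ell_relE.
- have Hl' : lk i j by move: Hl; rewrite /linked.
  by apply: mono2 => [|c d]; [case/and3P: Hl' => _ _ /eqP ->|rewrite Hl'].
exact: allP (allP ell_rel_ok _ (i4 a)) _ (i4 b).
Qed.

Lemma rel_ok_letters (hs : nat -> 'I_n) H p : letters_ok H p ->
  [/\ {in p, forall m, all (fun l => l.2 < 4)%N m.2},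
      {in p, forall m, all (fun l => l.1 \in H) m.2} &
      {in p, forall m, val (map (ren (fun k => hs k : nat)) m.2)}].
Proof.
move=> /allP Hp; split=> m /Hp Hm.
- by apply: sub_all Hm => l /andP [].
- by apply: sub_all Hm => l /andP [].
rewrite all_map; apply: sub_all Hm => l /= /andP [Hl _].
by rewrite /valid /= ltn_ord.
Qed.

Definition cow (w0 : word) (w : seq (Lgen n)) : F := co q g n w0 (map (@lett n) w).

(** The difference of the two sides reduces to zero by rules that [co] respects in every context.
    Coefficients of normal forms therefore descend to the algebra, whence the independence of
    reduced words. *)
Lemma cow_rel w0 (x y : Fr) u v : Lrel q g x y ->
  feval x (fun w => cow w0 (u ++ w ++ v)) = feval y (fun w => cow w0 (u ++ w ++ v)).
Proof.
case/Lrel_reif => hs [lk0 [H [p [E Hm /and3P [Hok Hnull _]]]]].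
apply/eqP; rewrite -subr_eq0 -fevalN -fevalD E; apply/eqP.
have [H4 HH HV] := rel_ok_letters hs Hok.
set u' := map (@lett n) u; set v' := map (@lett n) v.
have Vu (z : seq (Lgen n)) : val (map (@lett n) z).
  by rewrite all_map; apply/allP => l _; exact: lett_valid.
have := cnull_ren q_neq0 Hm (f := fun w => co q g n w0 (u' ++ w ++ v'))
  (Q := fun z => val z) _ H4 HH HV Hnull.
rewrite evs_crename => <-.
  rewrite /evA /evs.
  have fs (s : cpoly) (f : seq (Lgen n) -> F) :
      feval (\sum_(m <- s) cf q m.1 *: mon fr (map (gl hs) m.2)) f =
      \sum_(m <- s) cf q m.1 * f (map (gl hs) m.2).
    elim: s => [|m s IH]; first by rewrite !big_nil feval0.
    by rewrite !big_cons fevalD fevalZ feval_mon IH.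
  rewrite fs; apply: eq_big_seq => m Hmp; congr (_ * _).
  rewrite /cow !map_cat /=; congr (co _ _ _ _ (_ ++ _ ++ _)).
  rewrite -map_comp; apply/eq_in_map => l Hl; rewrite /= lett_gl //.
  exact: allP (H4 _ Hmp) _ Hl.
move=> u1 x1 y1 v1 r Hv Er; split.
  have Ec : u' ++ (u1 ++ x1 :: y1 :: v1) ++ v' = (u' ++ u1) ++ x1 :: y1 :: (v1 ++ v').
    by rewrite -!catA.
  rewrite Ec (co_rule q_neq0 w0 _ Er).
    by apply: eq_evs => z; rewrite -!catA.
  by rewrite -Ec all_cat [all _ (_ ++ v')]all_cat Hv !Vu.
by move=> m Hmr; have [] := ctx_dec Hv Er Hmr.
Qed.

Definition coA (w0 : word) (x : A) : F := teval (prepr x) (cow w0).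

Lemma coA_pcls w0 s : coA w0 (pcls _ s) = teval s (cow w0).
Proof.
rewrite /coA (@teval_ext _ _ _ _ (fun w => cow w0 ([::] ++ w ++ [::]))); last first.
  by move=> w; rewrite cats0.
rewrite [RHS](@teval_ext _ _ _ _ (fun w => cow w0 ([::] ++ w ++ [::]))); last first.
  by move=> w; rewrite cats0.
apply: teval_cong (pcls_repr _ _) _ _ => {}s t /cow_rel H u v.
by rewrite -!feval_pcls H.
Qed.

Lemma coAD w0 x y : coA w0 (x + y) = coA w0 x + coA w0 y.
Proof. by rewrite -(preprK x) -(preprK y) -pclsD !coA_pcls. Qed.
Lemma coAZ w0 a x : coA w0 (a *: x) = a * coA w0 x.
Proof. by rewrite -(preprK x) -pclsZ !coA_pcls. Qed.
Lemma coA0 w0 : coA w0 0 = 0.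
Proof. by rewrite -(scale0r (0 : A)) coAZ mul0r. Qed.

Lemma coA_mon w0 w : coA w0 (mon _ w) = cow w0 w.
Proof.
by rewrite -proj_mon /proj coA_pcls -/(feval _ _) feval_mon.
Qed.

Local Notation hs0 := (fun k => inord k : 'I_n).
(** [inord] sends handles out of range to handle 0, so only valid words are represented
    faithfully. *)
Definition word_mon (w : word) : A := mon _ (map (gl hs0) w).
Local Notation wmon := word_mon.

Lemma map_lettK (w : word) : val w -> map (@lett n) (map (gl hs0) w) = w.
Proof.
move=> /allP Hw; rewrite -map_comp -[RHS]map_id; apply/eq_in_map => l /Hw.
by case/andP => H1 H2; rewrite /= lett_gl // inordK // -surjective_pairing.
Qed.

Lemma coA_wmon w0 w : val w -> coA w0 (wmon w) = co q g n w0 w.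
Proof. by move=> Hw; rewrite coA_mon /cow map_lettK. Qed.

Lemma mon_wmon w : mon _ w = wmon (map (@lett n) w).
Proof.
rewrite /word_mon -map_comp; congr mon; rewrite -[LHS]map_id; apply: eq_map => l /=.
by rewrite gl_lett // inord_val.
Qed.

Lemma wmon_cat u v : wmon (u ++ v) = wmon u * wmon v.
Proof. by rewrite /word_mon map_cat mon_cat. Qed.

End Moduli.

(** * The rules and the action in the moduli algebra *)

Section ModuliRules.
Variables (F : fieldType) (q : F) (g n' : nat).
Hypothesis q_neq0 : q != 0.
Hypothesis q_free : forall k, (0 < k)%N -> q ^+ k != 1.
Local Notation n := n'.+1.
Local Notation fr := (fun _ _ : term F (Lgen n) => False).
Local Notation Fr := (freeAlg F (Lgen n)).
Local Notation relL := (fun s t => @Lrel F q g n (pcls _ s) (pcls _ t)).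
Local Notation A := (alekseev q g n).
Local Notation lk := (lkg g).
Local Notation val := (all (valid n)).
Local Notation wmon := (@word_mon F q g n').
Implicit Type hs : nat -> 'I_n.

Lemma proj_evA hs p : proj relL (evA q fr hs p) = evA q relL hs p.
Proof.
rewrite /evA /evs; elim: p => [|m p IH]; first by rewrite !big_nil proj0.
by rewrite !big_cons projD projZ IH proj_mon.
Qed.

Lemma evA_Lrel hs p (x y : Fr) :
  Lrel q g x y -> x - y = evA q fr hs p -> evA q relL hs p = 0.
Proof.
move=> Hxy E; rewrite -proj_evA -E projD projN.
by rewrite [proj _ x](proj_rel Hxy) subrr.
Qed.

Lemma evs_wmon (h : nat -> nat) p :
  evs q wmon (crename (ren h) p) = evA q relL (fun k => inord (h k)) p.
Proof.
rewrite evs_crename; apply: eq_evs => w /=; rewrite /word_mon -map_comp.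
by congr mon; apply: eq_map => l.
Qed.

Lemma ceval0 hs rels (s : cert) :
  (forall k, k \in map (fun t => t.1.1) s -> evA q relL hs (rels k) = 0) ->
  evA q relL hs (ceval rels s) = 0.
Proof.
move=> H; rewrite /evA evs_flatten big_map big1_seq // => t /andP [_ Ht].
rewrite evs_cscale // -/(evA _ _ _ _) H ?scaler0 //.
exact: map_f.
Qed.

(** Braided exchanges are defining relations as they stand; the other rules are the certified
    combinations of relations. *)
Lemma rule_wmon x y r : valid n x -> valid n y -> rule lk x y = Some r ->
  wmon [:: x; y] = evs q wmon r.
Proof.
case: x y => [h c] [h' c'] /andP [/= Hh Hc] /andP [/= Hh' Hc'].
have ic : c \in iota 0 4 by rewrite mem_iota.
have ic' : c' \in iota 0 4 by rewrite mem_iota.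
have null hs (p : cpoly) : collect p == [::] -> evA q relL hs p = 0.
  by move=> H; exact: collect_null H.
have div4 k : (k %/ 4 < 4)%N = (k < 16)%N by rewrite ltn_divLR.
pose o4 k (Hk : (k < 16)%N) : 'I_(2 * 2) * 'I_(2 * 2) :=
  (@Ordinal 4 (k %/ 4) (etrans (div4 k) Hk), @Ordinal 4 (k %% 4) (ltn_pmod k (isT : (0 < 4)%N))).
rewrite /rule /=; case: ifP => [/eqP E|Hne].
  have := allP (allP refl_certP _ ic) _ ic'; cbv beta.
  case: (refl_rule c c') => [r0|] // /null H [<-].
  pose hs (k : nat) : 'I_n := inord h.
  have := H hs; rewrite /evA !evs_csub // evs1 // => /eqP.
  rewrite -!/(evA _ _ hs _) (ceval0 (hs := hs)); last first.
    move=> k Hk; rewrite /refl_rels; case: eqP => [_|/eqP Hk16].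
      by apply: (evA_Lrel (L_det q g (hs 0%N))); rewrite -det_relE.
    have Hk' : (k < 16)%N.
      rewrite ltn_neqAle Hk16 /=; move: k Hk {Hk16}; apply/allP.
      by move: (c) (c') Hc Hc' => [|[|[|[|?]]]] [|[|[|[|?]]]].
    apply: (evA_Lrel (L_reflection q g (hs 0%N) (o4 k Hk').1 (o4 k Hk').2)).
    exact: (refl_relE q_neq0 hs (o4 k Hk').1 (o4 k Hk').2).
  rewrite subr0 subr_eq0 => /eqP H'.
  have -> : place h h = ren (fun=> h).
    by apply/funext => l; rewrite /place /ren; case: ifP.
  by rewrite evs_wmon -H' -E.
case: ifP => // Hlt [<-].
pose hh k := if k == 0%N then h' else h.
pose hs (k : nat) : 'I_n := inord (hh k).
have -> : place h' h = ren hh by [].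
rewrite evs_wmon; case: ifP => Hl.
  have := allP (allP ell_certP _ ic) _ ic' => /(null hs).
  rewrite /evA !evs_csub // evs1 // -!/(evA _ _ hs _) (ceval0 (hs := hs)).
    by rewrite subr0 => /eqP; rewrite subr_eq0 => /eqP.
  move=> k Hk.
  have Hk' : (k < 16)%N.
    move: k Hk; apply/allP.
    by move: (c) (c') Hc Hc' => [|[|[|[|?]]]] [|[|[|[|?]]]].
  have Hlk : linked g (hs 0%N) (hs 1%N) by rewrite /linked /hs /= !inordK.
  apply: (evA_Lrel (L_elliptic q (o4 k Hk').1 (o4 k Hk').2 Hlk)).
  exact: (ell_relE q_neq0 hs (o4 k Hk').1 (o4 k Hk').2).
have : Lrel q g (gen (gl hs (1%N, c)) * gen (gl hs (0%N, c')) : Fr)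
   (Rgen q (gl hs (1%N, c)) (gl hs (0%N, c'))).
  apply: L_braided; first by rewrite /= !inordK.
  by rewrite /linked /= !inordK // -/(lkg g h' h) Hl.
rewrite Rgen_br // => /evA_Lrel -/(_ hs (br_rel c c')).
rewrite /br_rel evF_sub // evA1 //= mon_cons mon1 => /(_ erefl).
rewrite /evA evs_csub // evs1 // => /eqP; rewrite subr_eq0 => /eqP <-.
by rewrite /word_mon.
Qed.

Lemma wmon_rule u x y v r : val (u ++ x :: y :: v) -> rule lk x y = Some r ->
  wmon (u ++ x :: y :: v) = evs q (fun w => wmon (u ++ w ++ v)) r.
Proof.
rewrite all_cat => /andP [_ /= /and3P [Hx Hy _]] Hr.
rewrite -[x :: _]/([:: x; y] ++ v) !wmon_cat (rule_wmon Hx Hy Hr).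
rewrite mulr_suml mulr_sumr; apply: eq_bigr => m _.
by rewrite !wmon_cat -pscaleAl -pscaleAr.
Qed.

(** Computed in the free algebra, the image of a relation under a generator of U reduces to zero,
    and the rules used hold in the quotient by [wmon_rule]. *)
Lemma act_relL s t : relL s t -> forall u, cong relL (act_term q u s) (act_term q u t).
Proof.
move=> Hst u; apply/pclsP.
rewrite -(proj_pcls relL (act_term q u s)) -(proj_pcls relL (act_term q u t)).
have Hfr (s' t' : term F (Lgen n)) : False -> forall u,
    cong fr (act_term q u s') (act_term q u t') by [].
rewrite -(actO_pcls Hfr u s) -(actO_pcls Hfr u t); apply/eqP; rewrite -subr_eq0 -projN -projD.
rewrite -scaleN1r -(actOZ Hfr) -(actOD Hfr) scaleN1r.
have [hs [lk0 [H [p [-> Hm /and3P [Hok _ Hall]]]]]] := Lrel_reif q_neq0 q_free Hst.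
have [H4 _ _] := rel_ok_letters hs Hok.
rewrite (evA_cact Hfr) // proj_evA.
have /andP [Hoku Hnull] : letters_ok H (cact u p) && cnull lk0 (cact u p).
  by case/and5P: Hall => ? ? ? ? _; case: (u).
have [H4u HHu HVu] := rel_ok_letters hs Hoku.
have := cnull_ren q_neq0 Hm (f := wmon) (Q := fun z => val z) _ H4u HHu HVu Hnull.
rewrite evs_wmon => <-; last first.
  move=> u1 x1 y1 v1 r Hv Er; split; first exact: wmon_rule.
  by move=> m Hmr; have [] := ctx_dec Hv Er Hmr.
apply/eqP; congr (evA _ _ _ _); apply/funext => k; exact/esym/inord_val.
Qed.

End ModuliRules.

(** * Invariants *)

(** On generators the relations of U hold already in the free algebra, so collecting terms decides
    them; the coproduct then extends them to products. *)
Lemma KE_check : all (fun c => let x := [:: (1, 0, [:: (0%N, c)])] in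
  (collect (csub (cact gK (cact gE x)) (cscale (1, 2) (cact gE (cact gK x)))) == [::]) &&
  (collect (csub (cact gK (cact gF x)) (cscale (1, -2) (cact gF (cact gK x)))) == [::]))
  (iota 0 4).
Proof. by vm_compute. Qed.

Lemma KKi_check : all (fun c => let x := [:: (1, 0, [:: (0%N, c)])] in
  (collect (csub (cact gK (cact gKi x)) x) == [::]) &&
  (collect (csub (cact gKi (cact gK x)) x) == [::])) (iota 0 4).
Proof. by vm_compute. Qed.

(** Multiplied by q - q^-1, to stay within Laurent polynomials. *)
Lemma EF_check : all (fun c => let x := [:: (1, 0, [:: (0%N, c)])] in
  collect (csub (cmul [:: (1, 1, [::]); (-1, -1, [::])]
      (csub (cact gE (cact gF x)) (cact gF (cact gE x))))
    (csub (cact gK x) (cact gKi x))) == [::]) (iota 0 4).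
Proof. by vm_compute. Qed.

Lemma cact_ok_check : all (fun u => all (fun c =>
  letters_ok [:: 0%N] (cact u [:: (1, 0, [:: (0%N, c)])])) (iota 0 4)) all_ugen.
Proof. by vm_compute. Qed.

(** * The module structure over the quantum group *)

Section ModuliModule.
Variables (F : fieldType) (q : F) (g n' : nat).
Hypothesis q_neq0 : q != 0.
Hypothesis q_free : forall k, (0 < k)%N -> q ^+ k != 1.
Local Notation n := n'.+1.
Local Notation relL := (fun s t => @Lrel F q g n (pcls _ s) (pcls _ t)).
Local Notation A := (alekseev q g n).
Local Notation val := (all (valid n)).
Local Notation wmon := (@word_mon F q g n').
Let act_rel := act_relL q_neq0 q_free (g := g) (n' := n').

Definition Uop (u : ugen) (x : A) : A := actO q u x.
Local Notation op := Uop.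

Lemma op_pcls u s : op u (pcls _ s) = pcls _ (act_term q u s).
Proof. exact: (actO_pcls act_rel). Qed.
Lemma opD u x y : op u (x + y) = op u x + op u y.
Proof. exact: (actOD act_rel). Qed.
Lemma opZ u a x : op u (a *: x) = a *: op u x.
Proof. exact: (actOZ act_rel). Qed.
Lemma op0 u : op u 0 = 0.
Proof. by rewrite -(scale0r (0 : A)) opZ !scale0r. Qed.
Lemma opN u x : op u (- x) = - op u x.
Proof. by rewrite -scaleN1r opZ scaleN1r. Qed.
Lemma opB u x y : op u (x - y) = op u x - op u y.
Proof. by rewrite opD opN. Qed.
Lemma op1 u : op u 1 = counit_gen F u *: (1 : A).
Proof. exact: (actO1 act_rel). Qed.
Lemma opKM x y : op gK (x * y) = op gK x * op gK y.
Proof. exact: (actOKM act_rel). Qed.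
Lemma opKiM x y : op gKi (x * y) = op gKi x * op gKi y.
Proof. exact: (actOKiM act_rel). Qed.
Lemma opEM x y : op gE (x * y) = op gE x * op gK y + x * op gE y.
Proof. exact: (actOEM act_rel). Qed.
Lemma opFM x y : op gF (x * y) = op gF x * y + op gKi x * op gF y.
Proof. exact: (actOFM act_rel). Qed.

Lemma alekseev_ind (P : A -> Prop) : P 1 ->
  (forall l x, P x -> P (gen l * x)) ->
  (forall a x y, P x -> P y -> P (a *: x + y)) -> forall x, P x.
Proof.
move=> P1 PM PL.
have P0 : P 0 by rewrite -(addNr (1 : A)) -scaleN1r; exact: PL.
move=> x; rewrite -(preprK x); set s := prepr x.
(* The claim about multiples is what an induction on terms can carry through products, since [PM]
   only prepends generators. *)
suff H y : P y -> P (pcls _ s * y) by rewrite -[pcls _ s]mulr1; exact: H.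
elim: s y => [l||s IHs t IHt|s IHs t IHt|a s IHs] y Py.
- exact: PM.
- by rewrite pcls1 mul1r.
- rewrite pclsD mulrDl -[pcls _ s * y]scale1r; apply: PL; [exact: IHs|exact: IHt].
- by rewrite pclsM -mulrA; apply: IHs; exact: IHt.
by rewrite pclsZ -pscaleAl -[_ *: _]addr0; apply: PL => //; exact: IHs.
Qed.

Section Generators.
Variable l : Lgen n.
Let hs := fun _ : nat => l.1.1.
Let x := [:: (1, 0, [:: (0%N, (lett l).2)])] : cpoly.

Let ic : (lett l).2 \in iota 0 4.
Proof. by rewrite mem_iota /=; case/andP: (lett_valid l). Qed.

Lemma gen_evA : gen l = evA q relL hs x.
Proof. by rewrite evA1 //= mon1 -[in LHS](@gl_lett _ hs l). Qed.

Lemma op_evA u p : letters_ok [:: 0%N] p -> op u (evA q relL hs p) = evA q relL hs (cact u p).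
Proof.
move=> /(rel_ok_letters hs) [H4 _ _].
by rewrite /Uop (evA_cact act_rel).
Qed.

Lemma op2_evA u v : op u (op v (gen l)) = evA q relL hs (cact u (cact v x)).
Proof.
rewrite gen_evA !op_evA //.
  by move: cact_ok_check => /and5P [H1 H2 H3 H4 _]; case: v;
    [exact: (allP H1 _ ic)|exact: (allP H2 _ ic)|exact: (allP H3 _ ic)|exact: (allP H4 _ ic)].
by rewrite /letters_ok /= andbT; case/andP: (lett_valid l) => _ ->.
Qed.

Lemma op1_evA u : op u (gen l) = evA q relL hs (cact u x).
Proof.
rewrite gen_evA op_evA //.
by rewrite /letters_ok /= andbT; case/andP: (lett_valid l) => _ ->.
Qed.

Let null p r : collect (csub p r) == [::] -> evA q relL hs p = evA q relL hs r.
Proof.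
move=> /(collect_null q (V := A) (fun w => mon _ (map (gl hs) w))).
by rewrite evs_csub // => /eqP; rewrite subr_eq0 => /eqP.
Qed.

Lemma gen_KE : op gK (op gE (gen l)) = q ^+ 2 *: op gE (op gK (gen l)).
Proof.
have /andP [/null H _] := allP KE_check _ ic.
by rewrite !op2_evA H {1}/evA evs_cscale // /cf mul1r.
Qed.

Lemma gen_KF : op gK (op gF (gen l)) = q ^- 2 *: op gF (op gK (gen l)).
Proof.
have /andP [_ /null H] := allP KE_check _ ic.
by rewrite !op2_evA H {1}/evA evs_cscale // /cf mul1r.
Qed.

Lemma gen_KKi : op gK (op gKi (gen l)) = gen l.
Proof.
have /andP [/null H _] := allP KKi_check _ ic.
by rewrite op2_evA H -gen_evA.
Qed.

Lemma gen_KiK : op gKi (op gK (gen l)) = gen l.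
Proof.
have /andP [_ /null H] := allP KKi_check _ ic.
by rewrite op2_evA H -gen_evA.
Qed.

Lemma gen_EF : (q - q^-1) *: (op gE (op gF (gen l)) - op gF (op gE (gen l))) =
  op gK (gen l) - op gKi (gen l).
Proof.
have /null := allP EF_check _ ic.
rewrite evA_cmul // /evA !evs_csub // -!/(evA q relL hs _) => H.
rewrite !op2_evA !op1_evA -H.
rewrite /evA !evs_cons evs_nil addr0 mon_nil -scalerDl -pscaleAl mul1r.
by rewrite /cf /= mul1r mulN1r expr1z exprN1.
Qed.

End Generators.

Lemma opKKi x : op gK (op gKi x) = x.
Proof.
elim/alekseev_ind: x => [|l x IH|a x y IHx IHy].
- by rewrite !op1 !scale1r op1 scale1r.
- by rewrite opKiM opKM gen_KKi IH.
by rewrite !opD !opZ IHx IHy.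
Qed.

Lemma opKiK x : op gKi (op gK x) = x.
Proof.
elim/alekseev_ind: x => [|l x IH|a x y IHx IHy].
- by rewrite !op1 !scale1r op1 scale1r.
- by rewrite opKM opKiM gen_KiK IH.
by rewrite !opD !opZ IHx IHy.
Qed.

Lemma opKE x : op gK (op gE x) = q ^+ 2 *: op gE (op gK x).
Proof.
elim/alekseev_ind: x => [|l x IH|a x y IHx IHy].
- by rewrite !op1 scale0r op0 scale1r op1 scale0r scaler0.
- rewrite opEM opD !opKM opEM gen_KE IH scalerDr.
  by rewrite -pscaleAl -pscaleAr.
by rewrite !opD !opZ IHx IHy scalerDr !scalerA mulrC.
Qed.

Lemma opKF x : op gK (op gF x) = q ^- 2 *: op gF (op gK x).
Proof.
elim/alekseev_ind: x => [|l x IH|a x y IHx IHy].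
- by rewrite !op1 scale0r op0 scale1r op1 scale0r scaler0.
- rewrite opFM opD !opKM opFM gen_KF IH scalerDr gen_KKi gen_KiK.
  by rewrite -pscaleAl -pscaleAr.
by rewrite !opD !opZ IHx IHy scalerDr !scalerA mulrC.
Qed.

Lemma opKiE x : op gKi (op gE x) = q ^- 2 *: op gE (op gKi x).
Proof.
rewrite -{1}[x]opKKi; have := opKE (op gKi x) => /(congr1 (op gKi)).
rewrite opKiK opZ => ->.
by rewrite scalerA mulVf ?scale1r // expf_neq0.
Qed.

Lemma opEF x : op gE (op gF x) - op gF (op gE x) =
  (q - q^-1)^-1 *: (op gK x - op gKi x).
Proof.
have Hd := q_sub_inv_neq0 q_neq0 q_free.
suff H : (q - q^-1) *: (op gE (op gF x) - op gF (op gE x)) = op gK x - op gKi x.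
  by rewrite -H scalerA mulVf // scale1r.
elim/alekseev_ind: x => [|l x IH|a x y IHx IHy].
- by rewrite !op1 !scale0r !op0 !scale1r !subrr scaler0.
- rewrite opFM opEM !opD !opEM !opFM opKM opKiM.
  (* The mixed terms of EF and FE cancel: both commutations produce the same factor q^-2. *)
  have -> : op gKi (op gE (gen l)) * op gF (op gK x) =
     op gE (op gKi (gen l)) * op gK (op gF x).
    by rewrite opKiE opKF -pscaleAl -pscaleAr.
  transitivity ((q - q^-1) *: ((op gE (op gF (gen l)) - op gF (op gE (gen l))) * op gK x
      + op gKi (gen l) * (op gE (op gF x) - op gF (op gE x)))).
    congr (_ *: _); rewrite mulrBl mulrBr.
    rewrite [X in _ - X]addrACA opprD addrACA.
    by rewrite [X in _ - X + _]addrC addrKA [X in _ + (X - _)]addrC addrKA.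
  rewrite scalerDr pscaleAl pscaleAr gen_EF IH mulrBl mulrBr addrA.
  by rewrite subrK.
rewrite !(opD, opZ) opprD addrACA -scalerBr scalerDr scalerA mulrC -scalerA.
by rewrite IHx IHy scalerBr opprD addrACA.
Qed.

Definition opT := fix opT (h : term F ugen) (x : A) : A :=
  match h with
  | tvar u => op u x
  | tone => x
  | tadd h h' => opT h x + opT h' x
  | tmul h h' => opT h (opT h' x)
  | tscale a h => a *: opT h x
  end.

Lemma pcls_act_Uterm h s : pcls _ (act_Uterm q h s) = opT h (pcls relL s).
Proof.
elim: h s => [u||h IH h' IH'|h IH h' IH'|a h IH] s //=.
- by rewrite op_pcls.
- by rewrite pclsD IH IH'.
- by rewrite IH IH'.
by rewrite pclsZ IH.
Qed.

Lemma opTD h x y : opT h (x + y) = opT h x + opT h y.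
Proof.
elim: h x y => [u||h IH h' IH'|h IH h' IH'|a h IH] x y //=.
- exact: opD.
- by rewrite IH IH' addrACA.
- by rewrite IH' IH.
by rewrite IH scalerDr.
Qed.

Lemma opTZ h a x : opT h (a *: x) = a *: opT h x.
Proof.
elim: h x => [u||h IH h' IH'|h IH h' IH'|b h IH] x //=.
- exact: opZ.
- by rewrite IH IH' scalerDr.
- by rewrite IH' IH.
by rewrite IH !scalerA mulrC.
Qed.

Lemma opT_cong (rel : term F ugen -> term F ugen -> Prop) :
  (forall s t, rel s t -> opT s =1 opT t) ->
  forall s t, cong rel s t -> opT s =1 opT t.
Proof.
move=> H s t; elim=> {s t}.
- exact: H.
- by [].
- by move=> s t _ IH x; rewrite IH.
- by move=> s t r _ IH _ IH' x; rewrite IH.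
- by move=> s s' t t' _ IH _ IH' x /=; rewrite IH IH'.
- by move=> s s' t t' _ IH _ IH' x /=; rewrite IH IH'.
- by move=> a s s' _ IH x /=; rewrite IH.
- by move=> s t r x /=; rewrite addrA.
- by move=> s t x /=; rewrite addrC.
- by move=> s x /=; rewrite scale0r add0r.
- by move=> s x /=; rewrite scale0r scaleN1r addNr.
- by [].
- by [].
- by [].
- by [].
- by move=> s t r x /=; rewrite opTD.
- by move=> a b s x /=; rewrite scalerA.
- by move=> s x /=; rewrite scale1r.
- by move=> a s t x /=; rewrite scalerDr.
- by move=> a b s x /=; rewrite scalerDl.
- by [].
by move=> a s t x /=; rewrite opTZ.
Qed.

Local Notation pf := (pcls (fun _ _ : term F ugen => False)).

Lemma opT_free s t : pf s = pf t ->
  opT s =1 opT t.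
Proof. by move/pclsP; exact: opT_cong. Qed.

(** A term in the class of one side of a relation need not be written like that side, so [opT_free]
    first replaces it by a standard representative. *)
Lemma opT_Urel s t :
  Urel q (fun u => gen u) (pf s) (pf t) ->
  opT s =1 opT t.
Proof.
move Ex: (pf s) => x; move Ey: (pf t) => y Hxy.
pose v (u : ugen) := tvar F u.
case: Hxy Ex Ey => Ex Ey.
- have /opT_free H : pf s = pf (tmul (v gK) (v gKi)) by rewrite Ex pclsM.
  have /opT_free H' : pf t = pf tone by rewrite Ey.
  by move=> z; rewrite H H' /= opKKi.
- have /opT_free H : pf s = pf (tmul (v gKi) (v gK)) by rewrite Ex pclsM.
  have /opT_free H' : pf t = pf tone by rewrite Ey.
  by move=> z; rewrite H H' /= opKiK.
- have /opT_free H : pf s = pf (tmul (v gK) (v gE)) by rewrite Ex pclsM.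
  have /opT_free H' : pf t = pf (tscale (q ^+ 2) (tmul (v gE) (v gK))).
    by rewrite Ey pclsZ pclsM.
  by move=> z; rewrite H H' /= opKE.
- have /opT_free H : pf s = pf (tmul (v gK) (v gF)) by rewrite Ex pclsM.
  have /opT_free H' : pf t = pf (tscale (q ^- 2) (tmul (v gF) (v gK))).
    by rewrite Ey pclsZ pclsM.
  by move=> z; rewrite H H' /= opKF.
have /opT_free H : pf s = pf (tadd (tmul (v gE) (v gF)) (topp (tmul (v gF) (v gE)))).
  by rewrite Ex pclsD pclsN !pclsM.
have /opT_free H' : pf t = pf (tscale (q - q^-1)^-1 (tadd (v gK) (topp (v gKi)))).
  by rewrite Ey pclsZ pclsD pclsN.
by move=> z; rewrite H H' /= !scaleN1r opEF.
Qed.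

Lemma opT_one h : opT h 1 = counit_term h *: (1 : A).
Proof.
elim: h => [u||h IH h' IH'|h IH h' IH'|a h IH] /=.
- exact: op1.
- by rewrite scale1r.
- by rewrite IH IH' scalerDl.
- by rewrite IH' opTZ IH scalerA mulrC.
by rewrite IH scalerA.
Qed.

Lemma coA_nil1 : coA [::] (1 : A) = 1.
Proof. by rewrite -(mon_nil relL) coA_mon // /cow [map _ _]/= co_reduced. Qed.

Lemma LinvP (x : A) :
  Linv x <-> [/\ op gK x = x, op gE x = 0 & op gF x = 0].
Proof.
split=> [H|[HK HE HF] h].
  have Hu u : op u x = counit_gen F u *: x.
    have := H (gen u); rewrite /act pcls_act_Uterm preprK.
    have E : opT (prepr (gen u : Uq q)) =1 opT (tvar F u).
      by apply: (opT_cong opT_Urel); exact: pcls_repr.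
    rewrite E /= => ->; congr (_ *: _).
    (* [counit] is computed on a chosen representative of the class of [u]. Acting on 1 and taking
       the coefficient of the empty word, which is 1 on 1, identifies its value with
       [counit_gen]. *)
    have := E 1; rewrite opT_one /= op1 => /(congr1 (coA [::])).
    by rewrite !coAZ // coA_nil1 !mulr1.
  by rewrite !Hu scale1r !scale0r.
have HKi : op gKi x = x by rewrite -{1}HK opKiK.
rewrite /act pcls_act_Uterm preprK /counit.
elim: (prepr h) => [u||s IHs t IHt|s IHs t IHt|a s IHs] /=.
- by case: u; rewrite ?HK ?HKi ?HE ?HF /= ?scale1r ?scale0r.
- by rewrite scale1r.
- by rewrite IHs IHt scalerDl.
- by rewrite IHt opTZ IHs scalerA mulrC.
by rewrite IHs scalerA.
Qed.

End ModuliModule.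

(** * Reduced words by degree and weight *)

Fixpoint allw (n : nat) (j : nat) : seq word :=
  if j is j'.+1 then [seq x :: w | x <- letters n, w <- allw n j'] else [:: [::]].

Lemma mem_letters k l : (l \in letters k) = valid k l.
Proof.
case: l => h c; apply/allpairsP/andP.
  by case=> [[h' c']] [+ + [-> ->]]; rewrite !mem_iota; split.
by case=> Hh Hc; exists (h, c); split; rewrite // mem_iota.
Qed.

Lemma uniq_letters k : uniq (letters k).
Proof. by apply: allpairs_uniq; rewrite ?iota_uniq // => -[? ?] [? ?]. Qed.

Lemma mem_allw n j w : (w \in allw n j) = all (valid n) w && (size w == j).
Proof.
elim: j w => [|j IH] [|x w] //=; rewrite ?andbF //.
  by apply/allpairsP; case=> [[]] /= ? ? [].
apply/allpairsP/idP.
  case=> [[y v]] /= [+ + [-> ->]].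
  by rewrite mem_letters IH eqSS -andbA => -> ->.
by rewrite eqSS -andbA => /andP [Hx Hw]; exists (x, w); split; rewrite //= ?mem_letters ?IH.
Qed.

Lemma uniq_allw n j : uniq (allw n j).
Proof.
elim: j => [|j IH] //=; apply: allpairs_uniq => //; first exact: uniq_letters.
by move=> [? ?] [? ?] _ _ /= [-> ->].
Qed.

Definition nws (g n j : nat) : seq word := [seq w <- allw n j | reduced g w].
Definition nwsw (g n j : nat) (a : int) : seq word := [seq w <- nws g n j | wt w == a].
Fixpoint nwsle (g n j : nat) : seq word :=
  (if j is j'.+1 then nwsle g n j' else [::]) ++ nws g n j.

Lemma mem_nws g n j w :
  (w \in nws g n j) = [&& reduced g w, all (valid n) w & size w == j].
Proof. by rewrite mem_filter mem_allw. Qed.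

Lemma uniq_nws g n j : uniq (nws g n j).
Proof. exact/filter_uniq/uniq_allw. Qed.

Lemma mem_nwsle g n j w :
  (w \in nwsle g n j) = [&& reduced g w, all (valid n) w & (size w <= j)%N].
Proof.
elim: j => [|j IH]; first by rewrite /= mem_nws leqn0.
rewrite [nwsle _ _ _]/= mem_cat -/(nwsle g n j) IH mem_nws [in RHS]leq_eqVlt ltnS.
by case: (reduced g w); case: (all _ w); rewrite //= orbC.
Qed.

Lemma uniq_nwsle g n j : uniq (nwsle g n j).
Proof.
elim: j => [|j IH]; first exact: uniq_nws.
rewrite [nwsle _ _ _]/= cat_uniq -/(nwsle g n j) IH uniq_nws andbT.
apply/hasPn => w; rewrite mem_nws => /and3P [_ _ /eqP Hs].
by rewrite mem_nwsle Hs ltnn !andbF.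
Qed.

Lemma wt_le_size w : (`|wt w| <= (size w)%:Z)%R.
Proof.
elim: w => [|x w IH]; first by rewrite wt_nil.
rewrite wt_cons /= -add1n PoszD; apply: le_trans (ler_normD _ _) _.
apply: lerD => //; rewrite /wtl; case: (x.2) => [|[|[|[|]]]] //.
Qed.

(** * Bases and weight spaces of the filtration pieces *)

Section Filtration.
Variables (F : fieldType) (q : F) (g n' : nat).
Hypothesis q_neq0 : q != 0.
Hypothesis q_free : forall k, (0 < k)%N -> q ^+ k != 1.
Local Notation n := n'.+1.
Local Notation relL := (fun s t => @Lrel F q g n (pcls _ s) (pcls _ t)).
Local Notation A := (alekseev q g n).
Local Notation val := (all (valid n)).
Local Notation wmon := (@word_mon F q g n').
Local Notation op := (@Uop F q g n').
Local Notation fil := (@genfil F (Lgen n) relL).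
Implicit Types (x y z : A) (a : int).

Let Q0 := q_neq0.
Let QF := q_free.

Lemma filP j x : fil j x <-> exists s : seq (F * word),
  all (fun p => val p.2 && (size p.2 <= j)%N) s /\ x = \sum_(p <- s) p.1 *: wmon p.2.
Proof.
split=> [[s [Hs ->]]|[s [Hs ->]]].
  exists [seq (p.1, map (@lett n) p.2) | p <- s]; split.
    rewrite all_map; apply: sub_all Hs => p /= Hp; rewrite size_map Hp andbT.
    by rewrite all_map; apply/allP => l _; exact: lett_valid.
  by rewrite big_map; apply: eq_bigr => p _; rewrite -mon_wmon.
exists [seq (p.1, map (gl (fun k => inord k)) p.2) | p <- s]; split.
  by rewrite all_map; apply: sub_all Hs => p /= /andP [_]; rewrite size_map.
by rewrite big_map.
Qed.

Lemma fil_wmon w j : val w -> (size w <= j)%N -> fil j (wmon w).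
Proof.
move=> Hv Hs; apply/filP; exists [:: (1, w)]; rewrite /= Hv Hs; split=> //.
by rewrite big_seq1 scale1r.
Qed.

Lemma fil0 j : fil j 0.
Proof. by exists [::]; rewrite big_nil. Qed.

Lemma fil_lin j c x y : fil j x -> fil j y -> fil j (c *: x + y).
Proof.
case=> [s [Hs ->]] [t [Ht ->]].
exists ([seq (c * p.1, p.2) | p <- s] ++ t); rewrite all_cat all_map Ht andbT.
split=> //; rewrite big_cat big_map scaler_sumr; congr (_ + _).
by apply: eq_bigr => p _; rewrite scalerA.
Qed.

Lemma filZ j c x : fil j x -> fil j (c *: x).
Proof. by move=> H; rewrite -[_ *: _]addr0; apply: fil_lin => //; exact: fil0. Qed.
Lemma filB j x y : fil j x -> fil j y -> fil j (x - y).
Proof. by move=> Hx Hy; rewrite addrC -scaleN1r; exact: fil_lin. Qed.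
Lemma fil_sum j I (r : seq I) (P : pred I) (f : I -> A) :
  (forall i, P i -> fil j (f i)) -> fil j (\sum_(i <- r | P i) f i).
Proof.
move=> H; apply: (big_ind (fil j)) => //; first exact: fil0.
by move=> x y Hx Hy; rewrite -[x]scale1r; exact: fil_lin.
Qed.

Lemma fil_mono j k x : (j <= k)%N -> fil j x -> fil k x.
Proof.
move=> Hjk [s [Hs ->]]; exists s; split=> //.
by apply: sub_all Hs => p /leq_trans ->.
Qed.

Lemma fil_ind j (P : A -> Prop) : P 0 ->
  (forall c x y, P x -> P y -> P (c *: x + y)) ->
  (forall w, val w -> (size w <= j)%N -> P (wmon w)) -> forall x, fil j x -> P x.
Proof.
move=> P0 PL PM x /filP [s [Hs ->]]; elim: s Hs => [|p s IH] /=.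
  by rewrite big_nil.
by case/andP => /andP [Hv Hp] /IH H; rewrite big_cons; apply: PL => //; exact: PM.
Qed.

Lemma fil_all x : exists j, fil j x.
Proof.
elim/alekseev_ind: x => [|l x [j [s [Hs ->]]]|c x y [j Hj] [k Hk]].
- by exists 0%N; rewrite -(mon_nil relL); apply/(fil_wmon (w := [::])).
- exists j.+1, [seq (p.1, l :: p.2) | p <- s]; rewrite all_map; split=> //.
  rewrite big_map mulr_sumr; apply: eq_bigr => p _.
  by rewrite big_cons /= pscaleAr.
by exists (maxn j k); apply: fil_lin; [apply: fil_mono Hj|apply: fil_mono Hk];
  rewrite ?leq_maxl ?leq_maxr.
Qed.

Lemma wmon_expand w : val w ->
  wmon w = \sum_(w0 <- nwsle g n (size w)) (co q g n w0 w : F) *: wmon w0.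
Proof.
move Ek: (code n w) => k; elim/ltn_ind: k w Ek => k IH w Ek Vw.
(* A longer range of summation is allowed, so that all monomials of the reduct can share it. *)
suff H j : (size w <= j)%N -> wmon w = \sum_(w0 <- nwsle g n j) (co q g n w0 w : F) *: wmon w0.
  exact: H.
move=> Hj; case E: (red1 (lkg g) w) => [r|].
  have Ew : wmon w = evs q wmon r.
    have [u [x [y [v [r' [Ew Er -> _]]]]]] := red1_some E.
    by rewrite evs_place {1}Ew; apply: wmon_rule => //; rewrite -Ew.
  rewrite Ew; under eq_bigr do rewrite coE // E /evs scaler_suml.
  rewrite exchange_big; apply: eq_big_seq => m Hm.
  have [H1 H2 H3 _] := red1_dec Vw E Hm; rewrite Ek in H3.
  rewrite (IH _ H3 _ erefl H1) scaler_sumr.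
  have Hsub : {subset nwsle g n (size m.2) <= nwsle g n j}.
    move=> w0; rewrite !mem_nwsle => /and3P [-> -> H4] /=.
    by rewrite (leq_trans H4) // (leq_trans H2).
  have -> : \sum_(w0 <- nwsle g n (size m.2)) cf q m.1 *: ((co q g n w0 m.2 : F) *: wmon w0)
     = \sum_(w0 <- nwsle g n j | w0 \in nwsle g n (size m.2)) cf q m.1 *: ((co q g n w0 m.2 : F) *: wmon w0).
    rewrite -[RHS]big_filter; apply: perm_big; apply: uniq_perm; rewrite ?filter_uniq ?uniq_nwsle //.
    by move=> w0; rewrite mem_filter; case E0: (w0 \in _); rewrite //= Hsub.
  rewrite big_mkcond; apply: eq_bigr => w0 _; rewrite scalerA.
  case: ifP => // /negP Hn; have [->|Hne] := eqVneq (co q g n w0 m.2) 0.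
    by rewrite scaler0 scale0r.
  by case: Hn; rewrite mem_nwsle; have [-> -> -> _] := co_supp H1 Hne.
have Hw : w \in nwsle g n j by rewrite mem_nwsle /reduced E Vw Hj.
rewrite (bigD1_seq w) ?uniq_nwsle //= co_reduced /reduced ?E // eqxx scale1r.
rewrite big1 ?addr0 // => w0 Hne.
by rewrite co_reduced /reduced ?E // eq_sym (negbTE Hne) scale0r.
Qed.

(** Spanning. With [coA_wmon] and [co_reduced] it makes the reduced words of length at most j a
    basis of the j-th piece, with coordinates [coA]. *)
Lemma fil_expand j x : fil j x ->
  x = \sum_(w0 <- nwsle g n j) coA w0 x *: wmon w0.
Proof.
move=> H; pattern x; move: x H; apply: fil_ind.
- by rewrite big1 // => w0 _; rewrite coA0 // scale0r.
- move=> c x y {1}-> {1}->; rewrite scaler_sumr -big_split /=.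
  by apply: eq_bigr => w0 _; rewrite coAD // coAZ // scalerA -scalerDl.
move=> w Hv Hs; rewrite {1}wmon_expand //.
have Hsub : {subset nwsle g n (size w) <= nwsle g n j}.
  move=> w0; rewrite !mem_nwsle => /and3P [-> -> H4] /=.
  by rewrite (leq_trans H4).
have -> : \sum_(w0 <- nwsle g n (size w)) (co q g n w0 w : F) *: wmon w0
   = \sum_(w0 <- nwsle g n j | w0 \in nwsle g n (size w)) (co q g n w0 w : F) *: wmon w0.
  rewrite -[RHS]big_filter; apply: perm_big; apply: uniq_perm; rewrite ?filter_uniq ?uniq_nwsle //.
  by move=> w0; rewrite mem_filter; case E0: (w0 \in _); rewrite //= Hsub.
rewrite big_mkcond; apply: eq_bigr => w0 _; rewrite coA_wmon //.
case: ifP => // /negP Hn; have [->|Hne] := eqVneq (co q g n w0 w) 0.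
  by rewrite scale0r.
by case: Hn; rewrite mem_nwsle; have [-> -> -> _] := co_supp Hv Hne.
Qed.

Lemma coA_supp j x w0 : fil j x -> coA w0 x != 0 -> w0 \in nwsle g n j.
Proof.
move=> Hx; apply: contraR => Hw0; apply/eqP; pattern x; move: x Hx; apply: fil_ind.
- by rewrite coA0.
- by move=> c x y Hx Hy; rewrite coAD // coAZ // Hx Hy mulr0 addr0.
move=> w Hv Hs; rewrite coA_wmon //; apply/eqP; apply: contraNT Hw0 => Hne.
have [H1 H2 H3 _] := co_supp Hv Hne.
by rewrite mem_nwsle H1 H2 (leq_trans H3).
Qed.

Lemma fil_eq0 j x : fil j x -> (forall w, w \in nwsle g n j -> coA w x = 0) -> x = 0.
Proof.
move=> Hx H; rewrite (fil_expand Hx) big_seq big1 // => w /H ->.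
by rewrite scale0r.
Qed.

Lemma op_wmon_fil u w : val w -> fil (size w) (op u (wmon w)).
Proof.
have act_rel := act_relL Q0 QF (g := g) (n' := n').
move=> Hv; rewrite /Uop /word_mon (evA_cact_word act_rel) //; last first.
  by apply: sub_all Hv => l /andP [].
have : {in cact_word u w, forall m, size m.2 = size w}.
  have Hg u' l : {in cact_gen u' l, forall m, size m.2 = 1%N}.
    move=> m Hm; apply/eqP; move: m Hm; apply/allP.
    by case: u' l => -[h [|[|[|[|c]]]]].
  elim: w u {Hv} => [|l w IH] u m.
    by case: u; rewrite ?inE // => /eqP ->.
  have HM p p' k k' : {in p, forall m : int * int * word, size m.2 = k} ->
      {in p', forall m : int * int * word, size m.2 = k'} ->
      {in cmul p p', forall m, size m.2 = (k + k')%N}.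
    move=> Hp Hp' _ /allpairsP [[a b] /= [Ha Hb ->]] /=.
    by rewrite size_cat Hp ?Hp'.
  have H1 w' : {in [:: (1, 0, w')] : cpoly, forall m, size m.2 = size w'}.
    by move=> m'; rewrite inE => /eqP ->.
  case: u => /=.
  - by move/(HM _ _ _ _ (Hg _ _) (IH _)).
  - by move/(HM _ _ _ _ (Hg _ _) (IH _)).
  - rewrite mem_cat; case/orP; first exact: (HM _ _ _ _ (Hg _ _) (IH _)).
    exact: (HM _ _ _ _ (H1 _) (IH _)).
  rewrite mem_cat; case/orP; first exact: (HM _ _ _ _ (Hg _ _) (H1 _)).
  exact: (HM _ _ _ _ (Hg _ _) (IH _)).
move=> Hsz; exists [seq (cf q m.1, map (gl (fun k => inord k)) m.2) | m <- cact_word u w].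
split; last by rewrite big_map.
by rewrite all_map; apply/allP => m /Hsz /= <-; rewrite size_map.
Qed.

Lemma op_fil u j x : fil j x -> fil j (op u x).
Proof.
move: x; apply: fil_ind.
- by rewrite op0 //; exact: fil0.
- by move=> c x y Hx Hy; rewrite opD // opZ //; exact: fil_lin.
by move=> w Hv Hs; apply: fil_mono Hs (op_wmon_fil _ Hv).
Qed.

Lemma opK_wmon w : val w -> op gK (wmon w) = q ^ (2 * wt w) *: wmon w.
Proof.
elim: w => [|l w IH] /=.
  by rewrite /word_mon mon_nil op1 // wt_nil mulr0 expr0z.
case/andP => Hl Hw; rewrite -cat1s wmon_cat opKM // IH //.
rewrite wt_cons mulrDr expfzDr // -pscalM; congr (_ * _).
rewrite /word_mon /= mon1 /Uop (actO_gen (act_relL Q0 QF)).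
have /andP [_ H4] := Hl.
by rewrite -[2 * wtl l](congr1 (fun a => 2 * a) (lwt_gl (fun k => inord k : 'I_n) H4)) /= pclsZ.
Qed.

Definition wt_space a x : Prop := op gK x = q ^ (2 * a) *: x.
Local Notation wtsp := wt_space.

Lemma wtsp_lin a c x y : wtsp a x -> wtsp a y -> wtsp a (c *: x + y).
Proof.
by rewrite /wt_space => Hx Hy; rewrite opD // opZ // Hx Hy scalerDr !scalerA mulrC.
Qed.

Lemma wtsp0 a : wtsp a 0.
Proof. by rewrite /wt_space op0 // scaler0. Qed.

Lemma coA_opK w0 x : coA w0 (op gK x) = q ^ (2 * wt w0) * coA w0 x.
Proof.
have [j Hj] := fil_all x; pattern x; move: x Hj; apply: fil_ind.
- by rewrite op0 // coA0 // mulr0.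
- by move=> c x y Hx Hy; rewrite opD // opZ // !coAD // !coAZ // Hx Hy mulrDr mulrCA.
move=> w Hv _; rewrite opK_wmon // coAZ // coA_wmon //.
have [->|Hne] := eqVneq (co q g n w0 w) 0; first by rewrite !mulr0.
by have [_ _ _ ->] := co_supp Hv Hne.
Qed.

Lemma q_pow_inj (a b : int) : q ^ a = q ^ b -> a = b.
Proof.
wlog le_ab : a b / b <= a => [H|E].
  by case/orP: (le_total a b) => ? E; [symmetry|]; apply: H.
have : q ^ (a - b) = 1 by rewrite expfzDr // E -expfzDr // subrr.
have : 0 <= a - b by rewrite subr_ge0.
move Ed: (a - b) => [d|//] _ /eqP; case: d Ed => [|d] Ed.
  by move=> _; apply/eqP; rewrite -subr_eq0 Ed.
by rewrite -exprnP (negbTE (QF _)).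
Qed.

(** As q is not a root of unity, distinct weights are distinct eigenvalues of K. *)
Lemma wtsp_coA a x w0 : wtsp a x -> coA w0 x != 0 -> wt w0 = a.
Proof.
move=> /(congr1 (coA w0)); rewrite coA_opK coAZ // => E Hne.
have /q_pow_inj := mulIf Hne E.
by move/mulfI; apply.
Qed.

(** Each letter has weight -1, 0 or 1, so weights are bounded by the degree; this is the source of
    the nilpotency of E and F on a piece. *)
Lemma wtsp_fil_eq0 a j x : fil j x -> wtsp a x -> j%:Z < `|a| -> x = 0.
Proof.
move=> Hx Ha Hlt; apply: (fil_eq0 Hx) => w Hw; apply/eqP.
apply: contraTT Hlt => Hne; rewrite -leNgt -(wtsp_coA Ha Hne).
apply: le_trans (wt_le_size w) _; rewrite lez_nat.
by move: Hw; rewrite mem_nwsle => /and3P [].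
Qed.

Lemma wtsp_E a x : wtsp a x -> wtsp (a + 1) (op gE x).
Proof.
rewrite /wt_space => Ha; rewrite opKE // Ha opZ // scalerA; congr (_ *: _).
by rewrite mulrDr expfzDr // mulrC.
Qed.

Lemma wtsp_F a x : wtsp a x -> wtsp (a - 1) (op gF x).
Proof.
rewrite /wt_space => Ha; rewrite opKF // Ha opZ // scalerA; congr (_ *: _).
by rewrite mulrBr expfzDr // mulrC.
Qed.

Lemma wtsp_Ki a x : wtsp a x -> op gKi x = q ^ (- (2 * a)) *: x.
Proof.
move=> Ha; rewrite -[x in RHS](opKiK Q0 QF) Ha opZ // scalerA -expfzDr // addNr.
by rewrite expr0z scale1r.
Qed.

End Filtration.

(** * Highest weight vectors in a filtration piece *)

Section HighestWeight.
Variables (F : fieldType) (q : F) (g n' : nat).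
Hypothesis q_neq0 : q != 0.
Hypothesis q_free : forall k, (0 < k)%N -> q ^+ k != 1.
Local Notation n := n'.+1.
Local Notation relL := (fun s t => @Lrel F q g n (pcls _ s) (pcls _ t)).
Local Notation A := (alekseev q g n).
Local Notation op := (@Uop F q g n').
Local Notation fil := (@genfil F (Lgen n) relL).
Local Notation wtsp := (@wt_space F q g n').
Implicit Types (x y z v : A) (a : int).

(** The quantum integer [k], k of any sign. Vectors in [wtsp a] have weight 2a in the usual
    normalisation. *)
Definition br (k : int) : F := (q ^ k - q ^ (- k)) / (q - q^-1).

Let d_neq0 : q - q^-1 != 0 := q_sub_inv_neq0 q_neq0 q_free.

Lemma br_neq0 k : k != 0 -> br k != 0.
Proof.
move=> Hk; rewrite mulf_neq0 ?invr_neq0 // subr_eq0; apply/eqP.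
by move/(q_pow_inj q_neq0 q_free); lia.
Qed.

(** The induction step of the formula E F^(k+1) v = [k+1] [2a-k] F^k v in [E_iterF]. *)
Lemma br_rec (k w : int) :
  br k * br (2 * w - k + 1) + br (2 * (w - k)) = br (k + 1) * br (2 * w - k).
Proof.
rewrite /br.
have E a b : q ^ (a + b) = q ^ a * q ^ b by rewrite expfzDr.
have EN a : q ^ (- a) = (q ^ a)^-1 by rewrite -invr_expz.
have E2 a : q ^ (2 * a) = q ^ a * q ^ a by rewrite -E; congr (q ^ _); lia.
rewrite !EN !(E, E2) !EN expr1z.
have Hk : q ^ k != 0 by rewrite expfz_neq0.
have Hw : q ^ w != 0 by rewrite expfz_neq0.
move: (q ^ k) (q ^ w) Hk Hw => Q W Hk Hw.
field; rewrite q_neq0 Hk Hw /= andbT subr_eq0 -expr2.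
exact: q_free.
Qed.

Lemma EF_wtsp a x : wtsp a x -> op gE (op gF x) = op gF (op gE x) + br (2 * a) *: x.
Proof.
move=> Ha; rewrite -[LHS](subrK (op gF (op gE x))) addrC; congr (_ + _).
rewrite opEF // (wtsp_Ki q_neq0 q_free Ha) Ha -scalerBl scalerA mulrC.
by rewrite /br.
Qed.

Lemma op_iter_wtsp k a x : wtsp a x -> wtsp (a - k%:Z) (iter k (op gF) x).
Proof.
move=> Ha; elim: k => [|k IH]; first by rewrite subr0.
by rewrite iterS -addn1 PoszD opprD addrA; exact: wtsp_F.
Qed.

Lemma op_iterE_wtsp k a x : wtsp a x -> wtsp (a + k%:Z) (iter k (op gE) x).
Proof.
move=> Ha; elim: k => [|k IH]; first by rewrite addr0.
by rewrite iterS -addn1 PoszD addrA; exact: wtsp_E.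
Qed.

Lemma iter_fil u k j x : fil j x -> fil j (iter k (op u) x).
Proof. by move=> Hx; elim: k => [|k IH] //; rewrite iterS; exact: op_fil. Qed.

Lemma iter_opZ u k c x : iter k (op u) (c *: x) = c *: iter k (op u) x.
Proof. by elim: k => [|k IH] //; rewrite !iterS IH opZ. Qed.

Lemma iter_opB u k x y : iter k (op u) (x - y) = iter k (op u) x - iter k (op u) y.
Proof. by elim: k => [|k IH] //; rewrite !iterS IH opB. Qed.

Lemma E_iterF k a v : wtsp a v -> op gE v = 0 ->
  op gE (iter k.+1 (op gF) v) = (br k.+1 * br (2 * a - k%:Z)) *: iter k (op gF) v.
Proof.
move=> Ha HE; elim: k => [|k IH].
  rewrite [iter 1 _ _]/= (EF_wtsp Ha) HE op0 // add0r subr0; congr (_ *: _).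
  by rewrite /br expr1z exprN1 divff // mul1r.
rewrite iterS (EF_wtsp (op_iter_wtsp k.+1 Ha)) IH opZ // -iterS -scalerDl.
congr (_ *: _); have := br_rec k.+1 a.
have -> : 2 * a - k.+1%:Z + 1 = 2 * a - k%:Z by lia.
by move=> ->; congr (br _ * br _); lia.
Qed.

(** Up to k = 2a the string from [v] has not ended: the factors [i+1] [2a-i] with i < k are
    nonzero. *)
Lemma iterE_iterF k a v : wtsp a v -> op gE v = 0 -> 0 < 2 * a - k%:Z + 1 ->
  exists2 c : F, c != 0 & iter k (op gE) (iter k (op gF) v) = c *: v.
Proof.
move=> Ha HE; elim: k => [|k IH] Hk; first by exists 1; rewrite ?oner_neq0 ?scale1r.
have [|c Hc Ec] := IH; first by lia.
exists (br k.+1 * br (2 * a - k%:Z) * c).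
  by apply: mulf_neq0 => //; apply: mulf_neq0; apply: br_neq0; lia.
by rewrite iterSr (E_iterF k Ha HE) iter_opZ Ec scalerA.
Qed.

(** Induction on the order k + 1 of nilpotency of E at [v]. The vector E^k v is killed by E, so F^k
    E^k v is a multiple of E F^(k+1) E^k v, and a suitable multiple of it subtracted from [v] leaves
    a vector killed by E^k. *)
Lemma E_surj j a v : 0 < a -> fil j v -> wtsp a v ->
  exists u, [/\ fil j u, wtsp (a - 1) u & op gE u = v].
Proof.
move=> Ha Hf Hw.
have : iter j.+1 (op gE) v = 0.
  apply: (wtsp_fil_eq0 q_neq0 q_free (iter_fil _ _ Hf) (op_iterE_wtsp j.+1 Hw)).
  by lia.
elim: j.+1 v Hf Hw => [|k IH] v Hf Hw /= H0.
  exists 0; rewrite op0 //; split=> //; [exact: fil0|exact: wtsp0].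
set u0 := iter k (op gE) v.
have Hu0 : wtsp (a + k%:Z) u0 by exact: op_iterE_wtsp.
have Fu0 : fil j u0 by exact: iter_fil.
have [|c Hc Ec] := iterE_iterF (k := k) Hu0 H0; first by lia.
set z := iter k (op gF) u0.
have Hz : wtsp a z by rewrite -[a](addrK k%:Z); exact: op_iter_wtsp.
have Fz : fil j z by exact: iter_fil.
have [u [Fu Wu Eu]] : exists u, [/\ fil j u, wtsp (a - 1) u & op gE u = v - c^-1 *: z].
  apply: IH.
  - by apply: filB => //; exact: filZ.
  - by rewrite addrC -scaleNr; exact: wtsp_lin.
  by rewrite iter_opB iter_opZ Ec scalerA mulVf // scale1r subrr.
have := E_iterF k Hu0 H0; rewrite -/z iterS -/z => Ez.
(* Here b = [k+1] [2(a+k)-k], whose two indices are positive because a > 0. *)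
set b := br k.+1 * _ in Ez.
have Hb : b != 0 by apply: mulf_neq0; apply: br_neq0; lia.
exists ((c^-1 * b^-1) *: op gF z + u); split.
- by apply: fil_lin => //; exact: op_fil.
- by apply: wtsp_lin => //; exact: wtsp_F.
by rewrite opD // opZ // Ez scalerA -mulrA mulVf // mulr1 Eu addrC subrK.
Qed.

(** A high power of F kills [v]. In weight 0, E F^(k+2) v = [k+2] [-(k+1)] F^(k+1) v with nonzero
    factors, so the power can be lowered down to F itself. *)
Lemma E_ker_F j v : fil j v -> wtsp 0 v -> op gE v = 0 -> op gF v = 0.
Proof.
move=> Hf Hw HE.
suff H k : iter k.+1 (op gF) v = 0 -> op gF v = 0.
  apply: (H j); apply: (wtsp_fil_eq0 q_neq0 q_free (iter_fil _ _ Hf) (op_iter_wtsp j.+1 Hw)).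
  by lia.
elim: k => [|k IH] // H; apply: IH.
have := E_iterF k.+1 Hw HE; rewrite H op0 // => /esym/eqP; rewrite scaler_eq0.
case/orP => [|/eqP //]; rewrite mulf_eq0 => /orP [] /eqP E.
  by have := @br_neq0 k.+2 isT; rewrite E eqxx.
have : br (2 * 0 - k.+1%:Z) != 0 by apply: br_neq0; lia.
by rewrite E eqxx.
Qed.

Lemma Linv_filP j x : Linv_fil j x <-> [/\ fil j x, wtsp 0 x & op gE x = 0].
Proof.
split=> [[/(LinvP q_neq0 q_free) [HK HE _] Hf]|[Hf HK HE]].
  by split=> //; rewrite /wt_space mulr0 expr0z scale1r.
split=> //; apply/(LinvP q_neq0 q_free); split=> //.
  by rewrite HK mulr0 expr0z scale1r.
exact: E_ker_F Hf HK HE.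
Qed.

End HighestWeight.

(** * Graded dimensions of the invariants *)

Section QuotientDimension.
Variables (F : fieldType) (q : F) (g n' : nat).
Hypothesis q_neq0 : q != 0.
Hypothesis q_free : forall k, (0 < k)%N -> q ^+ k != 1.
Local Notation n := n'.+1.
Local Notation relL := (fun s t => @Lrel F q g n (pcls _ s) (pcls _ t)).
Local Notation A := (alekseev q g n).
Local Notation op := (@Uop F q g n').
Local Notation fil := (@genfil F (Lgen n) relL).
Local Notation wtsp := (@wt_space F q g n').
Local Notation wmon := (@word_mon F q g n').
Implicit Types (x y z v : A).

Definition lowfil (j : nat) x : Prop := if j is j'.+1 then fil j' x else x = 0.

Lemma lowfilP j x : fil j x ->
  lowfil j x <-> {in nws g n j, forall w, coA w x = 0}.
Proof.
move=> Hx; split=> [Hl w Hw|H].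
  case: j Hx Hl Hw => [|j] Hx /= => [-> _|Hl Hw]; first by rewrite coA0.
  apply/eqP; apply: contraTT Hw => Hne; have := coA_supp q_neq0 q_free Hl Hne.
  by rewrite mem_nwsle mem_nws => /and3P [-> -> Hs] /=; rewrite neq_ltn ltnS Hs.
have := fil_expand q_neq0 q_free Hx.
rewrite -[nwsle _ _ _]/(nwsle g n j).
case: j Hx H => [|j] Hx H -> /=.
  by rewrite big_seq big1 // => w /H ->; rewrite scale0r.
rewrite big_cat /= [X in _ + X]big_seq [X in _ + X]big1 ?addr0; last first.
  by move=> w /H ->; rewrite scale0r.
rewrite -/(nwsle g n j) big_seq; apply: fil_sum => w; rewrite mem_nwsle => /and3P [_ Hv Hs].
by apply: filZ; exact: fil_wmon.
Qed.

Variable j : nat.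

(** For [x] of weight a in the j-th piece, this row determines the class of [x] modulo the preceding
    piece, see [top_eq0]. *)
Definition top (a : int) x : 'rV[F]_(size (nwsw g n j a)) :=
  \row_i coA (nth [::] (nwsw g n j a) i) x.

Lemma top_lin a c x y : top a (c *: x + y) = c *: top a x + top a y.
Proof. by apply/rowP => i; rewrite !mxE coAD // coAZ. Qed.

Lemma top0 a : top a 0 = 0.
Proof. by apply/rowP => i; rewrite !mxE coA0. Qed.

Lemma top_sum a m (c : 'rV[F]_m) (v : 'I_m -> A) :
  top a (\sum_i c 0 i *: v i) = \sum_i c 0 i *: top a (v i).
Proof.
elim/big_rec2: _ => [|i y1 y2 _ <-]; first by rewrite top0.
by rewrite top_lin.
Qed.

Lemma mem_nwsw a w : (w \in nwsw g n j a) = (wt w == a) && (w \in nws g n j).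
Proof. by rewrite mem_filter. Qed.

Lemma top_eq0 a x : fil j x -> wtsp a x -> lowfil j x <-> top a x = 0.
Proof.
move=> Hf Hw; rewrite lowfilP //; split=> [H|/rowP H w Hn].
  apply/rowP => i; rewrite !mxE; apply: H.
  by have := mem_nth [::] (ltn_ord i); rewrite mem_nwsw => /andP [].
apply/eqP; apply: contraT => Hne; have Ewt := wtsp_coA q_neq0 q_free Hw Hne.
have Hin : w \in nwsw g n j a by rewrite mem_nwsw Ewt eqxx.
have Hi : (index w (nwsw g n j a) < size (nwsw g n j a))%N by rewrite index_mem.
have := H (Ordinal Hi); rewrite !mxE /= nth_index // => E.
by rewrite E eqxx in Hne.
Qed.

Definition lift (a : int) (c : 'rV[F]_(size (nwsw g n j a))) : A :=
  \sum_i c 0 i *: wmon (nth [::] (nwsw g n j a) i).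

Lemma nwsw_nth a (i : 'I_(size (nwsw g n j a))) :
  let w := nth [::] (nwsw g n j a) i in
  [/\ wt w = a, reduced g w, all (valid n) w & size w = j].
Proof.
move=> w; have := mem_nth [::] (ltn_ord i); rewrite mem_nwsw mem_nws.
by case/and4P => /eqP ? ? ? /eqP ?; split.
Qed.

Lemma lift_fil a c : fil j (@lift a c).
Proof.
apply: fil_sum => i _; apply: filZ; have [_ _ Hv Hs] := nwsw_nth i.
by apply: fil_wmon => //; rewrite Hs.
Qed.

Lemma lift_wtsp a c : wtsp a (@lift a c).
Proof.
apply: (big_ind (wtsp a)) => [|x y Hx Hy|i _]; first exact: wtsp0.
  by rewrite -[x]scale1r; exact: wtsp_lin.
rewrite -[_ *: _]addr0; apply: wtsp_lin => //; last exact: wtsp0.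
by have [Hw _ Hv Hs] := nwsw_nth i; rewrite /wt_space opK_wmon // Hw.
Qed.

Lemma top_lift a c : top a (@lift a c) = c.
Proof.
rewrite top_sum; apply/rowP => k; rewrite summxE (bigD1 k) //= big1 ?addr0.
  have [_ Hr Hv _] := nwsw_nth k.
  by rewrite !mxE coA_wmon // co_reduced // eqxx mulr1.
move=> i Hik; have [_ Hr Hv _] := nwsw_nth i.
have Hn : (i == k :> nat) = false by exact: negbTE.
rewrite !mxE coA_wmon // co_reduced // nth_uniq ?Hn ?mulr0 //.
by rewrite filter_uniq // uniq_nws.
Qed.

(** The matrix of E from weight 0 to weight 1 on the associated graded space in degree j. *)
Definition Emx : 'M[F]_(size (nwsw g n j 0), size (nwsw g n j 1)) :=
  \matrix_(i, k) coA (nth [::] (nwsw g n j 1) k) (op gE (wmon (nth [::] (nwsw g n j 0) i))).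

Lemma top_E x : fil j x -> wtsp 0 x -> top 1 (op gE x) = top 0 x *m Emx.
Proof.
move=> Hf Hw.
have Hl : wtsp 0 (x - lift (top 0 x)).
  by rewrite addrC -scaleN1r; apply: wtsp_lin => //; exact: lift_wtsp.
have Fl : fil j (x - lift (top 0 x)) by apply: filB => //; exact: lift_fil.
have : top 0 (x - lift (top 0 x)) = 0.
  by rewrite addrC -scaleN1r top_lin top_lift scaleN1r addNr.
move/(top_eq0 Fl Hl) => Hlow.
have Elow : top 1 (op gE (x - lift (top 0 x))) = 0.
  apply/(top_eq0 (a := 1)); [exact: op_fil|by rewrite -[1]add0r; exact: wtsp_E|].
  case: (j) Hlow => [|j'] /=; last exact: op_fil.
  by move=> ->; rewrite op0.
rewrite -[x in LHS](subrK (lift (top 0 x))) opD // -[op gE (x - _)]scale1r top_lin.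
rewrite Elow scaler0 add0r /lift.
have -> : op gE (\sum_i (top 0 x) 0 i *: wmon (nth [::] (nwsw g n j 0) i)) =
    \sum_i (top 0 x) 0 i *: op gE (wmon (nth [::] (nwsw g n j 0) i)).
  elim/big_rec2: _ => [|i y1 y2 _ <-]; first by rewrite op0.
  by rewrite opD // opZ.
rewrite top_sum; apply/rowP => k; rewrite summxE !mxE.
by apply: eq_bigr => i _; rewrite !mxE.
Qed.

Lemma Emx_full : row_full Emx.
Proof.
rewrite -sub1mx; apply/row_subP => k; apply/submxP.
have H01 : (0 : int) < 1 by [].
have [u [Fu Wu Eu]] := E_surj q_neq0 q_free H01 (lift_fil (row k 1%:M))
  (lift_wtsp (row k 1%:M)).
rewrite subrr in Wu; exists (top 0 u).
by rewrite -top_E // Eu top_lift.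
Qed.

(** Passing to the associated graded space commutes with taking the kernel of E, because E is onto
    in every piece: a lift of a graded kernel element can be corrected in lower degree. *)
Lemma quot_dim_Linv :
  quot_dim (@Linv_fil F q g n j) (filpred (@Linv_fil F q g n) j)
    (size (nwsw g n j 0) - size (nwsw g n j 1))%N.
Proof.
have -> : (size (nwsw g n j 0) - size (nwsw g n j 1))%N = \rank (kermx Emx).
  by rewrite mxrank_ker; have /eqP -> := Emx_full.
set B := row_base (kermx Emx).
have HP := Linv_filP q_neq0 q_free (g := g) (n' := n').
have low x : Linv_fil j x -> filpred (@Linv_fil F q g n) j x <-> top 0 x = 0.
  move=> Hx; have /HP [Hf Hw HE] := Hx; rewrite -top_eq0 //.
  case: (j) Hx => [|j'] Hx; first by split.
  split=> [/HP []|Hl] //.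
  by apply/HP.
have lin c x y : Linv_fil j x -> Linv_fil j y -> Linv_fil j (c *: x + y).
  move=> /HP [H1 H2 H3] /HP [H4 H5 H6]; apply/HP; split.
  - exact: fil_lin.
  - exact: wtsp_lin.
  by rewrite opD // opZ // H3 H6 scaler0 addr0.
have Hv (i : 'I_(\rank (kermx Emx))) : exists v, Linv_fil j v /\ top 0 v = row i B.
  set y := lift (row i B).
  have Fy : fil j y by exact: lift_fil.
  have Wy : wtsp 0 y by exact: lift_wtsp.
  have WEy : wtsp 1 (op gE y) by rewrite -[1]add0r; exact: wtsp_E.
  have Hlow : lowfil j (op gE y).
    apply/(top_eq0 _ WEy); first exact: op_fil.
    rewrite top_E // top_lift; apply/sub_kermxP.
    by apply: submx_trans (row_sub i B) _; rewrite eq_row_base.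
  (* E y lies one piece lower, and [E_surj] applied in that piece gives the correction: y - u is
     invariant with the same top row as y. *)
  have [u [Hu Wu Eu]] : exists u, [/\ lowfil j u, wtsp 0 u & op gE u = op gE y].
    case: (j) Hlow => [|j'] /= Hlow.
      by exists 0; rewrite op0 // Hlow; split=> //; exact: wtsp0.
    have H01 : (0 : int) < 1 by [].
    have [u] := E_surj q_neq0 q_free H01 Hlow WEy.
    by rewrite subrr => -[? ? ?]; exists u.
  have Fu : fil j u.
    case: (j) Hu => [|j'] /=; first by move=> ->; exact: fil0.
    exact: fil_mono.
  exists (y - u); split.
    apply/HP; split; [exact: filB| |by rewrite opB // Eu subrr].
    by rewrite addrC -scaleN1r; exact: wtsp_lin.
  have /(top_eq0 Fu Wu) Tu := Hu.
  by rewrite addrC -scaleN1r top_lin top_lift Tu scaler0 add0r.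
have [v Hv'] := fin_all_exists Hv.
have sumL (c : 'rV[F]_(\rank (kermx Emx))) : Linv_fil j (\sum_i c 0 i *: v i).
  apply: (big_ind (Linv_fil j)).
  - by apply/HP; split; [exact: fil0|exact: wtsp0|rewrite op0].
  - by move=> x y Hx Hy; rewrite -[x]scale1r; exact: lin.
  move=> i _; rewrite -[_ *: _]addr0; apply: lin; first by case: (Hv' i).
  by apply/HP; split; [exact: fil0|exact: wtsp0|rewrite op0].
have topc (c : 'rV[F]_(\rank (kermx Emx))) : top 0 (\sum_i c 0 i *: v i) = c *m B.
  rewrite top_sum mulmx_sum_row; apply: eq_bigr => i _.
  by have [_ ->] := Hv' i.
have Hiff x (c : 'rV[F]_(\rank (kermx Emx))) : Linv_fil j x ->
    filpred (@Linv_fil F q g n) j (x - \sum_i c 0 i *: v i) <-> top 0 x = c *m B.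
  move=> Hx; rewrite low; last by rewrite addrC -scaleN1r; exact: lin.
  rewrite addrC -scaleN1r top_lin scaleN1r topc addrC.
  by split=> [/subr0_eq|->]; rewrite ?subrr.
exists v; split=> [i|x Hx]; first by case: (Hv' i).
have /HP [Hf Hw HE] := Hx.
have : (top 0 x <= B)%MS.
  by rewrite eq_row_base; apply/sub_kermxP; rewrite -top_E // HE top0.
case/submxP => c Ec; exists c; split; first exact/Hiff.
move=> c' /Hiff; rewrite Ec => /(_ Hx); apply: row_free_inj.
exact: row_base_free.
Qed.

End QuotientDimension.

(** * Counting reduced words *)

(** Both products of kd and ka are reducible because of the determinant, so on each handle a reduced
    word is a power of kb, then a power of kd or of ka, then a power of kc. *)
Definition nrel (x y : letter) : bool :=
  (x.1 < y.1)%N ||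
  [&& x.1 == y.1, (x.2 <= y.2)%N & ~~ ((x.2 == 1%N) && (y.2 == 2%N))].

Lemma nrel_rule lk x y : (x.2 < 4)%N -> (y.2 < 4)%N ->
  nrel x y = ~~ rule lk x y.
Proof.
case: x y => [h c] [h' c']; rewrite /nrel /rule /= => Hc Hc'.
case: ltngtP => // _.
by case: c Hc => [|[|[|[|?]]]] //; case: c' Hc' => [|[|[|[|?]]]].
Qed.

(** The codes of the excluded pair are adjacent, so excluding it keeps transitivity; sortedness is
    then a condition on all pairs, fit for prepending letters. *)
Lemma nrel_trans : transitive nrel.
Proof.
move=> [h c] [h1 c1] [h2 c2]; rewrite /nrel /=.
case/orP=> [H1|/and3P [/eqP -> H1 H2]] /orP [H3|/and3P [/eqP <- H3 H4]]; lia.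
Qed.

Lemma reduced_sorted g n w : all (valid n) w -> reduced g w = sorted nrel w.
Proof.
elim: w => [|x [|y v] IH] // /andP [Hx Hv].
have E : reduced g [:: x, y & v] = ~~ rule (lkg g) x y && reduced g (y :: v).
  rewrite /reduced /red1 -/(red1 _ _); case: (rule _ x y) => [r|] //=.
  by case: (if v is _ :: _ then _ else _).
have /andP [/andP [_ Hy4] _] := Hv; have /andP [_ Hx4] := Hx.
by rewrite E IH // -nrel_rule.
Qed.

(** On the generating function of the sizes this is multiplication by 1 / (1 - t). *)
Fixpoint conses (x : letter) (f : nat -> seq word) (j : nat) : seq word :=
  (if j is j'.+1 then map (cons x) (conses x f j') else [::]) ++ f j.

Lemma size_conses x f j :
  size (conses x f j) = \sum_(i < j.+1) size (f i).
Proof.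
elim: j => [|j IH] /=; first by rewrite big_ord1.
by rewrite size_cat size_map IH [RHS]big_ord_recr.
Qed.

(* Q holds for the words enumerated by f, and Q' for those obtained by adding
   any number of x in front. *)
Lemma mem_conses x (f : nat -> seq word) (Q Q' : pred word) (c : pred letter) :
  c x -> (forall j w, (w \in f j) = Q w && (count c w == j)) ->
  (forall v, Q (x :: v) = false) -> (forall v, Q' (x :: v) = Q' v) ->
  (forall w, ohead w != Some x -> Q' w = Q w) ->
  forall j w, (w \in conses x f j) = Q' w && (count c w == j).
Proof.
move=> cx Hf Qx Q'x Q'Q; elim=> [|j IH] w /=.
  rewrite Hf; have [|Hw] := eqVneq (ohead w) (Some x); last by rewrite Q'Q.
  by case: w => [|y v] //= [->]; rewrite Qx cx add1n /= andbF.
rewrite mem_cat Hf; have [|Hw] := eqVneq (ohead w) (Some x).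
  case: w => [|y v] //= [->]; rewrite Qx cx add1n orbF Q'x eqSS -IH.
  by rewrite mem_map // => ? ? [].
rewrite Q'Q //; case: mapP => // -[v _ Ew].
by rewrite Ew eqxx in Hw.
Qed.

Lemma uniq_conses x (f : nat -> seq word) :
  (forall j, uniq (f j)) -> (forall j v, x :: v \notin f j) ->
  forall j, uniq (conses x f j).
Proof.
move=> Hu Hx; elim=> [|j IH] /=; first exact: Hu.
rewrite cat_uniq Hu andbT map_inj_uniq ?IH => [/=|? ? [] //].
by apply/hasPn => w Hw; apply/mapP => -[v _ E]; move: (Hx j.+1 v); rewrite -E Hw.
Qed.

Definition cntb : word -> nat := count (fun l => l.2 == 0%N).
Definition cntm : word -> nat := count (fun l => (l.2 == 1%N) || (l.2 == 2%N)).
Definition cntc : word -> nat := count (fun l => l.2 == 3%N).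

(** The stages of the enumeration of a handle, read from right to left: [gtH] before handle h is
    entered, then [geC] once kc is allowed, [geD] or [geA] with one middle letter, [geM] with
    either, and [geB] with kb. *)
Definition geC (h : nat) (l : letter) := nrel (kc h) l.
Definition geD (h : nat) (l : letter) := nrel (kd h) l.
Definition geA (h : nat) (l : letter) := nrel (ka h) l.
Definition geM (h : nat) (l : letter) := (h < l.1)%N || (l.1 == h) && (0 < l.2)%N.
Definition geB (h : nat) (l : letter) := (h <= l.1)%N.
Definition gtH (h : nat) (l : letter) := (h < l.1)%N.

Ltac letter_lia := rewrite /geC /geD /geA /geM /geB /gtH /nrel /valid /kb /kd /ka /kc
  /= ?xpair_eqE /=; lia.

Section LetterOrder.
Variables n h : nat.
Implicit Types y l : letter.

Lemma geC_kc l : valid n l -> gtH h l = geC h l && (l != kc h).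
Proof. by case: l => h1 c1; letter_lia. Qed.
Lemma geC_tail y l : y != kc h -> geC h y -> geC h l -> nrel y l -> l != kc h.
Proof. by case: y l => [h1 c1] [h2 c2]; letter_lia. Qed.
Lemma geD_kd l : valid n l -> geC h l = geD h l && (l != kd h).
Proof. by case: l => h1 c1; letter_lia. Qed.
Lemma geD_tail y l : y != kd h -> geD h y -> geD h l -> nrel y l -> l != kd h.
Proof. by case: y l => [h1 c1] [h2 c2]; letter_lia. Qed.
Lemma geA_ka l : valid n l -> geC h l = geA h l && (l != ka h).
Proof. by case: l => h1 c1; letter_lia. Qed.
Lemma geA_tail y l : y != ka h -> geA h y -> geA h l -> nrel y l -> l != ka h.
Proof. by case: y l => [h1 c1] [h2 c2]; letter_lia. Qed.
Lemma geB_kb l : valid n l -> geM h l = geB h l && (l != kb h).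
Proof. by case: l => h1 c1; letter_lia. Qed.
Lemma geB_tail y l : y != kb h -> geB h y -> geB h l -> nrel y l -> l != kb h.
Proof. by case: y l => [h1 c1] [h2 c2]; letter_lia. Qed.
Lemma geB_nrel l : geB h l -> nrel (kb h) l.
Proof. by case: l => h1 c1; letter_lia. Qed.
Lemma geM_kd l : geD h l = geM h l && nrel (kd h) l.
Proof. by case: l => h1 c1; letter_lia. Qed.
Lemma geM_ka l : geA h l = geM h l && nrel (ka h) l.
Proof. by case: l => h1 c1; letter_lia. Qed.
Lemma geM_other y : valid n y -> y != kd h -> y != ka h -> geM h y = geC h y.
Proof. by case: y => h1 c1; letter_lia. Qed.
Lemma geM_tail y l : geC h y -> geM h l && nrel y l = geC h l && nrel y l.
Proof. by case: y l => [h1 c1] [h2 c2]; letter_lia. Qed.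

End LetterOrder.

Section WordLists.
Variables (n h : nat) (next : nat -> nat -> nat -> seq word).

Definition wC (i l k : nat) : seq word := conses (kc h) (next i l) k.
Definition wD (i l k : nat) : seq word := conses (kd h) (fun l => wC i l k) l.
Definition wA (i l k : nat) : seq word := conses (ka h) (fun l => wC i l k) l.
(** Nonempty powers of kd, nonempty powers of ka, and neither: keeping the empty power apart avoids
    counting it twice, and gives the factor 1 + 2t / (1 - t) = (1 + t) / (1 - t). *)
Definition wM (i l k : nat) : seq word :=
  (if l is l'.+1 then map (cons (kd h)) (wD i l' k) ++ map (cons (ka h)) (wA i l' k)
   else [::]) ++ wC i l k.
Definition wB (i l k : nat) : seq word := conses (kb h) (fun i => wM i l k) i.

Definition okw (P : pred letter) (w : word) : bool :=
  sorted nrel w && all (fun l => valid n l && P l) w.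

Lemma okw_cons (P : pred letter) x v :
  okw P (x :: v) = [&& valid n x, P x & okw (fun l => P l && nrel x l) v].
Proof.
rewrite /okw /= path_sortedE; last exact: nrel_trans.
have -> : all (fun l => valid n l && (P l && nrel x l)) v =
    all (fun l => valid n l && P l) v && all (nrel x) v.
  by rewrite -all_predI; apply: eq_all => l /=; rewrite andbA.
by case: (valid n x); case: (P x); case: (all (nrel x) v); case: (sorted nrel v);
  rewrite /= ?andbT ?andbF.
Qed.

Lemma eq_okw (P P' : pred letter) w :
  (forall l, valid n l -> P l = P' l) -> okw P w = okw P' w.
Proof.
move=> H; rewrite /okw; congr (_ && _); apply: eq_all => l.
by case E: (valid n l); rewrite //= H.
Qed.

(* f i l k lists the sorted words over P with i letters k^+_-, l letters k^-_-
   or k^+_+, and k letters k^-_+. *)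
Definition enum3 (f : nat -> nat -> nat -> seq word) (P : pred letter) : Prop :=
  (forall i l k w, (w \in f i l k) =
     [&& okw P w, cntb w == i, cntm w == l & cntc w == k]) /\
  (forall i l k, uniq (f i l k)).

Lemma okw_x (P : pred letter) x v : P x = false -> okw P (x :: v) = false.
Proof. by move=> H; rewrite okw_cons H andbF. Qed.

Lemma okw_keep (P : pred letter) x v : valid n x -> P x ->
  (forall l, P l -> nrel x l) -> okw P (x :: v) = okw P v.
Proof.
move=> Hv Hx H; rewrite okw_cons Hv Hx /=; apply: eq_okw => l Hl.
by case E: (P l); rewrite //= H.
Qed.

(** A sorted word that does not begin with its least possible letter x does not contain x at all. *)
Lemma okw_head (P P' : pred letter) x w :
  (forall l, valid n l -> P l = P' l && (l != x)) ->
  (forall y l, y != x -> P' y -> P' l -> nrel y l -> l != x) ->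
  ohead w != Some x -> okw P' w = okw P w.
Proof.
move=> HP Hne; case: w => [|y v] //= Hyx; rewrite !okw_cons.
have {}Hyx : y != x by apply: contraNneq Hyx => ->.
case Hv: (valid n y) => //=; rewrite HP // Hyx andbT.
case Hy: (P' y) => //=; apply: eq_okw => l Hl; rewrite HP //.
case Hl' : (P' l) => //=; case Hyl: (nrel y l); rewrite ?andbF //.
by rewrite (Hne _ _ Hyx Hy Hl' Hyl).
Qed.

Hypothesis hn : (h < n)%N.
Hypothesis nextP : enum3 next (gtH h).

Let vh c : (c < 4)%N -> valid n (h, c).
Proof. by rewrite /valid hn. Qed.

Lemma wCP : enum3 wC (geC h).
Proof.
have [Hm Hu] := nextP.
have Hx v : okw (gtH h) (kc h :: v) = false by rewrite okw_x // /gtH ltnn.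
split=> [i l k w|i l k]; last by apply: uniq_conses => // j v; rewrite Hm Hx.
rewrite (@mem_conses _ _ (fun w => [&& okw (gtH h) w, cntb w == i & cntm w == l])
  (fun w => [&& okw (geC h) w, cntb w == i & cntm w == l]) (fun l => l.2 == 3%N)) //.
- by rewrite -!andbA.
- by move=> j v; rewrite Hm -!andbA.
- by move=> v; rewrite Hx.
- move=> v; rewrite okw_keep ?vh //.
  by rewrite /geC /nrel /= eqxx orbT.
move=> v Hv; rewrite (okw_head _ _ Hv (P := gtH h)) //; first exact: geC_kc.
exact: geC_tail.
Qed.

Lemma wDP : enum3 wD (geD h).
Proof.
have [Hm Hu] := wCP.
have Hx v : okw (geC h) (kd h :: v) = false.
  by rewrite okw_x // /geC /nrel /= ltnn eqxx.
split=> [i l k w|i l k]; last by apply: uniq_conses => // j v; rewrite Hm Hx.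
rewrite (@mem_conses _ _ (fun w => [&& okw (geC h) w, cntb w == i & cntc w == k])
  (fun w => [&& okw (geD h) w, cntb w == i & cntc w == k])
  (fun l => (l.2 == 1%N) || (l.2 == 2%N))) //.
- by rewrite -!andbA [(cntc w == k) && _]andbC.
- by move=> j v; rewrite Hm -!andbA [(cntc v == k) && _]andbC.
- by move=> v; rewrite Hx.
- move=> v; rewrite okw_keep ?vh //.
  by rewrite /geD /nrel /= eqxx orbT.
move=> v Hv; rewrite (okw_head _ _ Hv (P := geC h)) //; first exact: geD_kd.
exact: geD_tail.
Qed.

Lemma wAP : enum3 wA (geA h).
Proof.
have [Hm Hu] := wCP.
have Hx v : okw (geC h) (ka h :: v) = false.
  by rewrite okw_x // /geC /nrel /= ltnn eqxx.
split=> [i l k w|i l k]; last by apply: uniq_conses => // j v; rewrite Hm Hx.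
rewrite (@mem_conses _ _ (fun w => [&& okw (geC h) w, cntb w == i & cntc w == k])
  (fun w => [&& okw (geA h) w, cntb w == i & cntc w == k])
  (fun l => (l.2 == 1%N) || (l.2 == 2%N))) //.
- by rewrite -!andbA [(cntc w == k) && _]andbC.
- by move=> j v; rewrite Hm -!andbA [(cntc v == k) && _]andbC.
- by move=> v; rewrite Hx.
- move=> v; rewrite okw_keep ?vh //.
  by rewrite /geA /nrel /= eqxx orbT.
move=> v Hv; rewrite (okw_head _ _ Hv (P := geC h)) //; first exact: geA_ka.
exact: geA_tail.
Qed.

Lemma wMP : enum3 wM (geM h).
Proof.
have [HC uC] := wCP; have [HD uD] := wDP; have [HA uA] := wAP.
have geMx c : (0 < c)%N -> geM h (h, c) by rewrite /geM /= ltnn eqxx.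
have Ed v : okw (geM h) (kd h :: v) = okw (geD h) v.
  rewrite okw_cons vh // geMx //=; apply: eq_okw => l _; exact/esym/geM_kd.
have Ea v : okw (geM h) (ka h :: v) = okw (geA h) v.
  rewrite okw_cons vh // geMx //=; apply: eq_okw => l _; exact/esym/geM_ka.
have Ho y v : y != kd h -> y != ka h -> okw (geM h) (y :: v) = okw (geC h) (y :: v).
  move=> Hd Ha; rewrite !okw_cons; case Hv: (valid n y) => //=.
  rewrite (geM_other Hv Hd Ha); case Hy: (geC h y) => //=.
  by apply: eq_okw => l _; exact: geM_tail.
have Cd v : okw (geC h) (kd h :: v) = false.
  by rewrite okw_x // /geC /nrel /= ltnn eqxx.
have Ca v : okw (geC h) (ka h :: v) = false.
  by rewrite okw_x // /geC /nrel /= ltnn eqxx.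
have mapE x y v (s : seq word) : (y :: v \in map (cons x) s) = (y == x) && (v \in s).
  apply/mapP/andP => [[v' Hv' [-> ->]]|[/eqP -> Hv]]; first by rewrite eqxx.
  by exists v.
have nilE x (s : seq word) : ([::] \in map (cons x) s) = false.
  by apply/mapP => -[].
have da : (kd h == ka h) = false by rewrite xpair_eqE andbF.
have ad : (ka h == kd h) = false by rewrite xpair_eqE andbF.
split=> [i l k w|i l k]; last first.
  rewrite /wM cat_uniq uC andbT; case: l => [|l]; first by apply/andP; split=> //; apply/hasPn.
  rewrite cat_uniq !map_inj_uniq ?uD ?uA /=; try by move=> ? ? [].
  rewrite andbT; apply/andP; split.
    by apply/hasPn => -[|y v]; rewrite ?nilE // !mapE => /andP [/eqP -> _]; rewrite ad.
  apply/hasPn => -[|y v] Hw; rewrite mem_cat ?nilE // !mapE.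
  move: Hw; rewrite HC; have [->|_] := eqVneq y (kd h); first by rewrite Cd.
  by have [->|_] := eqVneq y (ka h); first by rewrite Ca.
rewrite /wM mem_cat HC; case: w => [|y v].
  by case: l => [|l]; rewrite ?mem_cat ?nilE.
have [->|Hd] := eqVneq y (kd h).
  rewrite Cd orbF Ed; case: l => [|l]; first by rewrite /= !andbF.
  by rewrite mem_cat !mapE eqxx da orbF HD.
have [->|Ha] := eqVneq y (ka h).
  rewrite Ca orbF Ea; case: l => [|l]; first by rewrite /= !andbF.
  by rewrite mem_cat !mapE eqxx ad HA.
rewrite Ho //; case: l => [|l] //.
by rewrite mem_cat !mapE (negbTE Hd) (negbTE Ha).
Qed.

Lemma wBP : enum3 wB (geB h).
Proof.
have [Hm Hu] := wMP.
have Hx v : okw (geM h) (kb h :: v) = false.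
  by rewrite okw_x // /geM /= ltnn andbF.
split=> [i l k w|i l k]; last by apply: uniq_conses => // j v; rewrite Hm Hx.
rewrite (@mem_conses _ _ (fun w => [&& okw (geM h) w, cntm w == l & cntc w == k])
  (fun w => [&& okw (geB h) w, cntm w == l & cntc w == k]) (fun l => l.2 == 0%N)) //.
- by rewrite -!andbA [(cntb w == i) && _]andbC -!andbA.
- by move=> j v; rewrite Hm -!andbA [(cntb v == j) && _]andbC -!andbA.
- by move=> v; rewrite Hx.
- move=> v; rewrite okw_keep ?vh //; first by rewrite /geB.
  exact: geB_nrel.
move=> v Hv; rewrite (okw_head _ _ Hv (P := geM h)) //; first exact: geB_kb.
exact: geB_tail.
Qed.

End WordLists.

(* The reduced words over the last m of the n handles. *)
Fixpoint wlist (n m : nat) : nat -> nat -> nat -> seq word :=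
  if m is m'.+1 then wB (n - m) (wlist n m')
  else fun i l k => if (i + l + k == 0)%N then [:: [::]] else [::].

Lemma wlistP n m : (m <= n)%N -> enum3 n (wlist n m) (fun l => n - m <= l.1)%N.
Proof.
elim: m => [|m IH] Hm.
  split=> [i l k [|x v]|i l k] /=; last by case: ifP.
    by case: i l k => [|i] [|l] [|k].
  rewrite subn0; have -> : okw n (fun l => n <= l.1)%N (x :: v) = false.
    by apply/negP; rewrite okw_cons => /and3P [/andP [H _]]; rewrite leqNgt H.
  by case: ifP.
have Hh : (n - m.+1 < n)%N by lia.
apply: (wBP Hh); have [H1 H2] := IH (ltnW Hm); split=> // i l k w.
rewrite H1; congr (_ && _); apply: eq_okw => x _; rewrite /gtH.
by have -> : (n - m = (n - m.+1).+1)%N by lia.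
Qed.

(** The coefficient of t^i in (1 - t)^-m. *)
Definition cB (m i : nat) : nat := if m is m'.+1 then 'C(m' + i, i) else (i == 0)%N.

(** The coefficient of t^l in ((1 + t) / (1 - t))^m. *)
Fixpoint cM (m l : nat) : nat :=
  if m is m'.+1 then (cM m' l + 2 * \sum_(l' < l) cM m' l')%N else (l == 0)%N.

Lemma sum_cB m i : (\sum_(i' < i.+1) cB m i' = cB m.+1 i)%N.
Proof.
elim: i => [|i IH]; first by rewrite big_ord1; case: m => [|m] /=; rewrite ?bin0.
rewrite big_ord_recr /= IH; case: m {IH} => [|m] /=; first by rewrite addn0 !binn.
by rewrite addSnnS [in RHS]addSn binS addnC.
Qed.

Lemma size_wlist n m i l k : size (wlist n m i l k) = (cB m i * cM m l * cB m k)%N.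
Proof.
elim: m i l k => [|m IH] i l k.
  by rewrite /=; case: i l k => [|i] [|l] [|k].
rewrite [wlist _ _]/= /wB size_conses.
have EC i' l' : size (wC (n - m.+1) (wlist n m) i' l' k) = (cB m i' * cM m l' * cB m.+1 k)%N.
  rewrite /wC size_conses -sum_cB big_distrr /=.
  by apply: eq_bigr => k' _; rewrite IH.
have EM i' : size (wM (n - m.+1) (wlist n m) i' l k) = (cB m i' * cM m.+1 l * cB m.+1 k)%N.
  rewrite /wM size_cat EC; case: l => [|l].
    by rewrite /= big_ord0 muln0 addn0.
  have ES x : size (conses x (fun l' => wC (n - m.+1) (wlist n m) i' l' k) l) =
      (cB m i' * (\sum_(l' < l.+1) cM m l') * cB m.+1 k)%N.
    rewrite size_conses big_distrr big_distrl; apply: eq_bigr => l' _; exact: EC.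
  rewrite size_cat !size_map /wD /wA !ES [cM m.+1 _]/= -/(cM m).
  by move: (\sum_(l' < _) _)%N (cB m.+1 k) => s t; ring.
rewrite -sum_cB -mulnA big_distrl; apply: eq_bigr => i' _.
by rewrite EM -mulnA.
Qed.

Lemma size_count (T : Type) (f : T -> nat) (s : seq T) N :
  all (fun x => f x < N)%N s -> size s = (\sum_(k < N) count (fun x => f x == k) s)%N.
Proof.
elim: s => [|x s IH] /=; first by rewrite big1.
case/andP => Hx /IH ->; rewrite big_split /= -add1n; congr (_ + _)%N.
rewrite (bigD1 (Ordinal Hx)) //= eqxx big1 // => i Hi.
by rewrite -val_eqE /= in Hi; rewrite eq_sym (negbTE Hi).
Qed.

Lemma size_cnt n w : all (valid n) w -> size w = (cntb w + cntm w + cntc w)%N.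
Proof.
elim: w => [|x w IH] //= /andP [/andP [_ Hx] /IH ->]; rewrite /cntb /cntm /cntc /=.
by case: (x.2) Hx => [|[|[|[|c]]]] //= _; lia.
Qed.

Lemma wt_cnt w : wt w = (cntb w)%:Z - (cntc w)%:Z.
Proof.
elim: w => [|x w IH]; first by rewrite wt_nil.
rewrite wt_cons IH /cntb /cntc /= /wtl !PoszD; lia.
Qed.

(** The index k is the number of letters kc: the weight then forces k + a letters kb, and the degree
    leaves j - (2k + a) middle letters. *)
Lemma size_nwsw g n j (a : nat) : size (nwsw g n j a%:Z) =
  (\sum_(k < j.+1 | 2 * k + a <= j) cB n (k + a) * cM n (j - (2 * k + a)) * cB n k)%N.
Proof.
have Hw w : w \in nwsw g n j a -> [/\ sorted nrel w, all (valid n) w,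
    (cntb w = cntc w + a)%N & (cntb w + cntm w + cntc w = j)%N].
  rewrite mem_filter mem_nws => /andP [/eqP Ew /and3P [Hr Hv /eqP Hs]].
  rewrite -(reduced_sorted g Hv) Hr Hv -(size_cnt Hv) Hs; split=> //.
  by move: Ew; rewrite wt_cnt; lia.
rewrite (@size_count _ cntc _ j.+1); last first.
  by apply/allP => w /Hw [_ _ H1 H2]; lia.
rewrite [RHS]big_mkcond; apply: eq_bigr => k _.
have [H1 H2] := wlistP (leqnn n).
rewrite -size_filter; case: ifP => Hk.
  rewrite -(size_wlist n); apply/perm_size/uniq_perm => //.
    by rewrite filter_uniq // filter_uniq // uniq_nws.
  move=> w; rewrite mem_filter H1; apply/andP/and4P.
    case=> /eqP Ek /Hw [Hs Hv E1 E2]; split; try by apply/eqP; lia.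
    rewrite /okw Hs; apply: sub_all Hv => x /=; rewrite subnn leq0n andbT.
    exact.
  case=> /andP [Hs Hv] /eqP Eb /eqP Em /eqP Ec.
  have {}Hv : all (valid n) w by apply: sub_all Hv => x /andP [].
  rewrite Ec eqxx mem_filter mem_nws (reduced_sorted g Hv) Hs Hv (size_cnt Hv) wt_cnt.
  by rewrite Eb Em Ec; split=> //; apply/andP; split; [apply/eqP; lia|lia].
apply/eqP; rewrite size_eq0 -(negbK (_ == _)) -has_filter; apply/hasPn => w /Hw [_ _ E1 E2].
by apply/eqP => E; move: Hk; rewrite -E; lia.
Qed.

(** * The generating function *)

Section Series.
Variable N : nat.
Local Notation Z := {poly int}.
Implicit Types (p r s : Z) (c : nat -> int).

(** Identities of power series are read modulo X^N. With an explicit error term they can be combined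
    by [ring], the witnesses below being the accumulated errors. *)
Definition peq p r : Prop := exists e, p = r + 'X^N * e.

Lemma peqP p r : peq p r <-> forall i, (i < N)%N -> p`_i = r`_i.
Proof.
split=> [[e ->] i Hi|H]; first by rewrite coefD coefXnM Hi addr0.
exists (drop_poly N (p - r)).
have := poly_take_drop N (p - r); have -> : take_poly N (p - r) = 0.
  apply/polyP => i; rewrite coef_take_poly coef0; case: ifP => // /H.
  by rewrite coefB => ->; rewrite subrr.
by rewrite add0r mulrC => ->; rewrite addrC subrK.
Qed.

Lemma peq_refl p : peq p p. Proof. by exists 0; rewrite mulr0 addr0. Qed.
Lemma peqM s p r : peq p r -> peq (s * p) (s * r).
Proof. by case=> e ->; exists (s * e); ring. Qed.
Lemma peqD p r p' r' : peq p r -> peq p' r' -> peq (p + p') (r + r').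
Proof. by case=> e -> [e' ->]; exists (e + e'); ring. Qed.
Lemma peqN p r : peq p r -> peq (- p) (- r).
Proof. by case=> e ->; exists (- e); ring. Qed.

Lemma peq_nat k p r : peq (k.+1%:R * p) (k.+1%:R * r) -> peq p r.
Proof.
rewrite !peqP => H i /H; rewrite -!polyC_natr !coefCM.
by apply: mulfI; rewrite pnatr_eq0.
Qed.

(** The geometric sum inverts 1 - X modulo X^N. *)
Lemma peq_1X p r : peq ((1 - 'X) * p) ((1 - 'X) * r) -> peq p r.
Proof.
case=> e E; exists (e * (\sum_(i < N) 'X^i) + (p - r)).
have G : (1 - 'X) * (\sum_(i < N) 'X^i) = 1 - 'X^N :> Z.
  by have := subrX1 ('X : Z) N; rewrite -[X in X = _]opprB -[X in _ = X * _]opprB mulNr => /oppr_inj.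
have := congr1 (fun x => x * (\sum_(i < N) 'X^i)) E; rewrite mulrAC G => {}E.
have E' : p - 'X^N * p = r - 'X^N * r + 'X^N * (e * \sum_(i < N) 'X^i).
  transitivity ((1 - 'X^N) * p); first by ring.
  by rewrite E mulrDl mulrAC G; ring.
by rewrite -[LHS](subrK ('X^N * p)) E'; ring.
Qed.

Definition xsum (K a : nat) c : Z := \sum_(0 <= k < K) c k *: 'X^(2 * k + a).
Local Notation fE := (xsum N 0).
Local Notation fO := (xsum N 1).
Definition gs c : Z := \poly_(i < N) c i.
Definition sh c : nat -> int := fun k => if k is k'.+1 then c k' else 0.

Lemma coef_xsum K a c i : (xsum K a c)`_i = \sum_(0 <= k < K) c k * (i == 2 * k + a)%N%:R.
Proof. by rewrite coef_sum; apply: eq_bigr => k _; rewrite coefZ coefXn. Qed.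

Lemma xsum_ext K a c c' : c =1 c' -> xsum K a c = xsum K a c'.
Proof. by move=> H; apply: eq_bigr => k _; rewrite H. Qed.
Lemma xsumD K a c c' : xsum K a c + xsum K a c' = xsum K a (fun k => c k + c' k).
Proof. by rewrite -big_split; apply: eq_bigr => k _; rewrite scalerDl. Qed.
Lemma xsumZ K a (m : nat) c : m%:R * xsum K a c = xsum K a (fun k => m%:R * c k).
Proof.
rewrite mulr_sumr; apply: eq_bigr => k _.
by rewrite -polyC_natr mul_polyC scalerA.
Qed.
Lemma XfE c : 'X * fE c = fO c.
Proof.
rewrite mulr_sumr; apply: eq_bigr => k _.
by rewrite -scalerAr -exprS addn0 addn1.
Qed.
Lemma XfO c : peq ('X * fO c) (fE (sh c)).
Proof.
rewrite /peq /xsum; case: N => [|M]; first by exists 0; rewrite !big_geq // !mulr0 addr0.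
exists (c M *: 'X^(M.+1)).
rewrite [in RHS]big_nat_recl //= scale0r add0r big_nat_recr //= mulrDr mulr_sumr.
congr (_ + _).
  apply: eq_bigr => k _; rewrite -scalerAr -exprS; congr (_ *: 'X^_); lia.
by rewrite -!scalerAr -exprS -exprD; congr (_ *: 'X^_); lia.
Qed.
Lemma X2fE c : peq ('X^2 * fE c) (fE (sh c)).
Proof. by rewrite expr2 -mulrA XfE; exact: XfO. Qed.
Lemma X2fO c : peq ('X^2 * fO c) (fO (sh c)).
Proof. by rewrite expr2 -mulrA -[fO (sh c)]XfE; apply: peqM; exact: XfO. Qed.

Lemma xsum_widen K a c : (forall k, (K <= k)%N -> c k = 0) ->
  peq (xsum K a c) (xsum N a c).
Proof.
move=> H; apply/peqP => i Hi; rewrite !coef_xsum.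
transitivity (\sum_(0 <= k < K + N) c k * (i == 2 * k + a)%N%:R).
  rewrite [RHS](big_cat_nat (n := K)) ?leq_addr //= [X in _ = _ + X]big_nat_cond.
  by rewrite [X in _ = _ + X]big1 ?addr0 // => k /andP [/andP [/H -> _] _]; rewrite mul0r.
rewrite (big_cat_nat (n := N)) ?leq_addl //= [X in _ + X]big_nat_cond.
rewrite [X in _ + X]big1 ?addr0 // => k /andP [/andP [Hk _] _].
by rewrite (_ : (i == _)%N = false) ?mulr0 //; lia.
Qed.

Definition ca (v k : nat) : int := ('C(v + k, k) ^ 2)%N%:R.
Definition cb (v k : nat) : int := ('C(v + k, k) * 'C(v + k.+1, k.+1))%N%:R.
Definition ha (m k : nat) : int := ('C(m, k) ^ 2)%N%:R.
Definition hb (m k : nat) : int := ('C(m, k) * 'C(m, k.+1))%N%:R.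

(** Constant term in z after multiplication by (1 - Xz)(1 - X/z) = 1 + X^2 - X(z + 1/z); the
    coefficients of z and 1/z agree by symmetry, whence the 2. *)
Lemma fE_ca_rec v : peq (fE (ca v))
  ((1 + 'X^2) * fE (ca v.+1) - 2%:R * 'X * fO (cb v.+1)).
Proof.
have [e1 E1] := X2fE (ca v.+1); have [e2 E2] := XfO (cb v.+1).
exists (2%:R * e2 - e1).
have -> : (1 + 'X^2) * fE (ca v.+1) - 2%:R * 'X * fO (cb v.+1) =
  fE (ca v.+1) + 'X^2 * fE (ca v.+1) - 2%:R * ('X * fO (cb v.+1)) by ring.
rewrite E1 E2.
have -> : fE (ca v) = fE (ca v.+1) + fE (sh (ca v.+1)) - 2%:R * fE (sh (cb v.+1)).
  apply/eqP; rewrite eq_sym subr_eq xsumZ !xsumD; apply/eqP; apply: xsum_ext => k.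
  case: k => [|k] /=; first by rewrite /ca !bin0; lia.
  rewrite /ca /cb addSn [in LHS]binS addnS -addSn; set x := 'C(_, _); set y := 'C(_, _).
  by rewrite !natrX !natrM !natrD; ring.
by ring.
Qed.

Lemma cb_rec v k :
  v%:R * cb v k = v.+1%:R * (cb v.+1 k + sh (cb v.+1) k - 2%:R * ca v.+1 k) :> int.
Proof.
have E1 : (k.+1 * 'C(v + k.+1, k.+1) = v.+1 * 'C(v.+1 + k, k))%N.
  by rewrite mul_bin_left addSnnS (_ : v + k.+1 - k = v.+1)%N //; lia.
have E2 : ((v.+1 + k) * 'C(v + k, k) = v.+1 * 'C(v.+1 + k, k))%N.
  by have := mul_bin_down (v.+1 + k) k; rewrite addSn /= => ->; congr (_ * _)%N; lia.
have E3 : ('C(v.+1 + k.+1, k.+1) = 'C(v + k.+1, k.+1) + 'C(v.+1 + k, k))%N.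
  by rewrite addSn binS addSnnS.
(* p stands for the binomial of v + k over k - 1, read as 0 when k = 0. *)
have [p E4 E5] : exists2 p : int, 'C(v.+1 + k, k)%:R = 'C(v + k, k)%:R + p &
    sh (cb v.+1) k = p * 'C(v.+1 + k, k)%:R.
  case: k {E1 E2 E3} => [|k].
    by exists 0; rewrite ?mul0r // !bin0 addr0.
  exists ('C(v.+1 + k, k)%:R); rewrite /= /cb ?natrM //.
  by rewrite addSn binS addSnnS natrD.
rewrite E5 /cb /ca natrM natrM natrX E3 natrD.
have := congr1 (fun x => x%:R : int) E1; have := congr1 (fun x => x%:R : int) E2.
rewrite !natrM; move: E4.
move: ('C(v.+1 + k, k)%:R : int) ('C(v + k, k)%:R : int) ('C(v + k.+1, k.+1)%:R : int) => B b b1.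
move=> EB H2 H1.
transitivity ((v.+1%:R * B) * b1 - (v.+1%:R * B) * b); last by rewrite EB; ring.
by rewrite -{1}H2 -H1 natrD -!natr1; ring.
Qed.

(** The coefficient of z in the same product also involves that of z^2; differentiating the power in
    z gives a second relation, and eliminating z^2 between them accounts for the factors v and v +
    1. *)
Lemma fO_cb_rec v : peq (v%:R * fO (cb v))
  (v.+1%:R * ((1 + 'X^2) * fO (cb v.+1) - 2%:R * 'X * fE (ca v.+1))).
Proof.
have [e1 E1] := X2fO (cb v.+1).
exists (- v.+1%:R * e1).
have -> : (1 + 'X^2) * fO (cb v.+1) - 2%:R * 'X * fE (ca v.+1) =
  fO (cb v.+1) + 'X^2 * fO (cb v.+1) - 2%:R * ('X * fE (ca v.+1)) by ring.
rewrite E1 XfE.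
have -> : v%:R * fO (cb v) = v.+1%:R * (fO (cb v.+1) + fO (sh (cb v.+1)) - 2%:R * fO (ca v.+1)).
  rewrite mulrBr; apply/eqP; rewrite eq_sym subr_eq xsumD !xsumZ xsumD.
  apply/eqP; apply: xsum_ext => k; rewrite cb_rec; ring.
by ring.
Qed.

Lemma fE_ha_rec m : peq (fE (ha m.+1)) ((1 + 'X^2) * fE (ha m) + 2%:R * 'X * fO (hb m)).
Proof.
have [e1 E1] := X2fE (ha m); have [e2 E2] := XfO (hb m).
exists (- e1 - 2%:R * e2).
have -> : (1 + 'X^2) * fE (ha m) + 2%:R * 'X * fO (hb m) =
  fE (ha m) + 'X^2 * fE (ha m) + 2%:R * ('X * fO (hb m)) by ring.
rewrite E1 E2.
have -> : fE (ha m.+1) = fE (ha m) + fE (sh (ha m)) + 2%:R * fE (sh (hb m)).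
  rewrite xsumZ !xsumD; apply: xsum_ext => -[|k] /=; first by rewrite /ha !bin0.
  by rewrite /ha /hb binS !natrX !natrM !natrD; ring.
by ring.
Qed.

Lemma hb_rec m k :
  m.+2%:R * hb m.+1 k = m.+1%:R * (2%:R * ha m k + hb m k + sh (hb m) k) :> int.
Proof.
have E1 : (k.+1 * 'C(m.+1, k.+1) = m.+1 * 'C(m, k))%N by rewrite -mul_bin_diag.
have [p E4 E5] : exists2 p : int, 'C(m.+1, k)%:R = 'C(m, k)%:R + p &
    sh (hb m) k = p * 'C(m, k)%:R.
  case: k {E1} => [|k]; first by exists 0; rewrite ?mul0r // !bin0 addr0.
  by exists ('C(m, k)%:R); rewrite /= /hb ?natrM // binS natrD.
have E2 : m.+1%:R * 'C(m, k)%:R = (m.+1%:R - k%:R) * 'C(m.+1, k)%:R :> int.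
  have [Hk|Hk] := leqP k m.+1; last by rewrite !bin_small ?mulr0 //; lia.
  by rewrite -natrB // -!natrM; have := mul_bin_down m.+1 k => /= ->.
rewrite E5 /hb /ha natrX !natrM.
have := congr1 (fun x => x%:R : int) E1; rewrite !natrM; move: E4 E2.
have -> : 'C(m, k.+1)%:R = 'C(m.+1, k.+1)%:R - 'C(m, k)%:R :> int.
  by rewrite binS natrD addrK.
move: ('C(m.+1, k)%:R : int) ('C(m.+1, k.+1)%:R : int) ('C(m, k)%:R : int) => B B1 b EB H2 H1'.
transitivity ((m.+1%:R * b) * B1 + (m.+1%:R * b) * B); last by rewrite EB; ring.
by rewrite {1}H2 -H1' -!natr1; ring.
Qed.

(** The same elimination of the coefficient of z^2, now for ((1 + Xz)(1 + X/z))^(m+1). *)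
Lemma fO_hb_rec m : peq (m.+2%:R * fO (hb m.+1))
  (m.+1%:R * (2%:R * 'X * fE (ha m) + (1 + 'X^2) * fO (hb m))).
Proof.
have [e1 E1] := X2fO (hb m).
exists (- m.+1%:R * e1).
have -> : 2%:R * 'X * fE (ha m) + (1 + 'X^2) * fO (hb m) =
  2%:R * ('X * fE (ha m)) + fO (hb m) + 'X^2 * fO (hb m) by ring.
rewrite E1 XfE.
have -> : m.+2%:R * fO (hb m.+1) = m.+1%:R * (2%:R * fO (ha m) + fO (hb m) + fO (sh (hb m))).
  rewrite !xsumZ !xsumD xsumZ; apply: xsum_ext => k; exact: hb_rec.
by ring.
Qed.

(* fE (ca v) and fO (cb v) are the coefficients of z^0 and z^1 in
   ((1 - X z) (1 - X / z))^-(v + 1), and fE (ha m) and fO (hb m) those in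
   ((1 + X z) (1 + X / z))^m: both pairs obey the same recursion. *)
Lemma euler_pair v :
  peq ((1 - 'X^2) ^+ (2 * v + 1) * fE (ca v)) (fE (ha v)) /\
  peq (v%:R * ((1 - 'X^2) ^+ (2 * v + 1) * fO (cb v))) (v.+1%:R * fO (hb v)).
Proof.
elim: v => [|v [IH1 IH2]].
  split.
    have [e E] := X2fE (ca 0); exists (- e).
    rewrite expr1 mulrBl mul1r E.
    have -> : fE (ha 0) = fE (fun k => (k == 0%N)%:R).
      by apply: xsum_ext => -[|k]; rewrite /ha ?bin0n.
    have -> : fE (fun k => (k == 0%N)%:R) = fE (ca 0) - fE (sh (ca 0)).
      apply/eqP; rewrite eq_sym subr_eq xsumD; apply/eqP; apply: xsum_ext => -[|k] /=;
        by rewrite /ca ?add0n ?binn ?addr0 ?add0r.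
    by ring.
  have -> : fO (hb 0) = 0.
    by rewrite /xsum big1 // => k _; rewrite /hb bin0n /= muln0 scale0r.
  by rewrite mul0r mulr0; exact: peq_refl.
have [e1 E1] := fE_ca_rec v; have [e2 E2] := fO_cb_rec v.
have [f1 F1] := fE_ha_rec v; have [f2 F2] := fO_hb_rec v.
case: IH1 => [h1 IH1]; case: IH2 => [h2 IH2].
set P := (1 - 'X^2) ^+ (2 * v + 1) in IH1 IH2.
have -> : (1 - 'X^2) ^+ (2 * v.+1 + 1) = P * (1 - 'X^2) ^+ 2 :> Z.
  by rewrite -exprD; congr (_ ^+ _); lia.
move: (fE (ca v)) (fO (cb v)) (fE (ca v.+1)) (fO (cb v.+1)) (fE (ha v)) (fO (hb v))
  (fE (ha v.+1)) (fO (hb v.+1)) E1 E2 F1 F2 IH1 IH2 => a b A B x y x' y' E1 E2 F1 F2 IH1 IH2.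
split.
  apply: (@peq_nat v).
  exists (v.+1%:R * (1 + 'X^2) * h1 + 2%:R * 'X * h2 - v.+1%:R * f1
     - P * (v.+1%:R * (1 + 'X^2) * e1 + 2%:R * 'X * e2)).
  (* The recursions for [ca] and [cb] lower v, so this 2 by 2 system is inverted by its adjugate.
     Its determinant (1 + X^2)^2 - (2X)^2 = (1 - X^2)^2 explains why the exponent grows by 2. *)
  transitivity (P * (v.+1%:R * (1 + 'X^2) * (a - 'X^N * e1) + 2%:R * 'X * (v%:R * b - 'X^N * e2))).
    by rewrite E1 E2; ring.
  transitivity (v.+1%:R * (1 + 'X^2) * (P * a) + 2%:R * 'X * (v%:R * (P * b))
     - 'X^N * (P * (v.+1%:R * (1 + 'X^2) * e1 + 2%:R * 'X * e2))); first by ring.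
  by rewrite IH1 IH2 F1; ring.
exists (2%:R * 'X * v.+1%:R * h1 + (1 + 'X^2) * h2 - f2
     - P * (2%:R * 'X * v.+1%:R * e1 + (1 + 'X^2) * e2)).
transitivity (P * (2%:R * 'X * v.+1%:R * (a - 'X^N * e1) + (1 + 'X^2) * (v%:R * b - 'X^N * e2))).
  by rewrite E1 E2; ring.
transitivity (2%:R * 'X * v.+1%:R * (P * a) + (1 + 'X^2) * (v%:R * (P * b))
   - 'X^N * (P * (2%:R * 'X * v.+1%:R * e1 + (1 + 'X^2) * e2))); first by ring.
by rewrite IH1 IH2 F2; ring.
Qed.

(** In the difference of the two recursions, [fE] and [fO] at m + 1 share the factor 1 + X^2 + 2X =
    (1 + X)^2, up to sign; [euler_pair] at m turns the rest into [ha] and [hb]. *)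
Lemma euler_diff m : peq ((1 + 'X) ^+ 2 * (1 - 'X^2) ^+ (2 * m + 1) * (fE (ca m.+1) - fO (cb m.+1)))
  (fE (ha m) - fO (hb m)).
Proof.
have [e1 E1] := fE_ca_rec m; have [e2 E2] := fO_cb_rec m.
have [[h1 IH1] [h2 IH2]] := euler_pair m.
set P := (1 - 'X^2) ^+ (2 * m + 1) in IH1 IH2 *.
apply: (@peq_nat m); apply: peq_1X; apply: peq_1X.
move: (fE (ca m)) (fO (cb m)) (fE (ca m.+1)) (fO (cb m.+1)) (fE (ha m)) (fO (hb m))
  E1 E2 IH1 IH2 => a b A B x y E1 E2 IH1 IH2.
exists ((1 - 'X) ^+ 2 * (m.+1%:R * h1 - h2 - P * (m.+1%:R * e1 - e2))).
transitivity ((1 - 'X) ^+ 2 * P * (m.+1%:R * (a - 'X^N * e1) - (m%:R * b - 'X^N * e2))).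
  by rewrite E1 E2; ring.
transitivity ((1 - 'X) ^+ 2 * (m.+1%:R * (P * a) - (m%:R * (P * b)) - 'X^N * (P * (m.+1%:R * e1 - e2)))).
  by ring.
by rewrite IH1 IH2; ring.
Qed.

End Series.

(** * The series of the middle letters and the product of series *)

Section Convolution.
Variable N : nat.
Local Notation peq := (peq N).
Local Notation gs := (gs N).

Definition cMz (m l : nat) : int := (cM m l)%:R.

Lemma gs_ext c c' : c =1 c' -> gs c = gs c'.
Proof. by move=> H; apply/polyP => i; rewrite !coef_poly H. Qed.

Lemma gsD c c' : gs c + gs c' = gs (fun l => c l + c' l).
Proof. by apply/polyP => i; rewrite coefD !coef_poly; case: ifP; rewrite ?addr0. Qed.

Lemma X_gs c : peq ('X * gs c) (gs (sh c)).
Proof.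
apply/peqP => i Hi; rewrite coefXM !coef_poly Hi; case: i Hi => [|i] //= Hi.
by rewrite (ltnW Hi).
Qed.

Lemma cM_rec m : peq ((1 - 'X) * gs (cMz m.+1)) ((1 + 'X) * gs (cMz m)).
Proof.
have [e1 E1] := X_gs (cMz m.+1); have [e2 E2] := X_gs (cMz m).
exists (- e1 - e2); rewrite mulrBl mulrDl !mul1r E1 E2.
have -> : gs (cMz m.+1) = gs (cMz m) + gs (sh (cMz m)) + gs (sh (cMz m.+1)).
  rewrite !gsD; apply: gs_ext => -[|l] /=; rewrite /cMz /=.
    by rewrite big_ord0 muln0 addn0 !addr0.
  rewrite big_ord_recr /=; move: (\sum_(l' < l) _)%N (cM m l) (cM m l.+1) => s x y.
  by ring.
by ring.
Qed.

Lemma cM_series m : (0 < N)%N -> peq ((1 - 'X) ^+ m * gs (cMz m)) ((1 + 'X) ^+ m).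
Proof.
move=> HN; elim: m => [|m [e IH]].
  rewrite !expr0 mul1r; exists 0; rewrite mulr0 addr0.
  by apply/polyP => i; rewrite coef_poly coef1 /cMz /=; case: i => [|i]; rewrite ?HN //; case: ifP.
have [e1 E1] := cM_rec m; exists ((1 - 'X) ^+ m * e1 + (1 + 'X) * e).
rewrite !exprSr -mulrA E1 mulrDr.
have -> : (1 - 'X) ^+ m * ((1 + 'X) * gs (cMz m)) = (1 + 'X) * ((1 - 'X) ^+ m * gs (cMz m)) by ring.
by rewrite IH; ring.
Qed.

Lemma coef_xsum_gs a c M j : (j < N)%N ->
  (xsum N a c * gs M)`_j = \sum_(k < j.+1 | (2 * k + a <= j)%N) c k * M (j - (2 * k + a))%N.
Proof.
move=> Hj; rewrite mulr_suml coef_sum big_mkord.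
have -> : \sum_(k < j.+1 | (2 * k + a <= j)%N) c k * M (j - (2 * k + a))%N =
    \sum_(k < N | (2 * k + a <= j)%N && (k < j.+1)%N) c k * M (j - (2 * k + a))%N.
  exact: (big_ord_widen_cond N (fun k => 2 * k + a <= j)%N
    (fun k => c k * M (j - (2 * k + a))%N)).
rewrite [RHS]big_mkcond.
apply: eq_bigr => k _; rewrite -scalerAl coefZ coefXnM coef_poly.
have [H|H] := leqP (2 * k + a)%N j; last by rewrite mulr0.
have -> : (k < j.+1)%N by lia.
by rewrite (leq_ltn_trans (leq_subr _ _) Hj).
Qed.

End Convolution.

Lemma hs_identity (m : nat) (d : nat -> int) :
  (forall j, d j =
     \sum_(k < j.+1 | (2 * k + 0 <= j)%N) ca m.+1 k * cMz m.+2 (j - (2 * k + 0))%N -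
     \sum_(k < j.+1 | (2 * k + 1 <= j)%N) cb m.+1 k * cMz m.+2 (j - (2 * k + 1))%N) ->
  forall M, \sum_(j < M.+1) d j * (hs_den m.+2)`_(M - j) = (hs_num m.+2)`_M.
Proof.
move=> Hd M; pose N := M.+1.
transitivity ((gs N d * hs_den m.+2)`_M).
  by rewrite coefM; apply: eq_bigr => j _; rewrite coef_poly ltn_ord.
move: M @N => M N; suff /peqP H : peq N (gs N d * hs_den m.+2) (hs_num m.+2) by apply: H.
have HN : (0 < N)%N by [].
(* Truncated constant term in z of (1 - z) ((1 - Xz)(1 - X/z))^-n, where n = m + 2. *)
pose f := xsum N 0 (ca m.+1) - xsum N 1 (cb m.+1).
have Ed : peq N (gs N d) (f * gs N (cMz m.+2)).
  apply/peqP => j Hj; rewrite coef_poly Hj Hd /f mulrBl coefB.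
  by rewrite !coef_xsum_gs.
have [e1 E1] := Ed; have [e2 E2] := cM_series m.+2 HN.
have [e3 E3] := euler_diff N m; rewrite -/f in E3.
(* The binomials vanish beyond the ranges of the numerator, so modulo X^N both sums may run up to
   N. *)
have H4 : peq N (xsum m.+1 0 (ha m) - xsum m 1 (hb m)) (xsum N 0 (ha m) - xsum N 1 (hb m)).
  apply: peqD; last apply: peqN; apply: xsum_widen => k Hk; rewrite /ha /hb.
    by rewrite bin_small.
  by rewrite (bin_small (_ : (m < k.+1)%N)) ?muln0.
have -> : hs_den m.+2 = (1 - 'X) ^+ m.+2 * (1 - 'X^2) ^+ (2 * m + 1).
  by rewrite /hs_den; congr (_ * _ ^+ _); lia.
have -> : hs_num m.+2 = (1 + 'X) ^+ m * (xsum m.+1 0 (ha m) - xsum m 1 (hb m)).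
  rewrite /hs_num !subSS !subn0; congr (_ * (_ - _)).
  by apply: eq_bigr => k _; rewrite addn0.
have [e4 E4] := H4; rewrite E4.
have {}E3 : xsum N 0 (ha m) - xsum N 1 (hb m) =
  (1 + 'X) ^+ 2 * (1 - 'X^2) ^+ (2 * m + 1) * f - 'X^N * e3 by rewrite E3 addrK.
rewrite E3 E1; set Q := (1 - 'X^2) ^+ _.
exists (e1 * ((1 - 'X) ^+ m.+2 * Q) + f * Q * e2 + (1 + 'X) ^+ m * e3 - (1 + 'X) ^+ m * e4).
transitivity (f * Q * ((1 - 'X) ^+ m.+2 * gs N (cMz m.+2)) + 'X^N * e1 * ((1 - 'X) ^+ m.+2 * Q)).
  by ring.
by rewrite E2 -[m.+2]addn2 exprD; ring.
Qed.

(** * The theorem *)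

(** [f] is linear and injective on P only, so all vectors involved have to be kept inside P, a
    subspace. *)
Lemma quot_dim_image (F : fieldType) (V W : lmodType F) (f : V -> W) (P A B : set V) d :
  (forall c x y, P x -> P y -> P (c *: x + y)) -> P 0 -> A `<=` P -> B `<=` P ->
  set_inj P f -> (forall c x y, P x -> P y -> f (c *: x + y) = c *: f x + f y) ->
  quot_dim A B d -> quot_dim (f @` A) (f @` B) d.
Proof.
move=> PL P0 AP BP fi fL [v [Av Hv]]; exists (f \o v); split=> [i|_ [x Ax <-]].
  by exists (v i).
have f0 : f 0 = 0.
  have := fL 1 0 0 P0 P0; rewrite !scale1r addr0 => E.
  by apply: (addIr (f 0)); rewrite add0r -E.
have Psum (c : 'rV[F]_d) (I : seq 'I_d) : P (\sum_(i <- I) c 0 i *: v i).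
  elim: I => [|i I IH]; first by rewrite big_nil.
  by rewrite big_cons; apply: PL => //; exact: AP.
have fsum (c : 'rV[F]_d) (I : seq 'I_d) :
    f (\sum_(i <- I) c 0 i *: v i) = \sum_(i <- I) c 0 i *: f (v i).
  elim: I => [|i I IH]; first by rewrite !big_nil.
  by rewrite !big_cons fL ?IH //; exact: AP.
have fsub (c : 'rV[F]_d) : f (x - \sum_i c 0 i *: v i) = f x - \sum_i c 0 i *: (f \o v) i.
  rewrite addrC -scaleN1r fL //; last exact: AP.
  by rewrite fsum scaleN1r addrC.
have Hiff (c : 'rV[F]_d) : (f @` B) (f x - \sum_i c 0 i *: (f \o v) i) <->
    B (x - \sum_i c 0 i *: v i).
  rewrite -fsub; split=> [[b Bb /fi E]|]; last by exists (x - \sum_i c 0 i *: v i).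
  rewrite -E ?inE //; first exact: BP.
  by rewrite addrC -scaleN1r; apply: PL => //; exact: AP.
have [c [Hc Uc]] := Hv x Ax; exists c; split; first exact/Hiff.
by move=> c' /Hiff /Uc.
Qed.

Section Main.
Variables (F : fieldType) (q : F) (g m : nat).
Hypothesis q_neq0 : q != 0.
Hypothesis q_free : forall k, (0 < k)%N -> q ^+ k != 1.
Local Notation n := m.+2.

Lemma Linv_hilbert : hilbert_series (@Linv_fil F q g n) (hs_num n) (hs_den n).
Proof.
exists (fun j => size (nwsw g n j 0) - size (nwsw g n j 1))%N; split.
  by move=> j; exact: quot_dim_Linv.
apply: (@hs_identity m (fun j => (size (nwsw g n j 0) - size (nwsw g n j 1))%N%:R)) => j.
(* E being onto, the subtraction of naturals is a genuine one and can be read in the integers. *)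
have Hle : (size (nwsw g n j 1) <= size (nwsw g n j 0))%N.
  by rewrite -(eqP (Emx_full g m.+1 q_neq0 q_free j)) rank_leq_row.
rewrite natrB // (size_nwsw g n j 0) (size_nwsw g n j 1) !natr_sum.
congr (_ - _); apply: eq_bigr => k _; rewrite !natrM /ca /cb /cMz.
  by rewrite /cB addn0 natrX; ring.
by rewrite /cB addn1 natrM; ring.
Qed.

Lemma Linv_image_hilbert (Y : Type) (rel : term F Y -> term F Y -> Prop)
    (Q : set (presAlg rel)) (f : alekseev q g n -> presAlg rel) :
  subalg_iso (@Linv F q g n) Q f ->
  hilbert_series (fun j => f @` @Linv_fil F q g n j) (hs_num n) (hs_den n).
Proof.
case=> [[_ finj _] _ fL _]; have [d [Hd Hs]] := Linv_hilbert.
exists d; split=> // j.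
have L0 : @Linv F q g n 0.
  by apply/(LinvP q_neq0 q_free); rewrite !op0.
have LL c x y : @Linv F q g n x -> Linv y -> Linv (c *: x + y).
  move=> /(LinvP q_neq0 q_free) [H1 H2 H3] /(LinvP q_neq0 q_free) [H4 H5 H6].
  by apply/(LinvP q_neq0 q_free); rewrite !opD // !opZ // H1 H2 H3 H4 H5 H6 scaler0 addr0.
have -> : filpred (fun j => f @` @Linv_fil F q g n j) j = f @` filpred (@Linv_fil F q g n) j.
  case: (j) => [|j'] //=; rewrite image_set1; congr [set _].
  have := fL 1 0 0 L0 L0; rewrite !scale1r addr0 => E.
  by apply: (addIr (f 0)); rewrite add0r -E.
apply: (quot_dim_image (P := @Linv F q g n)) => //.
- by move=> x [].
- by case: (j) => [|j'] x //=; [move=> ->|case].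
Qed.

End Main.

Lemma indet_neq0 (R : realType) : indet R != 0.
Proof. by rewrite /indet tofrac_eq0 polyX_eq0. Qed.

Lemma indet_free (R : realType) k : (0 < k)%N -> indet R ^+ k != 1.
Proof.
move=> Hk; rewrite /indet -tofracXn -tofrac1 tofrac_eq; apply/eqP => E.
by have := congr1 (fun p : {poly R[i]} => size p) E; rewrite size_polyXn size_poly1; case: k Hk {E}.
Qed.

Theorem theorem1p3 (R : realType) (g r n : nat)
    (hr : (1 < r)%N) (hn : n = (2 * g + r - 1)%N) (hn1 : (1 < n)%N) :
  [/\ (* the invariants of the Alekseev algebra over C(q) *)
      hilbert_series (@Linv_fil (ratC R) (indet R) g n) (hs_num n) (hs_den n),
      (* the skein algebra over C(q^(1/4)) *)
      forall phi : @alekseev (ratC R) (indet R ^+ 4) g n ->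
                   @skein R g n (ratC R) (indet R),
        subalg_iso (@Linv (ratC R) (indet R ^+ 4) g n) setT phi ->
        hilbert_series
          (fun j => phi @` @Linv_fil (ratC R) (indet R ^+ 4) g n j)
          (hs_num n) (hs_den n) &
      (* the Askey-Wilson algebra over C(q) *)
      forall psi : @alekseev (ratC R) (indet R) 0 n ->
                   @Utens (ratC R) (indet R) n,
        subalg_iso (@Linv (ratC R) (indet R) 0 n) (@AW (ratC R) (indet R) n)
          psi ->
        (forall A x, is_Lambda A x -> psi (@qtrace (ratC R) (indet R) 0 n A) = x) ->
        hilbert_series
          (fun j => psi @` @Linv_fil (ratC R) (indet R) 0 n j)
          (hs_num n) (hs_den n)].
Proof.
(* With n = m + 2 the natural subtractions n - 2 and 2n - 3 of the formula are exact. *)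
case: n hn1 {hn} => [|[|m]] // _.
have q0 := indet_neq0 R; have qf := @indet_free R.
split; first exact: Linv_hilbert.
  move=> phi; apply: Linv_image_hilbert; first by rewrite expf_neq0.
  (* Here the indeterminate is q^(1/4), and its fourth power q is no root of unity either. *)
  by move=> k Hk; rewrite -exprM; apply: qf; rewrite muln_gt0.
by move=> psi Hpsi _; apply: (Linv_image_hilbert q0 qf Hpsi).
Qed.
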